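(* Let $\alpha,\beta\in(0,1)$. There is a constant $c(\alpha,\beta)>0$ depending only on $\alpha,\beta$ (and on the fixed bounded Vilenkin group $G_{\mathbf m}$) such that for every $p\in[1,\infty]$, every $f\in L^p(G_{\mathbf m}^2)$ and all integers $k,l\ge 1$ and $n,m$ with $M_k\le n<M_{k+1}$ and $M_l\le m<M_{l+1}$, $$\left\Vert \sigma_{n,m}^{-\alpha,-\beta}(f)-f\right\Vert_p\le c(\alpha,\beta)\Big(\omega_1(f,1/M_{k-1})_p\,M_k^{\alpha}+\omega_2(f,1/M_{l-1})_p\,M_l^{\beta}+\omega_{1,2}(f,1/M_{k-1},1/M_{l-1})_p\,M_k^{\alpha}M_l^{\beta}+\sum_{r=0}^{k-2}\frac{M_r}{M_k}\omega_1(f,1/M_r)_p+\sum_{s=0}^{l-2}\frac{M_s}{M_l}\omega_2(f,1/M_s)_p\Big),$$ where empty sums are $0$.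
   Context: Vilenkin group: $\mathbf m=(m_0,m_1,\dots)$ is a fixed bounded sequence of integers $m_k\ge 2$. $G_{\mathbf m}=\prod_{k\ge0}\mathbb Z/m_k\mathbb Z$ is the compact product group (discrete topology on each factor, coordinatewise addition modulo $m_k$), with elements $x=(x_0,x_1,\dots)$, $x_k\in\{0,\dots,m_k-1\}$, and $\mu$ is its normalized Haar measure; the normalized Haar measure on $G_{\mathbf m}^2=G_{\mathbf m}\times G_{\mathbf m}$ is also denoted $\mu$. Put $I_0=G_{\mathbf m}$ and $I_n=\{x\in G_{\mathbf m}:x_0=\dots=x_{n-1}=0\}$ for $n\ge1$. Put $M_0=1$, $M_{k+1}=m_kM_k$. Each integer $n\ge 0$ is uniquely $n=\sum_{j\ge0}n_jM_j$ with $n_j\in\{0,\dots,m_j-1\}$, finitely many nonzero. Vilenkin system: $r_k(x)=\exp(2\pi i x_k/m_k)$ and $\psi_n(x)=\prod_{k\ge0}r_k(x)^{n_k}$. Spaces: functions are complex valued. For $1\le p<\infty$, $L^p(G_{\mathbf m}^2)$ has norm $\|f\|_p=(\int_{G_{\mathbf m}^2}|f|^p\,d\mu)^{1/p}$; by convention $L^\infty(G_{\mathbf m}^2)$ means $C(G_{\mathbf m}^2)$, the continuous functions with the supremum norm. Fourier coefficients: $\widehat f(i,j)=\int_{G_{\mathbf m}^2}f(x,y)\overline{\psi_i(x)}\,\overline{\psi_j(y)}\,d\mu(x,y)$. Cesàro numbers: $A_0^{\gamma}=1$, $A_n^{\gamma}=\frac{(\gamma+1)\cdots(\gamma+n)}{n!}$.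 Cesàro means: $$\sigma_{n,m}^{-\alpha,-\beta}(x,y,f)=\frac1{A_n^{-\alpha}A_m^{-\beta}}\sum_{i=0}^n\sum_{j=0}^mA_{n-i}^{-\alpha}A_{m-j}^{-\beta}\widehat f(i,j)\psi_i(x)\psi_j(y),$$ and $\sigma_{n,m}^{-\alpha,-\beta}(f)$ is this function of $(x,y)$. Moduli of continuity: $\omega_1(f,1/M_n)_p=\sup_{u\in I_n}\|f(\cdot-u,\cdot)-f(\cdot,\cdot)\|_p$, $\omega_2(f,1/M_n)_p=\sup_{v\in I_n}\|f(\cdot,\cdot-v)-f(\cdot,\cdot)\|_p$, $\omega_{1,2}(f,1/M_n,1/M_m)_p=\sup_{(u,v)\in I_n\times I_m}\|f(\cdot-u,\cdot-v)-f(\cdot-u,\cdot)-f(\cdot,\cdot-v)+f(\cdot,\cdot)\|_p$. *)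

(* Defs.v *)
From HB Require Import structures.
From mathcomp Require Import all_boot all_order all_algebra.
From mathcomp Require Import all_classical all_reals all_analysis.
From mathcomp Require Import complex.

Set Implicit Arguments.
Unset Strict Implicit.
Unset Printing Implicit Defensive.

Import Order.TTheory GRing.Theory Num.Theory.
Import numFieldNormedType.Exports.

Local Open Scope classical_set_scope.
Local Open Scope complex_scope.
Local Open Scope ring_scope.

HB.instance Definition _ (U V : ptopologicalType) := Pointed.on (U * V)%type.

Definition borel (T : ptopologicalType) := g_sigma_algebraType (@open T).

(* ['Z_n] is Z/nZ only for [1 < n], so [1 < m k] for all [k] must be assumed. *)
Definition vilenkin (m : nat -> nat) : Type :=
  prod_topology (fun k => discrete_topology 'Z_(m k)).

Section VilenkinGroup.
Variable m : nat -> nat.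

HB.instance Definition _ := Topological.on (vilenkin m).

(* The coordinate is returned in ['Z_(m k)] rather than in its discrete alias,
   so that it can be added and read as a natural number below [m k]. *)
Definition coord (x : vilenkin m) (k : nat) : 'Z_(m k) := x k.

Definition vil_zero : vilenkin m := fun k => (0 : 'Z_(m k)).
Definition vil_opp (x : vilenkin m) : vilenkin m := fun k => - coord x k.
Definition vil_add (x y : vilenkin m) : vilenkin m :=
  fun k => coord x k + coord y k.

Fact vil_addA : associative vil_add.
Proof.
by move=> x y z; apply: functional_extensionality_dep => k; exact: addrA.
Qed.

Fact vil_addC : commutative vil_add.
Proof.
by move=> x y; apply: functional_extensionality_dep => k; exact: addrC.
Qed.

Fact vil_add0 : left_id vil_zero vil_add.
Proof.
by move=> x; apply: functional_extensionality_dep => k; exact: add0r.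
Qed.

Fact vil_addN : left_inverse vil_zero vil_opp vil_add.
Proof.
by move=> x; apply: functional_extensionality_dep => k; exact: addNr.
Qed.

HB.instance Definition _ := isPointed.Build (vilenkin m) vil_zero.
HB.instance Definition _ := GRing.isZmodule.Build (vilenkin m)
  vil_addA vil_addC vil_add0 vil_addN.

End VilenkinGroup.

Notation "''G2_' m" := (vilenkin m * vilenkin m)%type
  (at level 8, m at level 2, format "''G2_' m") : type_scope.

Section VilenkinSystem.
Variables (R : realType) (m : nat -> nat).

Definition vilM (k : nat) : nat := \prod_(0 <= j < k) m j.

Definition vil_digit (n j : nat) : nat := (n %/ vilM j) %% m j.

Definition vilI (n : nat) : set (vilenkin m) :=
  [set x | forall j, (j < n)%N -> coord x j = 0].

Definition expi (t : R) : R[i] := cos t +i* sin t.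

Definition rademacher (k : nat) (x : vilenkin m) : R[i] :=
  expi (2 * pi * (coord x k)%:R / (m k)%:R).

(* The product stops at [k = n]: when all [m j >= 2], [vilM k >= 2 ^ k > n] for
   [k >= n], so the remaining digits of [n] vanish. *)
Definition vil_psi (n : nat) (x : vilenkin m) : R[i] :=
  \prod_(0 <= k < n.+1) rademacher k x ^+ vil_digit n k.

End VilenkinSystem.

Section Spaces.
Variables (R : realType) (m : nat -> nat).
Variable mu : probability (borel 'G2_m) R.
Implicit Types (f : 'G2_m -> R[i]) (p : \bar R).

(* [mu] has total mass 1 as a [probability]; invariance makes it the normalized
   Haar measure of the compact group. *)
Definition is_haar : Prop :=
  forall (a : 'G2_m) (A : set 'G2_m), measurable (A : set (borel 'G2_m)) ->
    mu [set a + x | x in A] = mu A.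

Definition cmeasurable f : Prop :=
  measurable_fun [set: borel 'G2_m] (fun z => complex.Re (f z)) /\
  measurable_fun [set: borel 'G2_m] (fun z => complex.Im (f z)).

Definition cintegral f : R[i] :=
  (\int[mu]_z complex.Re (f z)) +i* (\int[mu]_z complex.Im (f z)).

(* For [p = +oo] this is the supremum, not the essential supremum. The value for
   [p = -oo] is irrelevant, as [1 <= p] throughout. *)
Definition Lpnorm p f : \bar R :=
  match p with
  | r%:E => Lnorm mu r%:E (fun z => (Normc.normc (f z))%:E)
  | _ => ereal_sup [set (Normc.normc (f z))%:E | z in [set: 'G2_m]]
  end.

Definition in_Lp p f : Prop :=
  match p with
  | r%:E => cmeasurable f /\ (Lpnorm p f < +oo)%E
  | _ => continuous (f : 'G2_m -> R[i]^o)
  end.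

Definition fourier_coef f (i j : nat) : R[i] :=
  cintegral (fun z => f z * (vil_psi R i z.1)^* * (vil_psi R j z.2)^*).

Definition cesaro_number (g : R) (n : nat) : R :=
  (\prod_(1 <= i < n.+1) (g + i%:R)) / n`!%:R.

(* [cesaro_mean g h] has orders [g] and [h]. *)
Definition cesaro_mean (g h : R) (n n' : nat) f (z : 'G2_m) : R[i] :=
  ((cesaro_number g n * cesaro_number h n')^-1)%:C *
  \sum_(0 <= i < n.+1) \sum_(0 <= j < n'.+1)
    (cesaro_number g (n - i) * cesaro_number h (n' - j))%:C *
    fourier_coef f i j * vil_psi R i z.1 * vil_psi R j z.2.

Definition omega1 p f (n : nat) : \bar R :=
  ereal_sup [set Lpnorm p (fun z => f (z.1 - u, z.2) - f z) | u in vilI n].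

Definition omega2 p f (n : nat) : \bar R :=
  ereal_sup [set Lpnorm p (fun z => f (z.1, z.2 - v) - f z) | v in vilI n].

Definition omega12 p f (n n' : nat) : \bar R :=
  ereal_sup [set Lpnorm p (fun z => f (z.1 - w.1, z.2 - w.2)
      - f (z.1 - w.1, z.2) - f (z.1, z.2 - w.2) + f z)
    | w in vilI n `*` vilI n'].

End Spaces.

(* Main.v *)
(* The kernel of a Cesaro mean of order -a is split along the scales of the
   group: its multiplier is a telescoping sum of multipliers that are constant
   on the blocks [q * M t, q.+1 * M t), whose kernels are supported in [vilI t],
   so that their L^1 norms are bounded by the square roots of the sums of the
   squared block values. For the multiplier A_(n-j) / A_n on [0, n] the
   monotonicity of A alone makes these norms sum up to O(M_k^a); for the same
   multiplier minus 1, which vanishes at 0 and is O(1/n)-Lipschitz on [0, n/2],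
   the restriction to [0, M_s) has a kernel of L^1 norm O(M_s / M_k).

   Let E be the projection onto the frequencies below M_(k-1), so that
   f - E f is bounded by omega_1(f, 1/M_(k-1)), and T the one-dimensional Cesaro
   mean. Then T - 1 = P + Q, where Q = (T - 1)(1 - E) costs M_k^a times the
   modulus, and P = (T - 1) E is bounded, and is treated block by block
   [M_r, M_(r+1)), which gives the sum over r. With P', Q' in the second variable,
     T T' - 1 = (P + Q)(P' + Q') + (P + Q) + (P' + Q').

   Everything happens for the partial Fourier sum F of f of order
   (M_(k+1), M_(l+1)), which has the same Cesaro means as f and for which
   translation-invariant estimates involve finite sums only. F is the
   average of the translates of f over a box of [vilI]'s, so Minkowski's integral
   inequality bounds F - f by the moduli of f, and the moduli of F by those of f. *)

Require Import Defs.
From mathcomp Require Import all_boot all_order all_algebra.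
From mathcomp Require Import all_classical all_reals all_analysis.
From mathcomp Require Import complex measurable_realfun ring lra zify.

Set Implicit Arguments.
Unset Strict Implicit.
Unset Printing Implicit Defensive.

Import Order.TTheory GRing.Theory Num.Theory.
Import numFieldNormedType.Exports.

Local Open Scope classical_set_scope.
Local Open Scope ring_scope.

(** The obstacle is that a negative order amplifies high frequencies: the multiplier A_(n-j) / A_n
    climbs from 1 at j = 0 to 1 / A_n, of size M_k^a, at j = n, so the means are not uniformly
    bounded and the factor M_k^a may only multiply the finest modulus. The cut at M_(k-1) achieves
    this: j < M_(k-1) forces 2 j <= n, which stays away from the peak.

    The two kernel bounds control sums of squares differently. In the Lipschitz case, the number of
    blocks times the squared increment decays geometrically as the blocks shrink. In the monotone
    case, the increments have a sup bound and, by telescoping, a bound on their sum.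

    The exponent p enters only through the triangle inequality, homogeneity and translation
    invariance, whence a constant free of p. These properties are isolated in [coef_seminorm], a
    seminorm on arrays of coefficients; exchanging the indices then carries each one-variable
    estimate to the other axis.

    In the constants, [B] bounds the [m k], the factor 1 / (1 - a) comes from A_n >= (1 - a) n^(-a),
    and 1 / (1 - 2^(-a)) from summing A at the indices M_t - 1. *)

Section Cesaro.
Variable R : realType.
Implicit Types (a g : R) (n i j : nat).

Lemma cesaro_number0 g : cesaro_number g 0 = 1.
Proof. by rewrite /cesaro_number big_geq// fact0 divr1. Qed.

Lemma cesaro_numberS g n :
  cesaro_number g n.+1 = cesaro_number g n * (1 + g / n.+1%:R).
Proof.
rewrite /cesaro_number big_nat_recr//= factS natrM invfM.
have n0 : n.+1%:R != 0 :> R by rewrite pnatr_eq0.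
have f0 : n`!%:R != 0 :> R by rewrite pnatr_eq0 -lt0n fact_gt0.
by field; rewrite f0 addrC natr1 n0.
Qed.

(* Young's inequality for [(1 + x)^a * 1] with exponents 1/a and 1/(1-a). *)
Lemma powR_le_bernoulli a (x : R) : 0 < a < 1 -> -1 <= x ->
  (1 + x) `^ a <= 1 + a * x.
Proof.
move=> /andP[a0 a1] x1.
have x0 : 0 <= 1 + x by rewrite -lerBlDl sub0r.
have := @conjugate_powR R ((1 + x) `^ a) 1 a^-1 (1 - a)^-1
  (powR_ge0 _ _) ler01.
rewrite !invr_gt0 subr_gt0 !invrK addrCA subrr addr0 => /(_ a0 a1 erefl).
rewrite mulr1 -powRrM divff ?gt_eqF// powRr1// powR1 mul1r.
by move/le_trans; apply; lra.
Qed.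

(** * Size and regularity of the Cesàro numbers of order -a *)

Section Negative.
Variable a : R.
Hypothesis a01 : 0 < a < 1.
Let A := cesaro_number (- a).

Let a_ltS n : a < n.+1%:R.
Proof. by case/andP: a01 => _ a1; rewrite (lt_le_trans a1)// ler1n. Qed.

Lemma cesaro_number_gt0 n : 0 < A n.
Proof.
elim: n => [|n IH]; rewrite /A ?cesaro_number0// cesaro_numberS.
by rewrite mulr_gt0// mulNr subr_gt0 ltr_pdivrMr// mul1r a_ltS.
Qed.

Lemma cesaro_number_diff n : A n - A n.+1 = A n * (a / n.+1%:R).
Proof. by rewrite /A cesaro_numberS mulNr mulrBr mulr1 opprB addrC subrK. Qed.

Lemma cesaro_number_le i j : (i <= j)%N -> A j <= A i.
Proof.
move=> /subnK <-; elim: (j - i)%N => // d IH; apply: le_trans IH.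
rewrite addSn -subr_ge0 cesaro_number_diff mulr_ge0//.
  exact/ltW/cesaro_number_gt0.
by case/andP: a01 => a0 _; rewrite divr_ge0// ltW.
Qed.

(** Each factor 1 - a/x of the product is at most (1 + 1/x)^(-a): by Bernoulli (1 + 1/x)^a <= 1 +
    a/x, and (1 - a/x)(1 + a/x) <= 1. *)
Lemma cesaro_number_ub n : A n <= (n.+1%:R `^ a)^-1.
Proof.
elim: n => [|n IH]; first by rewrite /A cesaro_number0 powR1 invr1.
rewrite /A cesaro_numberS mulNr.
set x := n.+1%:R : R; have x0 : 0 < x by rewrite /x.
have -> : n.+2%:R = x * (1 + x^-1).
  by rewrite mulrDr mulr1 divff ?gt_eqF// /x natr1.
have xV0 : 0 <= x^-1 by rewrite invr_ge0 ltW.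
rewrite powRM ?addr_ge0 ?(ltW x0)// invfM ler_pM//.
- exact/ltW/cesaro_number_gt0.
- by rewrite subr_ge0 ler_pdivrMr// mul1r ltW// a_ltS.
- have y0 : 0 < (1 + x^-1) `^ a by rewrite powR_gt0// ltr_pwDl.
  rewrite -[leRHS]mul1r ler_pdivlMr//.
  have := @powR_le_bernoulli a x^-1 a01 (le_trans (lerN10 _) xV0).
  have : 0 <= 1 - a / x by rewrite subr_ge0 ler_pdivrMr// mul1r ltW// a_ltS.
  move=> h1 h2; apply: (le_trans (ler_wpM2l h1 h2)).
  rewrite -subr_ge0 -/(a / x).
  have -> : 1 - (1 - a / x) * (1 + a / x) = (a / x) ^+ 2 by ring.
  exact: sqr_ge0.
Qed.

(** Equality holds at [n = 1], which is where 1 - a comes from; after that Bernoulli at -1/x shows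
    that each factor 1 - a/x is at least (1 - 1/x)^a. *)
Lemma cesaro_number_lb n : (0 < n)%N -> (1 - a) * (n%:R `^ a)^-1 <= A n.
Proof.
case: n => // n _; elim: n => [|n IH].
  by rewrite /A cesaro_numberS cesaro_number0 powR1 invr1 !mulr1 mul1r.
rewrite /A cesaro_numberS mulNr.
set x := n.+2%:R : R; have x0 : 0 < x by rewrite /x.
have x1 : 0 <= 1 - x^-1 by rewrite subr_ge0 invf_le1// /x ler1n.
have -> : (x `^ a)^-1 = (n.+1%:R `^ a)^-1 * (1 - x^-1) `^ a.
  have -> : n.+1%:R = x * (1 - x^-1) :> R.
    by rewrite mulrBr mulr1 divff ?gt_eqF// /x -(natr1 n.+1) addrK.
  rewrite powRM// ?(ltW x0)// invfM -mulrA mulVf ?mulr1//.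
  rewrite gt_eqF// powR_gt0// subr_gt0 invf_lt1// /x ltr1n//.
rewrite mulrA ler_pM//.
- case/andP: a01 => _ a1.
  by rewrite mulr_ge0 ?invr_ge0 ?powR_ge0// subr_ge0 ltW.
- exact: powR_ge0.
- have := @powR_le_bernoulli a (- x^-1) a01.
  rewrite mulrN; apply.
  by rewrite lerN2 invf_le1// /x ler1n.
Qed.

(** The condition [2 * j <= n] keeps the argument [n - j] comparable to [n], so a single difference
    A a/(i'+1) is O(n^(-a) / n), and division by A_n cancels n^(-a). *)
Lemma cesaro_ratio_lipschitz n i j : (0 < n)%N -> (i <= j)%N -> (2 * j <= n)%N ->
  `|A (n - i) / A n - A (n - j) / A n| <= 4 / ((1 - a) * n%:R) * (j - i)%:R.
Proof.
move=> n0 ij jn; rewrite distrC ger0_norm; last first.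
  by rewrite -mulrBl divr_ge0 ?subr_ge0 ?cesaro_number_le ?(ltW (cesaro_number_gt0 _))// leq_sub2l.
elim: j ij jn => [|j IH].
  by rewrite leqn0 => /eqP-> _; rewrite subrr subn0 mulr0.
rewrite leq_eqVlt => /predU1P[->|]; first by rewrite subrr subnn mulr0.
rewrite ltnS => ij jn.
have {IH} := IH ij (leq_trans (leq_mul (leqnn _) (leqnSn _)) jn).
rewrite subSn// -(natr1 (j - i)) mulrDr mulr1.
(* Only consecutive indices have to be compared. *)
suff: A (n - j.+1) / A n - A (n - j) / A n <= 4 / ((1 - a) * n%:R) by lra.
have -> : (n - j = (n - j.+1).+1)%N by lia.
have nj : (n <= 2 * (n - j.+1).+1)%N by lia.
rewrite -mulrBl cesaro_number_diff.
set i' := (n - j.+1)%N in nj *.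
have [a0 a1] := andP a01.
have nR : 0 < n%:R :> R by rewrite ltr0n.
have na : 0 < n%:R `^ a by exact: powR_gt0.
(* From n <= 2 (i' + 1), with 2^a bounded by 2. *)
have h1 : A i' <= 2 * (n%:R `^ a)^-1.
  apply: (le_trans (cesaro_number_ub _)).
  rewrite -[leLHS]mul1r ler_pdivrMr ?powR_gt0// mulrAC ler_pdivlMr// mul1r.
  apply: (@le_trans _ _ ((2 * i'.+1%:R) `^ a)).
    by rewrite ge0_ler_powR ?(ltW a0)// ?nnegrE// -natrM ler_nat.
  rewrite powRM// ler_wpM2r ?powR_ge0//.
  by rewrite -[leRHS]powRr1// ler_powR// ?ler1n// ltW.
have h2 : a / i'.+1%:R <= 2 / n%:R.
  rewrite ler_pdivrMr// mulrAC ler_pdivlMr//.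
  have : n%:R <= 2 * i'.+1%:R :> R by rewrite -natrM ler_nat.
  have : a * n%:R <= n%:R by rewrite ler_piMl// ltW.
  exact: le_trans.
have h3 := cesaro_number_lb n0.
have := cesaro_number_gt0 n => An.
rewrite ler_pdivrMr//.
apply: (@le_trans _ _ (2 * (n%:R `^ a)^-1 * (2 / n%:R))).
  by rewrite ler_pM// ?(ltW (cesaro_number_gt0 _))// divr_ge0// ltW.
apply: (@le_trans _ _ (4 / ((1 - a) * n%:R) * ((1 - a) * (n%:R `^ a)^-1))).
  rewrite le_eqVlt; apply/orP; left; apply/eqP; field.
  by rewrite !gt_eqF// subr_gt0.
by rewrite ler_wpM2l// divr_ge0// mulr_ge0// ?subr_ge0 ltW.
Qed.

End Negative.
End Cesaro.

(** * Mixed-radix digits of natural numbers *)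

Section MixedRadix.
Variable m : nat -> nat.
Hypothesis m_ge2 : forall k, (2 <= m k)%N.
Implicit Types i j k n q r t N : nat.

Let m_gt0 k : (0 < m k)%N. Proof. exact: leq_trans (m_ge2 k). Qed.

Lemma vilMS k : vilM m k.+1 = (vilM m k * m k)%N.
Proof. by rewrite /vilM big_nat_recr. Qed.

Lemma vilM_gt0 k : (0 < vilM m k)%N.
Proof. by rewrite /vilM prodn_gt0. Qed.

Lemma vilM_dvd k n : (k <= n)%N -> (vilM m k %| vilM m n)%N.
Proof.
by move=> kn; rewrite /vilM (@big_cat_nat _ _ _ k _ n)//= dvdn_mulr.
Qed.

Lemma vilM_le k n : (k <= n)%N -> (vilM m k <= vilM m n)%N.
Proof. by move=> kn; rewrite dvdn_leq ?vilM_gt0// vilM_dvd. Qed.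

Lemma vilM_double t d : (2 ^ d * vilM m t <= vilM m (t + d))%N.
Proof.
elim: d => [|d IH]; first by rewrite mul1n addn0.
by rewrite addnS vilMS expnSr mulnAC leq_mul.
Qed.

Lemma vilM_exp2 k : (2 ^ k <= vilM m k)%N.
Proof. by have := vilM_double 0 k; rewrite add0n /vilM [X in (_ * X)%N]big_geq// muln1. Qed.

Lemma ltn_vilM n : (n < vilM m n.+1)%N.
Proof.
apply: leq_trans (vilM_exp2 _); apply: leq_trans (ltn_expl n.+1 (ltnSn 1)).
exact: leqnSn.
Qed.

Lemma vil_digit_lt n k : (vil_digit m n k < m k)%N.
Proof. by rewrite ltn_mod. Qed.

Lemma vil_digit_high n k N : (n < vilM m N)%N -> (N <= k)%N ->
  vil_digit m n k = 0%N.
Proof.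
by move=> nN Nk; rewrite /vil_digit divn_small ?mod0n// (leq_trans nN)// vilM_le.
Qed.

Lemma vil_digit_add_low q b t j : (j < t)%N ->
  vil_digit m (q * vilM m t + b) j = vil_digit m b j.
Proof.
move=> jt; have /dvdnP[c ->] := vilM_dvd jt.
rewrite vilMS /vil_digit.
have -> : (q * (c * (vilM m j * m j)) = q * c * m j * vilM m j)%N by ring.
by rewrite divnMDl ?vilM_gt0// modnMDl.
Qed.

Lemma vil_digit_mul_low q t j : (j < t)%N -> vil_digit m (q * vilM m t) j = 0%N.
Proof.
by move=> jt; rewrite -[(_ * _)%N]addn0 vil_digit_add_low// /vil_digit div0n mod0n.
Qed.

Lemma vil_digit_add_high q b t j : (b < vilM m t)%N -> (t <= j)%N ->
  vil_digit m (q * vilM m t + b) j = vil_digit m (q * vilM m t) j.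
Proof.
move=> bt tj; have /dvdnP[c Ec] := vilM_dvd tj.
rewrite /vil_digit Ec [(c * _)%N]mulnC !divnMA divnMDl ?vilM_gt0//.
by rewrite mulnK ?vilM_gt0// (divn_small bt) addn0.
Qed.

(** Peels off the leading digit; iterated, it shows that the first [N] digits determine the residue
    modulo [vilM m N]. *)
Lemma modn_vilMS n N :
  (n %% vilM m N.+1 = vil_digit m n N * vilM m N + n %% vilM m N)%N.
Proof.
rewrite vilMS /vil_digit.
rewrite {1}(divn_eq n (vilM m N)) {1}(divn_eq (n %/ vilM m N) (m N)).
rewrite mulnDl -mulnA [(m N * _)%N]mulnC -addnA modnMDl modn_small//.
have := vil_digit_lt n N; rewrite /vil_digit => h.
apply: (@leq_trans ((n %/ vilM m N %% m N).+1 * vilM m N)).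
  by rewrite mulSn addnC ltn_add2r ltn_mod vilM_gt0.
by rewrite mulnC leq_mul2l h orbT.
Qed.

Lemma vil_digit_inj N i j : (i < vilM m N)%N -> (j < vilM m N)%N ->
  (forall k, (k < N)%N -> vil_digit m i k = vil_digit m j k) -> i = j.
Proof.
move=> iN jN ij; rewrite -(modn_small iN) -(modn_small jN).
elim: N {iN jN} ij => [|N IH] ij; first by rewrite /vilM big_geq// !modn1.
rewrite !modn_vilMS ij// IH// => k kN.
by rewrite ij// ltnS ltnW.
Qed.

End MixedRadix.

Lemma sum_nat_mul (V : nmodType) (a b : nat) (F : nat -> V) :
  \sum_(0 <= i < a * b) F i = \sum_(0 <= d < a) \sum_(0 <= i < b) F (d * b + i)%N.
Proof.
elim: a => [|a IH]; first by rewrite mul0n !big_geq.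
rewrite mulSn addnC (@big_cat_nat _ _ _ (a * b)%N) ?leq_addr//= IH big_nat_recr//=.
congr (_ + _).
rewrite -{1}[(a * b)%N]add0n big_addn [X in (X - _)%N]addnC addnK.
by apply: eq_bigr => i _; rewrite addnC.
Qed.

(** Distributivity, since the first [N] digits identify [0, M_N) with the product of the [0, m_k).
    Through it, character sums factor into sums over single coordinates. *)
Lemma sum_prod_vil_digit (K : comRingType) (m : nat -> nat) (N : nat)
    (m_ge2 : forall k, (2 <= m k)%N) (g : nat -> nat -> K) :
  \sum_(0 <= i < vilM m N) \prod_(0 <= k < N) g k (vil_digit m i k)
  = \prod_(0 <= k < N) \sum_(0 <= d < m k) g k d.
Proof.
elim: N => [|N IH].
  by rewrite /vilM [X in bigop _ (index_iota 0 X)]big_geq// big_nat1 !big_geq.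
rewrite vilMS mulnC sum_nat_mul big_nat_recr//= -IH mulrC mulr_suml.
apply: eq_big_nat => d /andP[_ dm].
rewrite mulr_sumr; apply: eq_big_nat => i /andP[_ iN].
rewrite big_nat_recr//= mulrC; congr (_ * _).
  congr (g N _); rewrite /vil_digit divnMDl ?vilM_gt0// divn_small// addn0.
  exact: modn_small.
by apply: eq_big_nat => k /andP[_ kN]; rewrite vil_digit_add_low.
Qed.

(** * The real-valued modulus on [R[i]] *)

Section ComplexModulus.
Variable R : realType.
Implicit Types x y z : R[i].
Local Notation nc := (@Normc.normc R).

Lemma normcE_real x : `|x| = (nc x)%:C%C.
Proof. by case: x. Qed.

Lemma normc_ge0 x : 0 <= nc x.
Proof. by case: x => a b; exact: sqrtr_ge0. Qed.

Lemma ler_normcD x y : nc (x + y) <= nc x + nc y.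
Proof. exact: le_normcD. Qed.

Lemma normc_opp x : nc (- x) = nc x.
Proof. exact: normcN. Qed.


Lemma normc_real (a : R) : nc a%:C%C = `|a|.
Proof. by rewrite /= expr0n addr0 sqrtr_sqr. Qed.

Lemma normcX x n : nc (x ^+ n) = nc x ^+ n.
Proof.
by elim: n => [|n IH]; rewrite ?Normc.normc1// !exprS Normc.normcM IH.
Qed.

Lemma normc_conj x : nc x^* = nc x.
Proof. by case: x => a b /=; rewrite sqrrN. Qed.

Lemma normc_sqr x : (nc x ^+ 2)%:C%C = x * x^*.
Proof. by rewrite -normCK normcE_real; exact: rmorphXn. Qed.

Lemma conj_real (a : R) : (a%:C%C : R[i])^* = a%:C%C.
Proof. exact: conjc_real. Qed.

Lemma real_complex_nat n : ((n%:R : R)%:C%C : R[i]) = n%:R.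
Proof. exact: rmorph_nat. Qed.

End ComplexModulus.

(** * Roots of unity and orthogonality on a cyclic group *)

Section RootsOfUnity.
Variable R : realType.

Lemma expiD (s t : R) : expi (s + t) = expi s * expi t.
Proof.
by rewrite /expi cosD sinD; apply/eqP; rewrite eq_complex/= eqxx/= addrC.
Qed.

Lemma expi0 : expi (0 : R) = 1.
Proof. by rewrite /expi cos0 sin0. Qed.

Lemma expi_mulrn (t : R) n : expi (n%:R * t) = expi t ^+ n.
Proof.
elim: n => [|n IH]; first by rewrite mul0r expi0.
by rewrite -natr1 mulrDl mul1r expiD IH exprSr.
Qed.

Lemma normc_expi (t : R) : Normc.normc (expi t) = 1.
Proof. by rewrite /expi /= cos2Dsin2 sqrtr1. Qed.

Definition unity_root (q : nat) : R[i] := expi (2 * pi / q%:R).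

Lemma normc_unity_root q : Normc.normc (unity_root q) = 1.
Proof. exact: normc_expi. Qed.

Lemma unity_root_conj q n : unity_root q ^+ n * (unity_root q ^+ n)^* = 1.
Proof. by rewrite -normc_sqr normcX normc_unity_root !expr1n. Qed.

Lemma unity_root_exp q : (0 < q)%N -> unity_root q ^+ q = 1.
Proof.
move=> q0; rewrite -expi_mulrn mulrC divfK ?pnatr_eq0 -?lt0n//.
by rewrite mulrC mulr_natr /expi -(add0r (pi *+ 2)) cosD2pi sinD2pi cos0 sin0.
Qed.

Lemma unity_root_neq1 q a : (0 < a < q)%N -> unity_root q ^+ a != 1.
Proof.
move=> /andP[a0 aq]; rewrite -expi_mulrn eq_complex /= negb_and; apply/orP; left.
have q0 : 0 < q%:R :> R by rewrite ltr0n (ltn_trans a0 aq).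
(* Half of the angle: the real part becomes 1 - 2 sin^2 t, and 0 < t < pi makes the sine
   positive. *)
set t : R := a%:R * pi / q%:R.
have -> : a%:R * (2 * pi / q%:R) = t + t :> R by rewrite /t; ring.
have t0 : 0 < sin t.
  have := pi_gt0 R => pi0.
  apply: sin_gt0_pi; apply/andP; split; first by rewrite divr_gt0// mulr_gt0// ltr0n.
  by rewrite ltr_pdivrMr// mulrC ltr_pM2l ?pi_gt0// ltr_nat.
rewrite cosD -!expr2 cos2sin2.
apply/eqP => h; have : sin t ^+ 2 = 0 by lra.
by move/eqP; rewrite sqrf_eq0 gt_eqF.
Qed.

Lemma unity_root_inj q a b : (a < q)%N -> (b < q)%N ->
  unity_root q ^+ a = unity_root q ^+ b -> a = b.
Proof.
wlog ab : a b / (a <= b)%N.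
  by move=> H aq bq; case/orP: (leq_total a b) => h e; [|symmetry]; apply: H.
move=> aq bq /esym; rewrite -{1}(subnK ab) exprD => h.
apply/eqP; rewrite eqn_leq ab/= -subn_eq0 -leqn0 leqNgt; apply/negP => d0.
have := @unity_root_neq1 q (b - a)%N; rewrite d0 (leq_ltn_trans _ bq) ?leq_subr//.
move=> /(_ isT)/negP; apply; apply/eqP.
have := congr1 ( *%R^~ (unity_root q ^+ a)^*) h.
by rewrite /= -mulrA unity_root_conj mulr1.
Qed.

(** Off the diagonal this is a geometric sum whose ratio z satisfies z^q = 1 and z != 1. *)
Lemma unity_root_sum q a b : (a < q)%N -> (b < q)%N ->
  \sum_(0 <= d < q) (unity_root q ^+ a * (unity_root q ^+ b)^*) ^+ d
  = (if a == b then q%:R else 0).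
Proof.
move=> aq bq; have q0 : (0 < q)%N by exact: leq_trans aq.
set w := unity_root q; set z := _ * _.
case: eqVneq => [ab|ab].
  under eq_bigr => d _ do rewrite /z ab unity_root_conj expr1n.
  by rewrite sumr_const_nat subn0.
have zq : z ^+ q = 1.
  rewrite /z exprMn -rmorphXn -!exprM [(a * q)%N]mulnC [(b * q)%N]mulnC !exprM.
  by rewrite unity_root_exp// !expr1n rmorph1 mulr1.
have z1 : z != 1.
  apply: contra_neq ab => z1; apply: (unity_root_inj aq bq).
  rewrite -/w -[LHS]mulr1 -(unity_root_conj q b) -/w [w ^+ b * _]mulrC.
  by rewrite mulrA -/z z1 mul1r.
apply/eqP; have := subrX1 z q; rewrite zq subrr => /esym/eqP.
by rewrite mulf_eq0 subr_eq0 (negbTE z1)/= big_mkord.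
Qed.

End RootsOfUnity.

(** * Vilenkin functions as characters, and their orthogonality *)

Section Characters.
Variables (R : realType) (m : nat -> nat).
Hypothesis m_ge2 : forall k, (2 <= m k)%N.
Implicit Types (x y : vilenkin m) (i j k n q r t N : nat).
Local Notation coord := (@Defs.coord m).
Local Notation psi := (@vil_psi R m).
Local Notation w k := (unity_root R (m k)).

Let m_gt0 k : (0 < m k)%N. Proof. exact: leq_trans (m_ge2 k). Qed.

Lemma coord_lt x k : (coord x k < m k)%N.
Proof. by rewrite -[X in (_ < X)%N](Zp_cast (m_ge2 k)) ltn_ord. Qed.

Lemma rademacherE k x : rademacher R k x = w k ^+ coord x k.
Proof. by rewrite /rademacher /unity_root -expi_mulrn; congr expi; ring. Qed.

(** Digits beyond the size of [n] vanish, so the cutoff of [vil_psi], which depends on [n], can be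
    replaced by a range common to several indices. *)
Lemma vil_psiE N n x : (n < vilM m N)%N ->
  psi n x = \prod_(0 <= k < N) w k ^+ (coord x k * vil_digit m n k).
Proof.
have E A B : (A <= B)%N -> (n < vilM m A)%N ->
    \prod_(0 <= k < B) rademacher R k x ^+ vil_digit m n k
    = \prod_(0 <= k < A) w k ^+ (coord x k * vil_digit m n k).
  move=> AB nA; rewrite (@big_cat_nat _ _ _ A)//= [X in _ * X]big_nat_cond.
  rewrite [X in _ * X]big1 ?mulr1 => [|k].
    by apply: eq_bigr => k _; rewrite rademacherE exprM.
  by rewrite andbT => /andP[Ak _]; rewrite (vil_digit_high m_ge2 nA Ak) expr0.
move=> nN; case/orP: (leq_total N n.+1) => le; first by rewrite /vil_psi (E N).
rewrite -(E N N)// /vil_psi (E n.+1)//; last exact: ltn_vilM.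
by rewrite (E n.+1 N)//; exact: ltn_vilM.
Qed.

Lemma vil_psi0 n : psi n 0 = 1.
Proof.
rewrite /vil_psi big1// => k _.
by rewrite /rademacher /= mulr0 mul0r expi0 expr1n.
Qed.

Lemma vil_psi_index0 x : psi 0 x = 1.
Proof. by rewrite (@vil_psiE 0) ?big_geq// vilM_gt0. Qed.

Lemma coordD x y k : coord (x + y) k = coord x k + coord y k.
Proof. by []. Qed.

(** Coordinates add modulo [m k]; the multiple of [m k] that is dropped is absorbed because the root
    of unity has order dividing [m k]. *)
Lemma rademacherD k x y :
  rademacher R k (x + y) = rademacher R k x * rademacher R k y.
Proof.
rewrite !rademacherE coordD /= -exprD.
move: (nat_of_ord (coord x k)) (nat_of_ord (coord y k)) => a b.
rewrite Zp_cast// [in RHS](divn_eq (a + b) (m k)) exprD mulnC exprM.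
by rewrite unity_root_exp// expr1n mul1r.
Qed.

Lemma vil_psiD n x y : psi n (x + y) = psi n x * psi n y.
Proof.
rewrite /vil_psi -big_split/=; apply: eq_bigr => k _.
by rewrite rademacherD exprMn.
Qed.

Lemma normc_vil_psi n x : Normc.normc (psi n x) = 1.
Proof.
rewrite /vil_psi; elim/big_ind: _ => [|u v hu hv|k _].
- exact: Normc.normc1.
- by rewrite Normc.normcM hu hv mulr1.
- by rewrite normcX rademacherE normcX normc_unity_root !expr1n.
Qed.

Lemma vil_psiN n x : psi n (- x) = (psi n x)^*.
Proof.
have := vil_psiD n x (- x); rewrite subrr vil_psi0 => h.
have h2 : (psi n x)^* * psi n x = 1.
  by rewrite mulrC -normc_sqr normc_vil_psi expr1n.
by rewrite -[LHS]mul1r -h2 -mulrA -h mulr1.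
Qed.

Lemma vil_psi_conj n x : psi n x * (psi n x)^* = 1.
Proof. by rewrite -normc_sqr normc_vil_psi expr1n. Qed.

(** No carry occurs: the digits of [q * vilM m t] live in positions from [t] on and those of [b]
    below [t]. *)
Lemma vil_psi_block q t b x : (b < vilM m t)%N ->
  psi (q * vilM m t + b) x = psi (q * vilM m t) x * psi b x.
Proof.
move=> bt; set n := (q * vilM m t + b)%N.
have nN : (n < vilM m (maxn t n.+1))%N.
  exact: leq_trans (ltn_vilM m_ge2 n) (vilM_le m_ge2 (leq_maxr _ _)).
rewrite (vil_psiE x nN) (@vil_psiE (maxn t n.+1) (q * vilM m t)%N); last first.
  by rewrite (leq_ltn_trans _ nN)// leq_addr.
rewrite (@vil_psiE (maxn t n.+1) b); last by rewrite (leq_ltn_trans _ nN)// leq_addl.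
rewrite -big_split/=; apply: eq_bigr => k _; rewrite -exprD -mulnDr.
have [kt|tk] := ltnP k t.
  by rewrite vil_digit_add_low// (vil_digit_mul_low m_ge2)// add0n.
by rewrite vil_digit_add_high// (vil_digit_high m_ge2 bt tk) addn0.
Qed.

Lemma vil_psi_vilI n t x : (n < vilM m t)%N -> vilI t x -> psi n x = 1.
Proof.
move=> nt It; rewrite (vil_psiE x nt) big_nat_cond big1// => k.
by rewrite andbT => /It ->; rewrite mul0n expr0.
Qed.

(** The sum factors over the coordinates below [t] into full geometric sums, each equal to [m k] or
    0 according to whether the coordinate vanishes. *)
Lemma vil_dirichlet t x :
  \sum_(0 <= j < vilM m t) psi j x
  = if `[< vilI t x >] then (vilM m t)%:R else 0.
Proof.
under eq_big_nat => j /andP[_ jt].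
  rewrite (vil_psiE x jt); under eq_bigr do rewrite exprM; over.
rewrite (sum_prod_vil_digit _ m_ge2 (fun k d => (w k ^+ coord x k) ^+ d)).
have E k : \sum_(0 <= d < m k) (w k ^+ coord x k) ^+ d
           = if coord x k == 0 :> nat then (m k)%:R else 0.
  have := @unity_root_sum R (m k) (coord x k) 0 (coord_lt _ _) (m_gt0 k).
  by rewrite expr0 rmorph1 mulr1.
case: asboolP => It.
  rewrite /vilM natr_prod; apply: eq_big_nat => k /andP[_ kt].
  by rewrite E It.
have [k [kt xk]] : exists k, (k < t)%N /\ coord x k != 0.
  apply: contrapT => h; apply: It => k kt; apply/eqP/negPn/negP => xk.
  by apply: h; exists k.
apply/eqP; rewrite prodf_seq_eq0; apply/hasP; exists k; first by rewrite mem_index_iota.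
by rewrite /= E (negbTE (_ : coord x k != 0%N :> nat)).
Qed.

Definition vil_of_nat i : vilenkin m :=
  fun k => inZp (vil_digit m i k) : 'Z_(m k).

Lemma coord_vil_of_nat i k : coord (vil_of_nat i) k = vil_digit m i k :> nat.
Proof. by rewrite /coord /= modn_small// (Zp_cast (m_ge2 k)) ltn_mod. Qed.

(** Orthogonality of the characters of the finite quotient by [vilI N], again by factoring over
    digits: distinct indices differ in some digit, whose factor is 0. *)
Lemma vil_psi_orthogonal N i j : (i < vilM m N)%N -> (j < vilM m N)%N ->
  \sum_(0 <= u < vilM m N) psi i (vil_of_nat u) * (psi j (vil_of_nat u))^*
  = if i == j then (vilM m N)%:R else 0.
Proof.
move=> iN jN.
pose g k d := (w k ^+ vil_digit m i k * (w k ^+ vil_digit m j k)^*) ^+ d.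
transitivity (\sum_(0 <= u < vilM m N) \prod_(0 <= k < N) g k (vil_digit m u k)).
  apply: eq_bigr => u _; rewrite (vil_psiE _ iN) (vil_psiE _ jN).
  rewrite rmorph_prod -big_split; apply: eq_bigr => k _.
  rewrite /g coord_vil_of_nat /=.
  by rewrite exprMn -rmorphXn -!exprM ![(vil_digit m u k * _)%N]mulnC.
rewrite (sum_prod_vil_digit _ m_ge2 g).
have E k : \sum_(0 <= d < m k) g k d =
    if vil_digit m i k == vil_digit m j k then (m k)%:R else 0.
  by rewrite /g unity_root_sum// vil_digit_lt.
case: (eqVneq i j) => [e|ij].
  by rewrite /vilM natr_prod; apply: eq_bigr => k _; rewrite E e eqxx.
have [k [kN dk]] : exists k, (k < N)%N /\ vil_digit m i k != vil_digit m j k.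
  apply: contrapT => h; move/eqP: ij; apply; apply: (vil_digit_inj m_ge2 iN jN) => k kN.
  by apply/eqP/negPn/negP => dk; apply: h; exists k.
apply/eqP; rewrite prodf_seq_eq0; apply/hasP; exists k; first by rewrite mem_index_iota.
by rewrite /= E (negbTE dk).
Qed.

End Characters.

(** * L^1 norms of kernels, scale by scale *)

Section Kernels.
Variables (R : realType) (m : nat -> nat).
Hypothesis m_ge2 : forall k, (2 <= m k)%N.
Implicit Types (x y : vilenkin m) (i j k n q r t u s N : nat) (lam : nat -> R).
Local Notation psi := (@vil_psi R m).
Local Notation nc := (@Normc.normc R).
Local Notation M k := (vilM m k).
Local Notation e := (vil_of_nat m).

Let M_gt0 k : 0 < (M k)%:R :> R. Proof. by rewrite ltr0n vilM_gt0. Qed.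

Definition vil_kernel N lam x : R[i] :=
  \sum_(0 <= j < M N) (lam j)%:C%C * psi j x.

(* The L^1 norm of [vil_kernel N lam]: a kernel of order [M N] is constant on
   the cosets of [vilI N], and [vil_of_nat] lists representatives of them. *)
Definition kernel_norm N lam : R :=
  (M N)%:R^-1 * \sum_(0 <= u < M N) nc (vil_kernel N lam (e u)).

Lemma eq_kernel_norm N lam lam' :
  (forall j, (j < M N)%N -> lam j = lam' j) ->
  kernel_norm N lam = kernel_norm N lam'.
Proof.
move=> E; rewrite /kernel_norm; congr (_ * _); apply: eq_bigr => u _.
by congr nc; apply: eq_big_nat => j /andP[_ jN]; rewrite E.
Qed.

Lemma kernel_norm_ge0 N lam : 0 <= kernel_norm N lam.
Proof.
by rewrite mulr_ge0 ?invr_ge0 ?(ltW (M_gt0 _))// sumr_ge0// => u _; exact: normc_ge0.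
Qed.

Lemma kernel_normD N lam lam' :
  kernel_norm N (fun j => lam j + lam' j) <= kernel_norm N lam + kernel_norm N lam'.
Proof.
rewrite -mulrDr ler_pM2l ?invr_gt0// -big_split/= ler_sum// => u _.
apply: le_trans (ler_normcD _ _); rewrite /vil_kernel -big_split/=.
rewrite le_eqVlt; apply/orP; left; apply/eqP; congr nc; apply: eq_bigr => j _.
by rewrite -mulrDl; congr (_ * _); exact: rmorphD.
Qed.

Lemma kernel_normZ N (c : R) lam :
  kernel_norm N (fun j => c * lam j) = `|c| * kernel_norm N lam.
Proof.
rewrite /kernel_norm mulrCA; congr (_ * _); rewrite mulr_sumr.
apply: eq_bigr => u _; rewrite -normc_real -Normc.normcM; congr nc.
rewrite /vil_kernel mulr_sumr; apply: eq_bigr => j _.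
by rewrite mulrA; congr (_ * _); exact: rmorphM.
Qed.

Lemma kernel_norm_sum N T (v : nat -> nat -> R) :
  kernel_norm N (fun j => \sum_(0 <= t < T) v t j)
  <= \sum_(0 <= t < T) kernel_norm N (v t).
Proof.
elim: T => [|T IH].
  rewrite [leRHS]big_geq// /kernel_norm big1 ?mulr0// => u _.
  rewrite /vil_kernel big1 ?Normc.normc0// => j _.
  by rewrite big_geq// mul0r.
rewrite [leRHS]big_nat_recr//=; apply: le_trans (lerD IH (lexx _)).
apply: le_trans (kernel_normD _ _ _).
rewrite le_eqVlt; apply/orP; left; apply/eqP; apply: eq_kernel_norm => j _.
by rewrite big_nat_recr.
Qed.

Lemma vil_parseval N lam :
  \sum_(0 <= u < M N) nc (vil_kernel N lam (e u)) ^+ 2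
  = (M N)%:R * \sum_(0 <= j < M N) lam j ^+ 2.
Proof.
apply: (@complexI R).
rewrite rmorph_sum rmorphM rmorph_sum mulr_sumr /=.
have E u : (nc (vil_kernel N lam (e u)) ^+ 2)%:C%C =
    \sum_(0 <= i < M N) \sum_(0 <= j < M N)
      ((lam i)%:C%C * (lam j)%:C%C) * (psi i (e u) * (psi j (e u))^*).
  rewrite normc_sqr /vil_kernel mulr_suml; apply: eq_bigr => i _.
  rewrite rmorph_sum mulr_sumr; apply: eq_bigr => j _.
  by rewrite rmorphM /= conj_real mulrACA.
under eq_bigr => u _ do rewrite E.
rewrite exchange_big/=; apply: eq_big_nat => i /andP[_ iN].
rewrite exchange_big/=.
under eq_big_nat => j /andP[_ jN].
  rewrite -mulr_sumr vil_psi_orthogonal//; over.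
rewrite (bigD1_seq i) ?mem_index_iota ?iota_uniq//= eqxx big1 => [|j ji].
  rewrite addr0 real_complex_nat mulrC; congr (_ * _).
  by rewrite expr2; symmetry; exact: rmorphM.
by rewrite eq_sym (negbTE ji) mulr0.
Qed.

(** Counting representatives is avoided: the summand is the Dirichlet kernel of order [M t], paired
    with the character of index 0, so orthogonality keeps only [j = 0]. *)
Lemma sum_vilI N t : (t <= N)%N ->
  \sum_(0 <= u < M N) (if `[< vilI t (e u) >] then (M t)%:R else 0) = (M N)%:R :> R.
Proof.
move=> tN; apply: (@complexI R); rewrite rmorph_sum /=.
transitivity (\sum_(0 <= u < M N) \sum_(0 <= j < M t) psi j (e u) * (psi 0 (e u))^*).
  apply: eq_bigr => u _.
  under [RHS]eq_bigr do rewrite vil_psi_index0// rmorph1 mulr1.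
  by rewrite vil_dirichlet//; case: ifP => // _; exact: real_complex_nat.
rewrite exchange_big/=.
under eq_big_nat => j /andP[_ jt].
  rewrite vil_psi_orthogonal ?vilM_gt0//; last first.
    exact: leq_trans jt (vilM_le m_ge2 tN).
  over.
rewrite (bigD1_seq 0%N) ?mem_index_iota ?iota_uniq ?vilM_gt0//= big1 => [|j ji].
  by rewrite addr0 real_complex_nat.
by rewrite (negbTE ji).
Qed.

(* Such a kernel is supported in [vilI t], which has measure [1 / M t], and its
   L^2 norm is [sqrt (M t * \sum c ^ 2)]; AM-GM replaces Cauchy-Schwarz. *)
Lemma kernel_norm_block_gt0 N t (c : nat -> R) S : (t <= N)%N -> 0 < S ->
  \sum_(0 <= q < M N %/ M t) c q ^+ 2 <= S ^+ 2 ->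
  kernel_norm N (fun j => c (j %/ M t)%N) <= S.
Proof.
move=> tN S0 cS; set lam := fun j => _.
have MNt : (M N = M N %/ M t * M t)%N by rewrite divnK// vilM_dvd.
have divE q b : (b < M t)%N -> ((q * M t + b) %/ M t = q)%N.
  by move=> bt; rewrite divnMDl ?vilM_gt0// divn_small// addn0.
(* On a block [c] is constant, so the inner sum is a character times the Dirichlet kernel of order
   [M t]. *)
have supp x : ~ vilI t x -> vil_kernel N lam x = 0.
  move=> nI; rewrite /vil_kernel MNt sum_nat_mul big1// => q _.
  transitivity ((c q)%:C%C * psi (q * M t) x * \sum_(0 <= b < M t) psi b x).
    rewrite mulr_sumr; apply: eq_big_nat => b /andP[_ bt].
    by rewrite /lam divE// vil_psi_block// mulrA.
  by rewrite vil_dirichlet// ifF ?mulr0//; apply/negbTE/asboolPn.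
have lam2 : \sum_(0 <= j < M N) lam j ^+ 2 <= (M t)%:R * S ^+ 2.
  rewrite MNt sum_nat_mul; apply: le_trans (ler_wpM2l (ltW (M_gt0 t)) cS).
  rewrite mulr_sumr ler_sum// => q _.
  rewrite (eq_big_nat _ _ (F2 := fun=> c q ^+ 2)) => [|b /andP[_ bt]].
    by rewrite sumr_const_nat subn0 mulr_natl.
  by rewrite /lam divE.
have ST : 0 < S * (M t)%:R by rewrite mulr_gt0.
(* AM-GM with weight T = S * M t, chosen so that after averaging each of the two terms contributes S
   / 2. Off [vilI t] both sides vanish. *)
have ptw u : nc (vil_kernel N lam (e u)) <=
    (2 * (S * (M t)%:R))^-1 * nc (vil_kernel N lam (e u)) ^+ 2
    + S / 2 * (if `[< vilI t (e u) >] then (M t)%:R else 0).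
  case: asboolP => [_|nI]; last first.
    by rewrite (supp _ nI) Normc.normc0 expr0n !mulr0 addr0.
  set K := nc _; set T := S * (M t)%:R in ST *.
  have -> : S / 2 * (M t)%:R = T / 2 by rewrite /T; ring.
  rewrite -subr_ge0.
  have -> : (2 * T)^-1 * K ^+ 2 + T / 2 - K = (2 * T)^-1 * (K - T) ^+ 2.
    by field; rewrite gt_eqF.
  by rewrite mulr_ge0 ?sqr_ge0// invr_ge0 mulr_ge0// ltW.
rewrite /kernel_norm ler_pdivrMl//.
apply: (le_trans (ler_sum _ (fun u _ => ptw u))).
rewrite big_split/= -!mulr_sumr vil_parseval sum_vilI//.
have := ler_wpM2l (ltW (M_gt0 N)) lam2.
move=> /(ler_wpM2l (_ : 0 <= (2 * (S * (M t)%:R))^-1)) h.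
apply: le_trans (lerD (h _) (lexx _)) _.
  by rewrite invr_ge0 mulr_ge0// ltW.
rewrite le_eqVlt; apply/orP; left; apply/eqP; field.
by rewrite !gt_eqF.
Qed.

(** The positive case divides by [S]; enlarging [S] by an arbitrary [eps] reaches [S = 0]. *)
Lemma kernel_norm_block N t (c : nat -> R) S : (t <= N)%N -> 0 <= S ->
  \sum_(0 <= q < M N %/ M t) c q ^+ 2 <= S ^+ 2 ->
  kernel_norm N (fun j => c (j %/ M t)%N) <= S.
Proof.
move=> tN S0 cS; apply/ler_addgt0Pr => eps e0.
apply: kernel_norm_block_gt0 => //; first by rewrite ltr_wpDl.
apply: le_trans cS _; rewrite lerXn2r// ?nnegrE ?addr_ge0// ?lerDl ltW//.
Qed.

(* [v t q] approximates the multiplier [v 0] on the block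
   [q * M t, q.+1 * M t). *)
Lemma kernel_norm_multiscale N (v : nat -> nat -> R) (S : nat -> R) :
  (forall t, (t <= N)%N -> 0 <= S t) ->
  (forall t, (t < N)%N ->
     \sum_(0 <= q < M N %/ M t) (v t q - v t.+1 (q %/ m t)%N) ^+ 2 <= S t ^+ 2) ->
  `|v N 0%N| <= S N ->
  kernel_norm N (v 0%N) <= \sum_(0 <= t < N.+1) S t.
Proof.
move=> S0 dv vN.
pose d t q := v t q - v t.+1 (q %/ m t)%N.
(* Telescoping over the scales. The increment at level [t] is a function of [j %/ M t] alone because
   [j %/ M t.+1] is [(j %/ M t) %/ m t]; the last argument is just 0. *)
have E j : (j < M N)%N -> v 0%N j =
    \sum_(0 <= t < N) d t (j %/ M t)%N + v N (j %/ M N - j %/ M N)%N.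
  move=> jN; rewrite subnn.
  have -> : \sum_(0 <= t < N) d t (j %/ M t)%N =
      - \sum_(0 <= t < N) (v t.+1 (j %/ M t.+1)%N - v t (j %/ M t)%N).
    rewrite -sumrN; apply: eq_bigr => t _.
    by rewrite /d vilMS divnMA opprB.
  rewrite telescope_sumr// (divn_small jN) opprB subrK.
  by rewrite [M 0]/vilM big_geq// divn1.
rewrite (eq_kernel_norm E); apply: le_trans (kernel_normD _ _ _) _.
rewrite big_nat_recr//= lerD//; last first.
  under eq_kernel_norm => j jN do rewrite subnn.
  apply: (@kernel_norm_block N N (fun=> v N 0%N)); rewrite ?S0//.
  rewrite divnn vilM_gt0// big_nat1 -[leLHS]real_normK ?num_real//.
  by rewrite lerXn2r// nnegrE (le_trans _ vN).
apply: le_trans (kernel_norm_sum _ _ _) _.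
apply: ler_sum_nat => t /andP[_ tN].
by apply: kernel_norm_block; rewrite ?dv ?S0// ltnW.
Qed.

Variables (B : nat).
Hypothesis m_leB : forall k, (m k <= B)%N.

(** Level [t] samples [lam] at the left ends of its blocks. There are M_s / M_t relevant blocks with
    increments at most L B M_t, so the root of the sum of squares is L B M_s sqrt(M_t / M_s), and
    M_t / M_s <= 2^(-(s-t)) makes it geometric in s - t. *)
Lemma kernel_norm_lipschitz N s lam (L : R) : (s <= N)%N -> 0 <= L ->
  lam 0%N = 0 ->
  (forall i j, (i <= j)%N -> (j < M s)%N -> `|lam i - lam j| <= L * (j - i)%:R) ->
  (forall j, (M s <= j)%N -> lam j = 0) ->
  kernel_norm N lam <= 3 * (L * B%:R * (M s)%:R).
Proof.
move=> sN L0 lam0 lamL lam_ge.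
pose v t q := lam (q * M t)%N.
set X := L * B%:R * (M s)%:R.
have X0 : 0 <= X by rewrite /X !mulr_ge0.
(* Any number in [1 / sqrt 2, 1) would do. *)
pose r : R := 3 / 4.
pose S t : R := if (t < s)%N then X * r ^+ (s - t) else 0.
have -> : kernel_norm N lam = kernel_norm N (v 0%N).
  by apply: eq_kernel_norm => j _; rewrite /v [M 0]/vilM big_geq// muln1.
apply: (@le_trans _ _ (\sum_(0 <= t < N.+1) S t)).
  apply: kernel_norm_multiscale => [t _|t tN|].
  - rewrite /S; case: ifP => // _.
    by rewrite mulr_ge0// exprn_ge0// /r divr_ge0.
  (* For [t >= s] every sample point is 0 or at least [M s], so all increments vanish. *)
  - rewrite /S; case: ltnP => ts; last first.
      rewrite big1 ?expr0n// => q _.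
      have E q' t' : (s <= t')%N -> lam (q' * M t')%N = 0.
        case: q' => [|q'] st'; first by rewrite mul0n.
        by rewrite lam_ge// mulSn (leq_trans (vilM_le m_ge2 st'))// leq_addr.
      by rewrite /v !E ?subrr ?expr0n// (leq_trans ts).
    pose c q := (v t q - v t.+1 (q %/ m t)%N) ^+ 2.
    have MsE : (M s = M s %/ M t * M t)%N by rewrite divnK// vilM_dvd// ltnW.
    have Q : (M s %/ M t <= M N %/ M t)%N by rewrite leq_div2r// vilM_le.
    rewrite (@big_cat_nat _ _ _ (M s %/ M t))//= [X in _ + X]big_nat_cond.
    rewrite [X in _ + X]big1 ?addr0; last first.
      move=> q; rewrite andbT => /andP[sq _].
      (* Since [M t.+1] divides [M s], the coarser block containing such a block also starts at or
         after [M s]. *)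
      have qs : (M s <= q * M t)%N by rewrite MsE leq_mul2r sq orbT.
      rewrite /v !lam_ge ?subrr ?expr0n//.
      have /dvdnP[c' cE] := vilM_dvd m ts.
      rewrite cE leq_mul2r; apply/orP; right.
      rewrite leq_divRL ?(leq_trans _ (m_ge2 t))//.
      rewrite -(leq_pmul2r (vilM_gt0 m_ge2 t)); apply: leq_trans qs.
      by rewrite cE vilMS -mulnA [(m t * _)%N]mulnC.
    (* The two sample points differ by (q mod m_t) M_t, at most B M_t. *)
    have cb q : (q < M s %/ M t)%N ->
        (v t q - v t.+1 (q %/ m t)%N) ^+ 2 <= (L * B%:R * (M t)%:R) ^+ 2.
      move=> qs; rewrite -[leLHS]real_normK ?num_real//.
      rewrite lerXn2r ?nnegrE ?mulr_ge0//.
      rewrite distrC /v; apply: le_trans (lamL _ _ _ _) _.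
      - rewrite vilMS mulnA mulnAC leq_mul2r; apply/orP; right.
        exact: leq_trunc_div.
      - by rewrite MsE ltn_mul2r vilM_gt0.
      - rewrite -mulrA ler_wpM2l// -natrM ler_nat.
        rewrite vilMS mulnA mulnAC -mulnBl leq_mul2r; apply/orP; right.
        rewrite {1}(divn_eq q (m t)) addKn (leq_trans _ (m_leB t))//.
        by rewrite ltnW// ltn_mod (leq_trans _ (m_ge2 t)).
    apply: (@le_trans _ _ (\sum_(0 <= q < M s %/ M t) (L * B%:R * (M t)%:R) ^+ 2)).
      by apply: ler_sum_nat => q /andP[_ qs]; exact: cb.
    rewrite sumr_const_nat subn0 -[leLHS]mulr_natl.
    set Q' := _%:R; have Q'E : Q' * (M t)%:R = (M s)%:R by rewrite -natrM -MsE.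
    have dbl : (M t)%:R <= (M s)%:R * (r ^+ (s - t)) ^+ 2.
      have := vilM_double m_ge2 t (s - t); rewrite subnKC ?(ltnW ts)// => h.
      rewrite -exprM mulnC exprM.
      have r2 : 2^-1 <= r ^+ 2 by rewrite /r; lra.
      have p2 : (2^-1) ^+ (s - t) <= (r ^+ 2) ^+ (s - t).
        by rewrite lerXn2r ?nnegrE ?invr_ge0 ?sqr_ge0.
      apply: le_trans (ler_wpM2l (ltW (M_gt0 s)) p2).
      by rewrite exprVn ler_pdivlMr ?exprn_gt0// mulrC -natrX -natrM ler_nat.
    have -> : Q' * (L * B%:R * (M t)%:R) ^+ 2 =
        (L * B%:R) ^+ 2 * (M s)%:R * (M t)%:R by rewrite -Q'E; ring.
    have -> : (X * r ^+ (s - t)) ^+ 2 =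
        (L * B%:R) ^+ 2 * (M s)%:R * ((M s)%:R * (r ^+ (s - t)) ^+ 2).
      by rewrite /X; ring.
    by rewrite ler_wpM2l// mulr_ge0 ?sqr_ge0// ltW.
  - rewrite /v mul0n lam0 normr0 /S; case: ifP => // _.
    by rewrite mulr_ge0// exprn_ge0// /r divr_ge0.
have sN1 : (s <= N.+1)%N by exact: leq_trans (leqnSn _).
rewrite (@big_cat_nat _ _ _ s)//= [X in _ + X]big_nat_cond.
rewrite [X in _ + X]big1 ?addr0; last first.
  by move=> t; rewrite andbT /S => /andP[st _]; rewrite ltnNge st.
(* The geometric series is at most r / (1 - r), which is 3 for r = 3/4. *)
have E : \sum_(0 <= t < s) S t = X * (r * \sum_(0 <= i < s) r ^+ i).
  rewrite !mulr_sumr big_nat_rev/= add0n; apply: eq_big_nat => i /andP[_ is_].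
  rewrite /S -exprS ifT; last by rewrite ltn_subrL (leq_ltn_trans _ is_).
  by congr (_ * _ ^+ _); lia.
rewrite E mulrC ler_wpM2r//.
have := subrX1 r s; rewrite -(big_mkord xpredT (fun i => r ^+ i)).
set G := \sum_(0 <= i < s) r ^+ i => h.
have : 0 <= r ^+ s by rewrite exprn_ge0// /r divr_ge0.
rewrite -lerBlDr in h *; move: h; rewrite /r; lra.
Qed.

(** With U = a (M t - 1), the increments at level [t] are dominated by a sequence [d] bounded by U
    and, by monotonicity, of sum at most 3 B U. Their squares thus sum to at most 3 B U^2 <= (3 B
    U)^2, and no smoothness is asked of the jump at [j = n]. *)
Lemma kernel_norm_decreasing N n (a : nat -> R) (G : R) : (n < M N)%N ->
  (forall i, 0 <= a i) -> (forall i j, (i <= j)%N -> a j <= a i) ->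
  \sum_(0 <= t < N) a (M t - 1)%N <= G ->
  kernel_norm N (fun j => if (j <= n)%N then a (n - j)%N else 0)
    <= 3 * B%:R * G + a 0%N.
Proof.
move=> nN a0 a_anti aG.
(* The shift by [M t - 1] vanishes at level 0 and bounds the level-[t] values
   by [a (M t - 1)]. *)
pose v t q := if (q * M t <= n)%N then a (n - q * M t + (M t - 1))%N else 0.
pose S t : R := if (t < N)%N then 3 * B%:R * a (M t - 1)%N else a 0%N.
have -> : kernel_norm N (fun j => if (j <= n)%N then a (n - j)%N else 0)
          = kernel_norm N (v 0%N).
  by apply: eq_kernel_norm => j _; rewrite /v [M 0]/vilM big_geq// muln1 subnn addn0.
apply: (@le_trans _ _ (\sum_(0 <= t < N.+1) S t)); last first.
  rewrite big_nat_recr//= {2}/S ltnn lerD2r//.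
  apply: le_trans (ler_wpM2l _ aG); last by rewrite mulr_ge0.
  rewrite mulr_sumr le_eqVlt; apply/orP; left; apply/eqP.
  by apply: eq_big_nat => t /andP[_ tN]; rewrite /S tN.
apply: kernel_norm_multiscale => [t _|t tN|].
- by rewrite /S; case: ifP => // _; rewrite !mulr_ge0.
- rewrite /S tN; set U := a (M t - 1)%N.
  have U0 : 0 <= U by exact: a0.
  (* [p] is the block containing [n], and [g i] is the level-[t] value [i] blocks before it. *)
  pose p := (n %/ M t)%N; pose rm := (n %% M t)%N.
  have Mt0 := vilM_gt0 m_ge2 t.
  pose g i := a (i * M t + rm + (M t - 1))%N.
  have g0 i : 0 <= g i by exact: a0.
  have gU i : g i <= U by apply: a_anti; rewrite leq_addl.
  (* Up to block [p], the coarser level evaluates [a] at most 2 B blocks further. After [p] the fine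
     value is 0, and the coarse block containing [n] reaches at most B blocks beyond, with value at
     most U. *)
  pose d q : R := if (q <= p)%N then g (p - q)%N - g (p - q + 2 * B)%N
                  else if (q <= p + B)%N then U else 0.
  have g_anti i j : (i <= j)%N -> g j <= g i.
    by move=> ij; apply: a_anti; rewrite !leq_add2r leq_mul2r ij orbT.
  have d0 q : 0 <= d q.
    rewrite /d; case: ifP => _; first by rewrite subr_ge0 g_anti// leq_addr.
    by case: ifP.
  have dU q : d q <= U.
    rewrite /d; case: ifP => _; last by case: ifP.
    by rewrite lerBlDr (le_trans (gU _))// lerDl.
  have cd q : `|v t q - v t.+1 (q %/ m t)%N| <= d q.
    have q'q : (q %/ m t * M t.+1 <= q * M t)%N.
      by rewrite vilMS mulnA mulnAC leq_mul2r leq_trunc_div orbT.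
    have qq' : (q * M t <= q %/ m t * M t.+1 + M t.+1)%N.
      rewrite vilMS mulnA mulnAC [(M t * m t)%N]mulnC -mulnDl leq_mul2r.
      apply/orP; right; rewrite {1}(divn_eq q (m t)) leq_add2l ltnW//.
      by rewrite ltn_mod (leq_trans _ (m_ge2 t)).
    have MB : (M t.+1 <= B * M t)%N by rewrite vilMS mulnC leq_mul2r m_leB orbT.
    have M1 : (M t <= M t.+1)%N by exact: vilM_le.
    have nE : (n = p * M t + rm)%N by exact: divn_eq.
    have rmM : (rm < M t)%N by rewrite ltn_mod.
    rewrite /v /d; case: (leqP q p) => qp.
      have qn : (q * M t <= n)%N by rewrite nE (leq_trans _ (leq_addr _ _))// leq_mul2r qp orbT.
      rewrite qn (leq_trans q'q qn).
      have pq : ((p - q) * M t = p * M t - q * M t)%N by rewrite mulnBl.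
      have pq2 : ((p - q + 2 * B) * M t = (p * M t - q * M t) + 2 * (B * M t))%N.
        by rewrite mulnDl pq mulnA.
      have qpM : (q * M t <= p * M t)%N by rewrite leq_mul2r qp orbT.
      rewrite ger0_norm ?subr_ge0; last by apply: a_anti; lia.
      rewrite lerB//; apply: a_anti; rewrite ?pq ?pq2; lia.
    have nq : (n < q * M t)%N.
      rewrite nE (leq_trans (_ : _ < p.+1 * M t)%N)//; last first.
        by rewrite leq_mul2r qp orbT.
      by rewrite mulSn addnC ltn_add2r.
    rewrite leqNgt nq/= sub0r normrN.
    case: (leqP q (p + B)) => qB.
      case: ifP => _; last by rewrite normr0.
      by rewrite ger0_norm// a_anti//; lia.
    have qB' : ((p.+1 + B) * M t <= q * M t)%N by rewrite leq_mul2r qB orbT.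
    rewrite ifF ?normr0//; apply/negbTE; rewrite -ltnNge.
    move: qB'; rewrite mulnDl mulSn; lia.
  have dsum Q : \sum_(0 <= q < Q) d q <= 3 * B%:R * U.
    apply: (@le_trans _ _ (\sum_(0 <= q < Q + (p.+1 + B)) d q)).
      rewrite (@big_cat_nat _ _ _ Q _ (Q + _)) ?leq_addr//= lerDl.
      by apply: sumr_ge0.
    rewrite (@big_cat_nat _ _ _ (p.+1 + B)) ?leq_addl//= [X in _ + X]big_nat_cond.
    rewrite [X in _ + X]big1 ?addr0; last first.
      move=> q; rewrite andbT => /andP[pq _].
      by rewrite /d !ifF//; apply/negbTE; rewrite -ltnNge; lia.
    rewrite (@big_cat_nat _ _ _ p.+1) ?leq_addr//=.
    have -> : 3 * B%:R * U = (2 * B)%:R * U + B%:R * U.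
      by rewrite natrM; ring.
    apply: lerD; last first.
      apply: (@le_trans _ _ (\sum_(p.+1 <= q < p.+1 + B) U)); first exact: ler_sum.
      by rewrite sumr_const_nat addKn mulr_natl.
    rewrite big_nat_rev/= add0n.
    (* After reversal, the sum telescopes with step 2 B: only the first 2 B values of [g] can
       remain, each at most U. *)
    have -> : \sum_(0 <= i < p.+1) d (p.+1 - i.+1)%N =
        \sum_(0 <= i < p.+1) g i - \sum_(2 * B <= i < p.+1 + 2 * B) g i.
      rewrite -{1}[(2 * B)%N]add0n big_addn addnK -sumrB.
      apply: eq_big_nat => i /andP[_ ip].
      by rewrite /d subSS leq_subr subKn.
    have : \sum_(0 <= i < p.+1) g i <= \sum_(0 <= i < p.+1 + 2 * B) g i.
      rewrite (@big_cat_nat _ _ _ p.+1 _ (p.+1 + _)) ?leq_addr//= lerDl.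
      by apply: sumr_ge0.
    rewrite (@big_cat_nat _ _ _ (2 * B) _ (p.+1 + _)) ?leq_addl//=.
    have : \sum_(0 <= i < 2 * B) g i <= (2 * B)%:R * U.
      apply: (@le_trans _ _ (\sum_(0 <= q < 2 * B) U)); first exact: ler_sum.
      by rewrite sumr_const_nat subn0 mulr_natl.
    lra.
  have c2 q : (v t q - v t.+1 (q %/ m t)%N) ^+ 2 <= U * d q.
    rewrite -[leLHS]real_normK ?num_real// expr2.
    by apply: ler_pM => //; exact: le_trans (cd _) (dU _).
  apply: (le_trans (ler_sum _ (fun q _ => c2 q))).
  rewrite -mulr_sumr expr2; apply: ler_pM => //; first exact: sumr_ge0.
  have B2 : (1 <= B)%N by rewrite (leq_trans _ (m_leB 0))// ltnW.
  rewrite ler_peMl//.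
  have : 1 <= B%:R :> R by rewrite ler1n.
  lra.
- rewrite /S ltnn /v mul0n leq0n subn0 ger0_norm//.
  by apply: a_anti.
Qed.

End Kernels.

(** * Fourier multipliers on translation-invariant seminorms *)

Section Multipliers.
Variables (R : realType) (m : nat -> nat).
Hypothesis m_ge2 : forall k, (2 <= m k)%N.
Implicit Types (x y : vilenkin m) (i j k n q r t s N : nat).
Implicit Types (lam : nat -> R) (c : nat -> nat -> R[i]).
Local Notation psi := (@vil_psi R m).
Local Notation nc := (@Normc.normc R).
Local Notation M k := (vilM m k).
Local Notation e := (vil_of_nat m).
Local Notation knorm := (@kernel_norm R m).

Let M_gt0 k : 0 < (M k)%:R :> R. Proof. by rewrite ltr0n vilM_gt0. Qed.

(* The model is [nu c = `|\sum_(i < M N) \sum_(j < M N') c i j psi_i psi_j|]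
   for a translation-invariant norm. *)
Record coef_seminorm N N' (nu : (nat -> nat -> R[i]) -> R) : Prop := {
  coef_seminorm_ge0 : forall c, 0 <= nu c ;
  coef_seminorm_ext : forall c c',
    (forall i j, (i < M N)%N -> (j < M N')%N -> c i j = c' i j) -> nu c = nu c' ;
  coef_seminormD : forall c c', nu (fun i j => c i j + c' i j) <= nu c + nu c' ;
  coef_seminormZ : forall (a : R[i]) c, nu (fun i j => a * c i j) <= nc a * nu c ;
  coef_seminorm_shift : forall (u v : vilenkin m) c,
    nu (fun i j => c i j * psi i u * psi j v) = nu c }.

(** Transfers the estimates in the first variable to the second one. *)
Lemma coef_seminorm_swap N N' nu : coef_seminorm N N' nu ->
  coef_seminorm N' N (fun c => nu (fun i j => c j i)).
Proof.
case=> ge0 ext nD nZ nS; split => [c|c c' cc'|c c'|a c|u v c].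
- exact: ge0.
- by apply: ext => i j iN jN; rewrite cc'.
- exact: nD.
- exact: nZ.
- by rewrite -[RHS](nS v u); congr nu; apply/funext => i; apply/funext => j; rewrite mulrAC.
Qed.

Section OneAxis.
Variables (N N' : nat) (nu : (nat -> nat -> R[i]) -> R).
Hypothesis nuP : coef_seminorm N N' nu.

Lemma coef_seminorm_sum T (a : nat -> R[i]) (c : nat -> nat -> nat -> R[i]) :
  nu (fun i j => \sum_(0 <= t < T) a t * c t i j)
  <= \sum_(0 <= t < T) nc (a t) * nu (c t).
Proof.
elim: T => [|T IH].
  rewrite [leRHS]big_geq//.
  have -> : (fun i j => \sum_(0 <= t < 0) a t * c t i j) = (fun i j => 0 * c 0 i j).
    by apply/funext => i; apply/funext => j; rewrite big_geq// mul0r.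
  by apply: le_trans (coef_seminormZ nuP _ _) _; rewrite Normc.normc0 mul0r.
rewrite [leRHS]big_nat_recr//=; apply: le_trans (lerD IH (coef_seminormZ nuP _ _)).
apply: le_trans (coef_seminormD nuP _ _); rewrite le_eqVlt; apply/orP; left.
apply/eqP; congr nu; apply/funext => i; apply/funext => j.
by rewrite big_nat_recr.
Qed.

Lemma coef_seminorm_shift1 (u : vilenkin m) c : nu (fun i j => c i j * psi i u) = nu c.
Proof.
rewrite -[RHS](coef_seminorm_shift nuP u 0); congr nu.
by apply/funext => i; apply/funext => j; rewrite vil_psi0 mulr1.
Qed.

(** Fourier inversion on the quotient by [vilI N]: orthogonality keeps only the index [i] of the
    kernel. *)
Lemma vil_kernel_coef lam i : (i < M N)%N ->
  (M N)%:R^-1 * (\sum_(0 <= u < M N) vil_kernel N lam (e u) * psi i (- e u))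
  = (lam i)%:C%C.
Proof.
move=> iN; have M0 : (M N)%:R != 0 :> R[i].
  by rewrite pnatr_eq0 -lt0n vilM_gt0.
apply: (mulfI M0); rewrite mulVKf//.
under eq_bigr do rewrite vil_psiN// /vil_kernel mulr_suml.
rewrite exchange_big/=.
under eq_big_nat => j /andP[_ jN].
  under eq_bigr do rewrite -mulrA.
  rewrite -mulr_sumr vil_psi_orthogonal//; over.
rewrite (bigD1_seq i) ?mem_index_iota ?iota_uniq//= eqxx big1 => [|j ji].
  by rewrite addr0 mulrC.
by rewrite (negbTE ji) mulr0.
Qed.

(** A multiplier is a convolution: by inversion it is a combination of translates with the kernel
    values as weights, and translates have equal seminorm. *)
Lemma multiplier_bound lam c :
  nu (fun i j => (lam i)%:C%C * c i j) <= knorm N lam * nu c.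
Proof.
have M0 : (M N)%:R != 0 :> R[i] by rewrite pnatr_eq0 -lt0n vilM_gt0.
pose a u : R[i] := (M N)%:R^-1 * vil_kernel N lam (e u).
rewrite (@coef_seminorm_ext _ _ _ nuP _
   (fun i j => \sum_(0 <= u < M N) a u * (c i j * psi i (- e u)))); last first.
  move=> i j iN _; rewrite -vil_kernel_coef// -mulrA mulr_suml mulr_sumr.
  by apply: eq_bigr => u _; rewrite /a; ring.
apply: le_trans (coef_seminorm_sum _ _ _) _.
rewrite /kernel_norm -mulrA mulr_suml mulr_sumr ler_sum// => u _.
rewrite coef_seminorm_shift1 /a Normc.normcM -mulrA.
have -> : ((M N)%:R^-1 : R[i]) = ((M N)%:R^-1)%:C%C.
  by rewrite -real_complex_nat; exact: (esym (fmorphV _ _)).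
by rewrite normc_real ger0_norm// invr_ge0 ltW.
Qed.

(** The projection onto the frequencies below [M r] averages translates over [vilI r], so its
    complement averages the negated differences (translate minus identity), each bounded by [W]. *)
Lemma high_frequency_bound r c (W : R) : (r <= N)%N ->
  (forall u : vilenkin m, vilI r u -> nu (fun i j => (psi i (- u) - 1) * c i j) <= W) ->
  nu (fun i j => (if (i < M r)%N then 0 else 1) * c i j) <= W.
Proof.
move=> rN cW.
have M0 : (M N)%:R != 0 :> R[i] by rewrite pnatr_eq0 -lt0n vilM_gt0.
pose dl i : R := if (i < M r)%N then 1 else 0.
have KE x : vil_kernel N dl x = if `[< vilI r x >] then (M r)%:R else 0.
  rewrite -vil_dirichlet// /vil_kernel (@big_cat_nat _ _ _ (M r)) ?vilM_le//=.
  rewrite [X in _ + X]big_nat_cond [X in _ + X]big1 ?addr0; last first.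
    by move=> i; rewrite andbT /dl => /andP[ri _]; rewrite ltnNge ri mul0r.
  by apply: eq_big_nat => i /andP[_ ir]; rewrite /dl ir mul1r.
pose a u : R[i] := - (M N)%:R^-1 * vil_kernel N dl (e u).
rewrite (@coef_seminorm_ext _ _ _ nuP _
   (fun i j => \sum_(0 <= u < M N) a u * ((psi i (- e u) - 1) * c i j))); last first.
  move=> i j iN _.
  (* The constant 1 is written as the coefficient of index 0 of the same kernel, so that both terms
     are sums over the same translates. *)
  have h0 := @vil_kernel_coef dl 0 (vilM_gt0 m_ge2 _).
  have hi := @vil_kernel_coef dl i iN.
  have -> : (if (i < M r)%N then 0 else 1) = (dl 0%N)%:C%C - (dl i)%:C%C :> R[i].
    by rewrite /dl vilM_gt0//; case: ifP; rewrite ?subrr ?subr0.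
  rewrite -h0 -hi -mulrBr -sumrB mulr_sumr mulr_suml; apply: eq_bigr => u _.
  by rewrite vil_psi_index0// /a; ring.
apply: le_trans (coef_seminorm_sum _ _ _) _.
have nMV : nc ((M N)%:R^-1) = (M N)%:R^-1.
  have -> : ((M N)%:R^-1 : R[i]) = ((M N)%:R^-1)%:C%C.
    by rewrite -real_complex_nat; exact: (esym (fmorphV _ _)).
  by rewrite normc_real ger0_norm// invr_ge0 ltW.
apply: (@le_trans _ _ (\sum_(0 <= u < M N)
    (M N)%:R^-1 * (if `[< vilI r (e u) >] then (M r)%:R else 0) * W)).
  apply: ler_sum => u _; rewrite /a Normc.normcM normc_opp nMV KE.
  case: asboolP => [Iu|_]; last by rewrite Normc.normc0 mulr0 !mul0r.
  by rewrite -real_complex_nat normc_real normr_nat ler_wpM2l ?cW.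
rewrite -mulr_suml -mulr_sumr sum_vilI// mulVf ?mul1r//.
by rewrite gt_eqF.
Qed.

End OneAxis.

Variables (B : nat).
Hypothesis m_leB : forall k, (m k <= B)%N.

Let B_ge1 : 1 <= B%:R :> R.
Proof. by rewrite ler1n (leq_trans _ (m_leB 0))// ltnW. Qed.

Section CesaroMultiplier.
Variable a : R.
Hypothesis a01 : 0 < a < 1.
Local Notation A := (cesaro_number (- a)).

Let a0 : 0 < a. Proof. by case/andP: a01. Qed.
Let a1 : 0 < 1 - a. Proof. by case/andP: a01; rewrite subr_gt0. Qed.

Definition cesaro_multiplier n j : R :=
  if (j <= n)%N then A (n - j) / A n else 0.

Let rho : R := (2 `^ a)^-1.

Let rho_lt1 : 0 <= rho < 1.
Proof.
rewrite /rho invr_ge0 powR_ge0/= invf_lt1 ?powR_gt0//.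
have : (1 : R) `^ a < 2 `^ a by rewrite gt0_ltr_powR ?nnegrE// ltr1n.
by rewrite powR1.
Qed.

(** A at M_t - 1 is at most M_t^(-a) <= 2^(-a t); [a > 0] makes the series converge, with ratio
    [rho] < 1. *)
Lemma cesaro_number_geometric T :
  \sum_(0 <= t < T) A (M t - 1) <= (1 - rho)^-1.
Proof.
have [r0 r1] := andP rho_lt1.
have r1' : 0 < 1 - rho by rewrite subr_gt0.
apply: (@le_trans _ _ (\sum_(0 <= t < T) rho ^+ t)).
  apply: ler_sum => t _; apply: (le_trans (cesaro_number_ub a01 _)).
  rewrite subn1 prednK ?vilM_gt0// /rho exprVn lef_pV2 ?posrE ?powR_gt0 ?exprn_gt0//.
  rewrite -powR_mulrn ?powR_ge0// -powRrM mulrC powRrM powR_mulrn//.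
  rewrite ge0_ler_powR ?(ltW a0)// ?nnegrE//; last by rewrite -natrX ler_nat vilM_exp2.
rewrite -[leRHS]mul1r ler_pdivlMr//.
have := subrX1 rho T; rewrite -(big_mkord xpredT (fun i => rho ^+ i)).
have : 0 <= rho ^+ T by exact: exprn_ge0.
lra.
Qed.

(** The first factor is the bound of [kernel_norm_decreasing] for the numbers A, its [+ 1] being
    A_0; [B%:R / (1 - a)] bounds 1 / (A_n M_k^a); the last 1 is the norm of the constant multiplier
    -1. *)
Definition cesaro_const : R :=
  (3 * B%:R * (1 - rho)^-1 + 1) * (B%:R / (1 - a)) + 1.

(** 12 is the 3 of [kernel_norm_lipschitz] times the 4 of [cesaro_ratio_lipschitz]. *)
Definition cesaro_low_const : R := 12 * B%:R / (1 - a).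

Let const_ge0 : 0 <= (3 * B%:R * (1 - rho)^-1 + 1) * (B%:R / (1 - a)).
Proof.
have [r0 r1] := andP rho_lt1.
have r1' : 0 < 1 - rho by rewrite subr_gt0.
by apply: mulr_ge0; [apply: addr_ge0|] => //; rewrite divr_ge0 ?mulr_ge0 ?(ltW r1') ?(ltW a1).
Qed.

Lemma cesaro_const_ge0 : 0 <= cesaro_const.
Proof. by rewrite addr_ge0. Qed.

Lemma cesaro_low_const_ge0 : 0 <= cesaro_low_const.
Proof. by rewrite /cesaro_low_const divr_ge0 ?mulr_ge0// ltW. Qed.

Variables (k n N : nat).
Hypothesis kn : (M k <= n < M k.+1)%N.
Hypothesis kN : (k < N)%N.

Let nN : (n < M N)%N.
Proof. by case/andP: kn => _ /leq_trans; apply; exact: vilM_le. Qed.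

Let n0 : (0 < n)%N.
Proof. by case/andP: kn => h _; exact: leq_trans (vilM_gt0 m_ge2 k) h. Qed.

Let Mka1 : 1 <= (M k)%:R `^ a.
Proof.
have : (M k)%:R `^ 0 <= (M k)%:R `^ a by rewrite ler_powR ?ler1n ?vilM_gt0// ltW.
by rewrite powRr0.
Qed.

Lemma cesaro_multiplier_norm :
  knorm N (fun j => cesaro_multiplier n j - 1) <= cesaro_const * (M k)%:R `^ a.
Proof.
have [kn1 kn2] := andP kn.
have An := cesaro_number_gt0 a01 n.
apply: le_trans (kernel_normD m_ge2 _ _ _) _.
rewrite /cesaro_const mulrDl mul1r lerD//; last first.
  apply: le_trans Mka1.
  apply: (@kernel_norm_block _ _ m_ge2 N N (fun=> -1)) => //.
  by rewrite divnn vilM_gt0// big_nat1 sqrrN.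
rewrite (@eq_kernel_norm _ _ _ _ (fun j => (A n)^-1 *
    (if (j <= n)%N then A (n - j) else 0))); last first.
  by move=> j _; rewrite /cesaro_multiplier; case: ifP; rewrite ?mulr0// mulrC.
rewrite kernel_normZ ger0_norm ?invr_ge0 ?(ltW An)//.
have K1 := kernel_norm_decreasing m_ge2 m_leB nN
  (fun i => ltW (cesaro_number_gt0 a01 i)) (cesaro_number_le a01)
  (cesaro_number_geometric N).
rewrite cesaro_number0 in K1.
(* 1 / A_n <= n^a / (1 - a), while n < M_(k+1) <= B M_k and B^a <= B. *)
have K2 : (A n)^-1 <= B%:R / (1 - a) * (M k)%:R `^ a.
  rewrite -[leLHS]mul1r ler_pdivrMr//.
  apply: (le_trans _ (ler_wpM2l _ (cesaro_number_lb a01 n0))); last first.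
    by rewrite mulr_ge0 ?powR_ge0 ?divr_ge0// ltW.
  have na : 0 < n%:R `^ a by rewrite powR_gt0// ltr0n.
  have -> : B%:R / (1 - a) * (M k)%:R `^ a * ((1 - a) * (n%:R `^ a)^-1)
    = B%:R * (M k)%:R `^ a / n%:R `^ a by field; rewrite !gt_eqF.
  rewrite ler_pdivlMr// mul1r.
  apply: (@le_trans _ _ ((B%:R * (M k)%:R) `^ a)).
    rewrite ge0_ler_powR ?(ltW a0)// ?nnegrE// -natrM ler_nat.
    by rewrite ltnW// (leq_trans kn2)// vilMS mulnC leq_mul2r m_leB orbT.
  rewrite powRM// ler_wpM2r ?powR_ge0//.
  by rewrite -[leRHS]powRr1// ler_powR// ltW// -subr_gt0.
rewrite mulrC -[leRHS]mulrA ler_pM ?kernel_norm_ge0//.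
by rewrite invr_ge0 ltW.
Qed.

(** For [s < k], every [j < M s] satisfies [2 * j <= n], the range of the Lipschitz estimate; the
    value at [j = 0] is 0 because the means preserve constants. *)
Lemma cesaro_multiplier_low_norm s : (s < k)%N ->
  knorm N (fun j => if (j < M s)%N then cesaro_multiplier n j - 1 else 0)
  <= cesaro_low_const * ((M s)%:R / (M k)%:R).
Proof.
move=> sk; have [kn1 kn2] := andP kn.
have nR : 0 < n%:R :> R by rewrite ltr0n.
have An := cesaro_number_gt0 a01 n.
have jn j : (j < M s)%N -> (2 * j <= n)%N.
  move=> js; apply: leq_trans kn1; apply: leq_trans (vilM_le m_ge2 sk).
  by rewrite vilMS mulnC leq_mul// ltnW.
apply: (@le_trans _ _ (3 * (4 / ((1 - a) * n%:R) * B%:R * (M s)%:R))).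
  apply: kernel_norm_lipschitz => //.
  - by rewrite ltnW// (ltn_trans sk).
  - by rewrite divr_ge0 ?mulr_ge0// ltW.
  - by rewrite vilM_gt0// /cesaro_multiplier leq0n subn0 divff ?subrr// gt_eqF.
  - move=> i j ij js; rewrite js (leq_ltn_trans ij js) /cesaro_multiplier.
    have jn1 : (j <= n)%N by have := jn _ js; lia.
    rewrite jn1 (leq_trans ij jn1) opprB addrA subrK.
    by apply: cesaro_ratio_lipschitz => //; exact: jn.
  - by move=> j js; rewrite ltnNge js.
have -> : 3 * (4 / ((1 - a) * n%:R) * B%:R * (M s)%:R)
    = cesaro_low_const * ((M s)%:R / n%:R).
  by rewrite /cesaro_low_const; field; rewrite !gt_eqF.
rewrite ler_wpM2l ?cesaro_low_const_ge0// ler_wpM2l// lef_pV2 ?posrE//.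
by rewrite ler_nat.
Qed.

Variables (N' : nat) (nu : (nat -> nat -> R[i]) -> R).
Hypothesis nuP : coef_seminorm N N' nu.

Definition cesaro_low n k i : R :=
  if (i < M k.-1)%N then cesaro_multiplier n i - 1 else 0.

Definition cesaro_high n k i : R :=
  if (i < M k.-1)%N then 0 else cesaro_multiplier n i - 1.

Lemma cesaro_high_bound c (W : R) :
  (forall u : vilenkin m, vilI k.-1 u ->
     nu (fun i j => (psi i (- u) - 1) * c i j) <= W) ->
  nu (fun i j => (cesaro_high n k i)%:C%C * c i j)
    <= cesaro_const * (M k)%:R `^ a * W.
Proof.
move=> cW.
have kN' : (k.-1 <= N)%N by rewrite (leq_trans (leq_pred _))// ltnW.
have h := high_frequency_bound nuP kN' cW.
apply: le_trans (ler_pM _ (coef_seminorm_ge0 nuP _) cesaro_multiplier_norm h).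
  apply: le_trans (multiplier_bound nuP _ _).
  rewrite le_eqVlt; apply/orP; left; apply/eqP; congr nu.
  apply/funext => i; apply/funext => j; rewrite /cesaro_high.
  by case: ifP => _; rewrite ?mul0r ?mulr0 ?mul1r.
exact: kernel_norm_ge0.
Qed.

Lemma cesaro_low_bounded c : (0 < k)%N ->
  nu (fun i j => (cesaro_low n k i)%:C%C * c i j) <= cesaro_low_const * nu c.
Proof.
move=> k0; apply: le_trans (multiplier_bound nuP _ _) _.
rewrite ler_wpM2r ?(coef_seminorm_ge0 nuP)//.
apply: (le_trans (@cesaro_multiplier_low_norm k.-1 _)); first by rewrite prednK.
rewrite -[leRHS]mulr1 ler_wpM2l ?cesaro_low_const_ge0//.
by rewrite ler_pdivrMr// mul1r ler_nat vilM_le// leq_pred.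
Qed.

(** The frequencies in [M_s, M_(s+1)) are those below M_(s+1) on which the projection below M_s is
    removed: the removal costs [W s], and the multiplier cut at M_(s+1) costs M_(s+1) / M_k <= B M_s
    / M_k. *)
Lemma cesaro_low_bound c (W : nat -> R) : (0 < k)%N ->
  (forall r (u : vilenkin m), vilI r u ->
     nu (fun i j => (psi i (- u) - 1) * c i j) <= W r) ->
  nu (fun i j => (cesaro_low n k i)%:C%C * c i j)
    <= cesaro_low_const * B%:R *
       \sum_(0 <= r < k.-1) (M r)%:R / (M k)%:R * W r.
Proof.
move=> k0 cW.
suff H s : (s <= k.-1)%N ->
  nu (fun i j => ((if (i < M s)%N then cesaro_multiplier n i - 1 else 0) : R)%:C%C * c i j)
    <= cesaro_low_const * B%:R * \sum_(0 <= r < s) (M r)%:R / (M k)%:R * W r.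
  exact: H.
elim: s => [_|s IH sk].
  rewrite [X in _ <= _ * X]big_geq// mulr0.
  (* [M 0 = 1] leaves only the frequency 0, where the multiplier minus 1 vanishes. *)
  have -> : (fun i j => ((if (i < M 0)%N then cesaro_multiplier n i - 1 else 0) : R)%:C%C * c i j)
     = (fun i j => 0 * c i j).
    apply/funext => i; apply/funext => j; rewrite [M 0]/vilM big_geq//.
    case: i => [|i]/=; last by rewrite !mul0r.
    rewrite /cesaro_multiplier leq0n subn0 divff ?subrr ?mul0r//.
    by rewrite gt_eqF// cesaro_number_gt0.
  by apply: le_trans (coef_seminormZ nuP _ _) _; rewrite Normc.normc0 mul0r.
rewrite [X in _ <= _ * X]big_nat_recr//= mulrDr.
apply: le_trans (lerD (IH (ltnW sk)) (lexx _)).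
have sk' : (s.+1 < k)%N by rewrite -(prednK k0).
have sN : (s <= N)%N by rewrite ltnW// (ltn_trans _ kN)// ltnW.
have h := high_frequency_bound nuP sN (cW s).
have g := multiplier_bound nuP
  (fun i => if (i < M s.+1)%N then cesaro_multiplier n i - 1 else 0)
  (fun i j => (if (i < M s)%N then 0 else 1) * c i j).
apply: (@le_trans _ _ (nu (fun i j => ((if (i < M s)%N then cesaro_multiplier n i - 1 else 0) : R)%:C%C * c i j) +
  nu (fun i j => ((if (i < M s.+1)%N then cesaro_multiplier n i - 1 else 0) : R)%:C%C *
    ((if (i < M s)%N then 0 else 1) * c i j)))).
  apply: le_trans (coef_seminormD nuP _ _).
  rewrite le_eqVlt; apply/orP; left; apply/eqP; congr nu.
  apply/funext => i; apply/funext => j.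
  have [is_|si] := ltnP i (M s).
    by rewrite (leq_trans is_ (vilM_le m_ge2 (leqnSn s))) mul0r mulr0 addr0.
  by rewrite mul0r add0r mul1r.
rewrite lerD2l; apply: (le_trans g).
(* [u = 0] is admissible and a seminorm is nonnegative. *)
have W0 : 0 <= W s.
  by apply: le_trans (cW s 0 _); [exact: (coef_seminorm_ge0 nuP)|].
apply: (le_trans (ler_pM (kernel_norm_ge0 _ _ _) (coef_seminorm_ge0 nuP _)
  (cesaro_multiplier_low_norm sk') h)) => //.
have := cesaro_low_const_ge0; move: cesaro_low_const => C C0.
rewrite -!mulrA ler_wpM2l// [leRHS]mulrA ler_wpM2r ?mulr_ge0 ?invr_ge0//.
by rewrite -natrM ler_nat vilMS mulnC leq_mul2r m_leB orbT.
Qed.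

Lemma cesaro_multiplier_split i :
  cesaro_multiplier n i - 1 = cesaro_low n k i + cesaro_high n k i.
Proof. by rewrite /cesaro_low /cesaro_high; case: ifP; rewrite ?addr0 ?add0r. Qed.

End CesaroMultiplier.

(** The product of the two one-axis constants is taken because it dominates the coefficient of each
    of the five terms after the expansion of T T' - 1. *)
Lemma coef_seminorm_cesaro alpha beta k l n n' N N' nu c (W1 W2 : nat -> R) (W12 : R) :
  0 < alpha < 1 -> 0 < beta < 1 -> (0 < k < N)%N -> (0 < l < N')%N ->
  (M k <= n < M k.+1)%N -> (M l <= n' < M l.+1)%N ->
  coef_seminorm N N' nu ->
  (forall r (u : vilenkin m), vilI r u ->
     nu (fun i j => (psi i (- u) - 1) * c i j) <= W1 r) ->
  (forall r (v : vilenkin m), vilI r v ->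
     nu (fun i j => (psi j (- v) - 1) * c i j) <= W2 r) ->
  (forall u v : vilenkin m, vilI k.-1 u -> vilI l.-1 v ->
     nu (fun i j => (psi i (- u) - 1) * ((psi j (- v) - 1) * c i j)) <= W12) ->
  nu (fun i j => (cesaro_multiplier alpha n i * cesaro_multiplier beta n' j - 1)%:C%C * c i j)
  <= (1 + cesaro_const alpha + cesaro_low_const alpha + cesaro_low_const alpha * B%:R) *
     (1 + cesaro_const beta + cesaro_low_const beta + cesaro_low_const beta * B%:R) *
     (W1 k.-1 * (M k)%:R `^ alpha + W2 l.-1 * (M l)%:R `^ beta
      + W12 * ((M k)%:R `^ alpha * (M l)%:R `^ beta)
      + \sum_(0 <= r < k.-1) (M r)%:R / (M k)%:R * W1 r
      + \sum_(0 <= s < l.-1) (M s)%:R / (M l)%:R * W2 s).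
Proof.
move=> al be /andP[k0 kN] /andP[l0 lN] kn ln nuP cW1 cW2 cW12.
have nuP' := coef_seminorm_swap nuP.
have nu_ge0 := coef_seminorm_ge0 nuP.
pose P i : R := cesaro_low alpha n k i; pose Q i : R := cesaro_high alpha n k i.
pose P' i : R := cesaro_low beta n' l i; pose Q' i : R := cesaro_high beta n' l i.
set C1 := cesaro_const alpha; set C1' := cesaro_const beta.
set C2 := cesaro_low_const alpha; set C2' := cesaro_low_const beta.
set X := (M k)%:R `^ alpha; set Y := (M l)%:R `^ beta.
set S1 := \sum_(0 <= r < k.-1) _; set S2 := \sum_(0 <= s < l.-1) _.
have hP c0 : nu (fun i j => (P i)%:C%C * c0 i j) <= C2 * nu c0.
  exact: (cesaro_low_bounded al kn kN nuP c0 k0).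
have hP' c0 : nu (fun i j => (P' j)%:C%C * c0 i j) <= C2' * nu c0.
  exact: (cesaro_low_bounded be ln lN nuP' (fun i j => c0 j i) l0).
have hPS : nu (fun i j => (P i)%:C%C * c i j) <= C2 * B%:R * S1.
  exact: (cesaro_low_bound al kn kN nuP k0 cW1).
have hPS' : nu (fun i j => (P' j)%:C%C * c i j) <= C2' * B%:R * S2.
  exact: (cesaro_low_bound (c := fun i j => c j i) be ln lN nuP' l0 cW2).
have hQ c0 W : (forall u : vilenkin m, vilI k.-1 u ->
     nu (fun i j => (psi i (- u) - 1) * c0 i j) <= W) ->
    nu (fun i j => (Q i)%:C%C * c0 i j) <= C1 * X * W.
  exact: (cesaro_high_bound al kn kN nuP (c := c0)).
have hQ' c0 W : (forall v : vilenkin m, vilI l.-1 v ->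
     nu (fun i j => (psi j (- v) - 1) * c0 i j) <= W) ->
    nu (fun i j => (Q' j)%:C%C * c0 i j) <= C1' * Y * W.
  exact: (cesaro_high_bound be ln lN nuP' (c := fun i j => c0 j i)).
have hQ1 := hQ c _ (cW1 k.-1).
have hQ1' := hQ' c _ (cW2 l.-1).
have C1ge0 : 0 <= C1 by exact: cesaro_const_ge0.
have C1'ge0 : 0 <= C1' by exact: cesaro_const_ge0.
have C2ge0 : 0 <= C2 by exact: cesaro_low_const_ge0.
have C2'ge0 : 0 <= C2' by exact: cesaro_low_const_ge0.
have X0 : 0 <= X by exact: powR_ge0.
have Y0 : 0 <= Y by exact: powR_ge0.
(* The bound for Q is applied with, as its modulus, the bound for Q' on differenced coefficients;
   multipliers on the two axes commute. *)
have hQQ : nu (fun i j => (Q i)%:C%C * ((Q' j)%:C%C * c i j)) <= C1 * X * (C1' * Y * W12).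
  apply: hQ => u Iu.
  have -> : (fun i j => (psi i (- u) - 1) * ((Q' j)%:C%C * c i j))
      = (fun i j => (Q' j)%:C%C * ((psi i (- u) - 1) * c i j)).
    by apply/funext => i; apply/funext => j; rewrite mulrCA.
  apply: hQ' => v Iv.
  have -> : (fun i j => (psi j (- v) - 1) * ((psi i (- u) - 1) * c i j))
      = (fun i j => (psi i (- u) - 1) * ((psi j (- v) - 1) * c i j)).
    by apply/funext => i; apply/funext => j; rewrite mulrCA.
  exact: cW12.
have hPQ : nu (fun i j => (P i)%:C%C * ((Q' j)%:C%C * c i j)) <= C2 * (C1' * Y * W2 l.-1).
  by apply: le_trans (hP _) _; rewrite ler_wpM2l.
have hQP : nu (fun i j => (P' j)%:C%C * ((Q i)%:C%C * c i j)) <= C2' * (C1 * X * W1 k.-1).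
  by apply: le_trans (hP' _) _; rewrite ler_wpM2l.
have hPP : nu (fun i j => (P' j)%:C%C * ((P i)%:C%C * c i j)) <= C2' * (C2 * B%:R * S1).
  by apply: le_trans (hP' _) _; rewrite ler_wpM2l.
(* [P Q'] is estimated through the boundedness of [P], and [P P'] through that
   of [P'], so that no power of [M k] or [M l] multiplies [S1]. *)
have split8 : nu (fun i j => (cesaro_multiplier alpha n i * cesaro_multiplier beta n' j - 1)%:C%C * c i j)
  <= C1 * X * (C1' * Y * W12) + C2 * (C1' * Y * W2 l.-1) + C2' * (C1 * X * W1 k.-1)
     + C2' * (C2 * B%:R * S1) + C2 * B%:R * S1 + C2' * B%:R * S2
     + C1 * X * W1 k.-1 + C1' * Y * W2 l.-1.
  have -> : (fun i j => (cesaro_multiplier alpha n i * cesaro_multiplier beta n' j - 1)%:C%C * c i j)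
    = (fun i j => (Q i)%:C%C * ((Q' j)%:C%C * c i j) + (P i)%:C%C * ((Q' j)%:C%C * c i j)
       + (P' j)%:C%C * ((Q i)%:C%C * c i j) + (P' j)%:C%C * ((P i)%:C%C * c i j)
       + (P i)%:C%C * c i j + (P' j)%:C%C * c i j
       + (Q i)%:C%C * c i j + (Q' j)%:C%C * c i j).
    apply/funext => i; apply/funext => j.
    have E1 : cesaro_multiplier alpha n i = 1 + (P i + Q i).
      by rewrite -cesaro_multiplier_split addrC subrK.
    have E2 : cesaro_multiplier beta n' j = 1 + (P' j + Q' j).
      by rewrite -cesaro_multiplier_split addrC subrK.
    have RD (x y : R) : (x + y)%:C%C = x%:C%C + y%:C%C by exact: rmorphD.
    have RM (x y : R) : (x * y)%:C%C = x%:C%C * y%:C%C by exact: rmorphM.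
    have R1 : (1 : R)%:C%C = 1 by [].
    have RN (x : R) : (- x)%:C%C = - x%:C%C by exact: rmorphN.
    rewrite E1 E2 RD RM !RD RN R1; ring.
  do 7 (apply: (le_trans (coef_seminormD nuP _ _)); apply: lerD => //).
have W1ge0 r : 0 <= W1 r.
  by apply: le_trans (cW1 r 0 _); [exact: nu_ge0|].
have W2ge0 r : 0 <= W2 r.
  by apply: le_trans (cW2 r 0 _); [exact: nu_ge0|].
have W12ge0 : 0 <= W12.
  by apply: le_trans (cW12 0 0 _ _); [exact: nu_ge0| |].
have S1ge0 : 0 <= S1.
  by apply: sumr_ge0 => r _; rewrite mulr_ge0// divr_ge0.
have S2ge0 : 0 <= S2.
  by apply: sumr_ge0 => r _; rewrite mulr_ge0// divr_ge0.
have XW : 0 <= X * W1 k.-1 by exact: mulr_ge0.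
have YW : 0 <= Y * W2 l.-1 by exact: mulr_ge0.
have XYW : 0 <= X * Y * W12 by rewrite !mulr_ge0.
set D := C2 * B%:R in split8 *; set D' := C2' * B%:R in split8 *.
have D0 : 0 <= D by exact: mulr_ge0.
have D'0 : 0 <= D' by exact: mulr_ge0.
apply: (le_trans split8); rewrite -subr_ge0.
clearbody D D' S1 S2 X Y C1 C1' C2 C2'.
set K := 1 + C1 + C2 + D; set K' := 1 + C1' + C2' + D'.
have Kge0 : 0 <= K by rewrite !addr_ge0.
have K'ge0 : 0 <= K' by rewrite !addr_ge0.
(* Here and below, the constant minus the coefficient of one term is displayed as a sum of products
   of nonnegative numbers. *)
have K0 : 0 <= K * K' - C1 * (1 + C2').
  have -> : K * K' - C1 * (1 + C2') = (1 + C2 + D) * K' + C1 * (C1' + D').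
    by rewrite /K /K'; ring.
  by apply: addr_ge0; apply: mulr_ge0 => //; rewrite !addr_ge0.
have K1 : 0 <= K * K' - C1' * (1 + C2).
  have -> : K * K' - C1' * (1 + C2) = (1 + C2' + D') * K + C1' * (C1 + D).
    by rewrite /K /K'; ring.
  by apply: addr_ge0; apply: mulr_ge0 => //; rewrite !addr_ge0.
have K2 : 0 <= K * K' - C1 * C1'.
  have -> : K * K' - C1 * C1' = (1 + C2 + D) * K' + C1 * (1 + C2' + D').
    by rewrite /K /K'; ring.
  by apply: addr_ge0; apply: mulr_ge0 => //; rewrite !addr_ge0.
have K3 : 0 <= K * K' - D * (1 + C2').
  have -> : K * K' - D * (1 + C2') = (1 + C1 + C2) * K' + D * (C1' + D').
    by rewrite /K /K'; ring.
  by apply: addr_ge0; apply: mulr_ge0 => //; rewrite !addr_ge0.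
have K4 : 0 <= K * K' - D'.
  have -> : K * K' - D' = K * (1 + C1' + C2') + (C1 + C2 + D) * D'.
    by rewrite /K /K'; ring.
  by apply: addr_ge0; apply: mulr_ge0 => //; rewrite !addr_ge0.
have -> : K * K' * (W1 k.-1 * X + W2 l.-1 * Y + W12 * (X * Y) + S1 + S2)
    - (C1 * X * (C1' * Y * W12) + C2 * (C1' * Y * W2 l.-1) + C2' * (C1 * X * W1 k.-1)
     + C2' * (D * S1) + D * S1 + D' * S2 + C1 * X * W1 k.-1 + C1' * Y * W2 l.-1)
  = (K * K' - C1 * (1 + C2')) * (X * W1 k.-1) + (K * K' - C1' * (1 + C2)) * (Y * W2 l.-1)
    + (K * K' - C1 * C1') * (X * Y * W12) + (K * K' - D * (1 + C2')) * S1
    + (K * K' - D') * S2 by ring.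
by rewrite !addr_ge0// mulr_ge0.
Qed.

End Multipliers.

(** * Cosets of [vilI] as a base of the topology *)

Section VilenkinTopology.
Variable m : nat -> nat.
Hypothesis m_ge2 : forall k, (2 <= m k)%N.
Implicit Types (x y : vilenkin m) (z w : 'G2_m).

Lemma vilI0 N : vilI N (0 : vilenkin m).
Proof. by []. Qed.

Lemma vilID N x y : vilI N x -> vilI N y -> vilI N (x + y).
Proof. by move=> Ix Iy k kN; rewrite coordD Ix// Iy// addr0. Qed.

Lemma vilIN N x : vilI N x -> vilI N (- x).
Proof. by move=> Ix k kN; rewrite [LHS](_ : _ = - Defs.coord x k)// Ix// oppr0. Qed.

Lemma vilI_le N N' x : (N <= N')%N -> vilI N' x -> vilI N x.
Proof. by move=> NN' Ix k kN; apply: Ix; exact: leq_trans NN'. Qed.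

Lemma vilI_subP N x y :
  vilI N (y - x) <-> forall k, (k < N)%N -> y k = x k.
Proof.
split=> [I k kN|E k kN].
  by have /eqP := I k kN; rewrite subr_eq0 => /eqP.
by apply/eqP; rewrite subr_eq0; apply/eqP; exact: E.
Qed.

(** In one direction, the filter generated by the cosets is tested coordinate by coordinate, the
    product topology being a supremum; in the other, finitely many coordinate cylinders, open
    because the factors are discrete, are intersected. *)
Lemma nbhs_vilenkinP x (A : set (vilenkin m)) :
  nbhs x A <-> exists N, forall y, vilI N (y - x) -> A y.
Proof.
pose F : set_system (vilenkin m) := [set B | exists N, forall y, vilI N (y - x) -> B y].
have FF : Filter F.
  split => [|P Q [N HN] [N' HN']|P Q PQ [N HN]].
  - by exists 0%N.
  - exists (maxn N N') => y Iy; split.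
      by apply: HN; apply: vilI_le Iy; exact: leq_maxl.
    by apply: HN'; apply: vilI_le Iy; exact: leq_maxr.
  - by exists N => y /HN /PQ.
split.
  suff : F --> x by move=> h /h.
  apply/cvg_sup => k U [B [[W oW <-] Wx] BU].
  exists k.+1 => y /vilI_subP E; apply: BU => /=.
  by rewrite /= in Wx *; rewrite E.
move=> [N HN]; apply: (@filterS _ _ _ [set y | forall k, (k < N)%N -> y k = x k]).
  by move=> y /vilI_subP; exact: HN.
elim: N {HN} => [|N IH]; first by apply: filterS (filterT) => y _ k.
have h : nbhs x [set y : vilenkin m | y N = x N].
  apply: (@proj_continuous nat (fun k => discrete_topology 'Z_(m k)) N x [set x N]).
  exact: discrete_set1.
apply: filterS (filterI IH h) => y [h1 h2] k; rewrite ltnS leq_eqVlt => /predU1P[->//|].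
exact: h1.
Qed.

Lemma nbhs_G2P z (A : set 'G2_m) : nbhs z A <->
  exists N, forall w, vilI N (w.1 - z.1) -> vilI N (w.2 - z.2) -> A w.
Proof.
split=> [[[P Q] [/= /nbhs_vilenkinP[N HN] /nbhs_vilenkinP[N' HN']] PQ]|[N HN]].
  exists (maxn N N') => w I1 I2; apply: PQ; split => /=.
    by apply: HN; apply: vilI_le I1; exact: leq_maxl.
  by apply: HN'; apply: vilI_le I2; exact: leq_maxr.
exists ([set y | vilI N (y - z.1)], [set y | vilI N (y - z.2)]).
  by split; apply/nbhs_vilenkinP; exists N.
by move=> w [/= h1 h2]; exact: HN.
Qed.

Lemma open_G2P (A : set 'G2_m) : open A <-> forall z, A z ->
  exists N, forall w, vilI N (w.1 - z.1) -> vilI N (w.2 - z.2) -> A w.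
Proof.
rewrite openE; split => [oA z /oA /nbhs_G2P//|oA z /oA h].
exact/nbhs_G2P.
Qed.

Lemma vilI_representative N x : exists i, vilI N (x - vil_of_nat m i).
Proof.
suff [i _ iE] : exists2 i, (i < vilM m N)%N &
    forall k, (k < N)%N -> vil_digit m i k = Defs.coord x k.
  exists i; apply/vilI_subP => k kN; apply: val_inj => /=.
  have := coord_vil_of_nat m_ge2 i k; rewrite /Defs.coord /= => ->.
  by rewrite iE.
elim: N => [|N [i iN IH]]; first by exists 0%N; rewrite ?vilM_gt0.
exists (Defs.coord x N * vilM m N + i)%N.
  rewrite vilMS (leq_trans (_ : _ < (Defs.coord x N).+1 * vilM m N)%N)//.
    by rewrite mulSn addnC ltn_add2r.
  by rewrite mulnC leq_mul2l coord_lt ?orbT.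
move=> k; rewrite ltnS leq_eqVlt => /predU1P[->|kN]; last first.
  by rewrite vil_digit_add_low// IH.
rewrite /vil_digit divnMDl ?vilM_gt0// divn_small// addn0 modn_small//.
exact: coord_lt.
Qed.

(** Indexing by all pairs of naturals repeats boxes, but keeps the family countable and covering. *)
Definition vil_box N (ij : nat * nat) : set 'G2_m :=
  [set z | vilI N (z.1 - vil_of_nat m ij.1) /\ vilI N (z.2 - vil_of_nat m ij.2)].

Lemma vil_box_shift N ij z w : vil_box N ij z ->
  vilI N (w.1 - z.1) -> vilI N (w.2 - z.2) -> vil_box N ij w.
Proof.
move=> [h1 h2] g1 g2; split.
  by have := vilID g1 h1; rewrite addrA subrK.
by have := vilID g2 h2; rewrite addrA subrK.
Qed.

Lemma vil_box_ex N z : exists ij, vil_box N ij z.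
Proof.
have [i hi] := vilI_representative N z.1.
have [j hj] := vilI_representative N z.2.
by exists (i, j).
Qed.

Lemma vil_box_diff N ij z w : vil_box N ij z -> vil_box N ij w ->
  vilI N (w.1 - z.1) /\ vilI N (w.2 - z.2).
Proof.
move=> [h1 h2] [g1 g2]; split.
  by have := vilID g1 (vilIN h1); rewrite opprB addrA subrK.
by have := vilID g2 (vilIN h2); rewrite opprB addrA subrK.
Qed.


End VilenkinTopology.

(** * Measurability of addition and invariance of integrals *)

Section HaarMeasure.
Variables (R : realType) (m : nat -> nat).
Hypothesis m_ge2 : forall k, (2 <= m k)%N.
Local Notation T := (borel 'G2_m).
Implicit Types (f g : 'G2_m -> R[i]) (z w : 'G2_m).

Lemma compact_G2 : compact [set: 'G2_m].
Proof.
have cV : compact [set: vilenkin m].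
  have := @tychonoff nat (fun k => discrete_topology 'Z_(m k)) (fun=> setT)
    (fun k => @finite_compact (discrete_topology 'Z_(m k)) setT
      (@finite_finset 'Z_(m k) setT)).
  by congr (compact _); apply/seteqP; split.
by rewrite -setXTT; exact: compact_setX.
Qed.

Lemma measurable_open (A : set 'G2_m) : open A -> measurable (A : set T).
Proof. exact: sub_sigma_algebra. Qed.

Lemma open_box N ij : open (@vil_box m N ij).
Proof. by apply/open_G2P => z hz; exists N => w; exact: vil_box_shift. Qed.

(** The source carries the product of the Borel sigma-algebras, so continuity alone does not
    conclude: the preimage of an open set is exhibited as a countable union of products of boxes. *)
Lemma measurable_vil_sum :
  measurable_fun [set: T * T] (fun zw => ((zw.1 : 'G2_m) + (zw.2 : 'G2_m)) : T).
Proof.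
pose add (zw : T * T) : T := (zw.1 : 'G2_m) + (zw.2 : 'G2_m).
have H := @measurability _ _ (T * T)%type T setT add (@open 'G2_m) erefl.
apply: H.
move=> _ [A oA <-]; rewrite setTI.
have /open_G2P oA' := oA.
have -> : add @^-1` A = \bigcup_(p in [set: nat * ((nat * nat) * (nat * nat))])
    ([set zw | vil_box p.1 p.2.1 zw.1 /\ vil_box p.1 p.2.2 zw.2 /\
       forall z w, vil_box p.1 p.2.1 z -> vil_box p.1 p.2.2 w -> A (z + w)] : set (T * T)).
  apply/seteqP; split => [[z w] /= Azw|[z w] [[N [ij ij']] _ [/= h1 [h2 h3]]]]; last exact: h3.
  have [N HN] := oA' _ Azw.
  have [ij zij] := vil_box_ex m_ge2 N z; have [ij' wij] := vil_box_ex m_ge2 N w.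
  exists (N, (ij, ij')) => //; split => //; split => // z' w' h h'; apply: HN.
    rewrite /= opprD addrACA; apply: vilID.
      by have [] := vil_box_diff zij h.
    by have [] := vil_box_diff wij h'.
  rewrite /= opprD addrACA; apply: vilID.
    by have [] := vil_box_diff zij h.
  by have [] := vil_box_diff wij h'.
apply: countable_bigcupT_measurable => // -[N [ij ij']] /=.
have [H|nH] := pselect (forall z w, vil_box N ij z -> vil_box N ij' w -> A (z + w)).
  rewrite (_ : [set _ | _] = (vil_box N ij : set T) `*` (vil_box N ij' : set T)).
    by apply: measurableX; apply: measurable_open; exact: open_box.
  by apply/seteqP; split => [[z w] [h1 [h2 h3]]|[z w] [h1 h2]].
rewrite (_ : [set _ | _] = set0) ?measurable0//.
by apply/seteqP; split => // -[z w] [_ [_ /nH]].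
Qed.

Lemma measurable_translate z : measurable_fun [set: T] (fun w => (z + (w : 'G2_m)) : T).
Proof. exact: (measurable_fun_pair2 (z : T) measurable_vil_sum). Qed.

Variable mu : probability T R.
Hypothesis mu_haar : is_haar mu.

(** [is_haar] speaks of images; the preimage under translation by [z] is the image under translation
    by [- z]. *)
Let eq_pushforward z (A : set T) : measurable A ->
  pushforward mu (fun w => (z + (w : 'G2_m)) : T) A = mu A.
Proof.
move=> mA; rewrite /pushforward /= -[RHS](mu_haar (- z) mA); congr (mu _).
apply/seteqP; split => [w /= h|_ [w Aw <-]]; last by rewrite /= addrA subrr add0r.
by exists (z + w) => //; rewrite addrA addNr add0r.
Qed.

Lemma ge0_integral_translate z (f : T -> \bar R) :
  measurable_fun [set: T] f -> (forall w, 0 <= f w)%E ->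
  (\int[mu]_w f ((z + (w : 'G2_m))%R : T) = \int[mu]_w f w)%E.
Proof.
move=> mf f0.
have mt := measurable_translate z.
have := ge0_integral_pushforward mt mu measurableT mf (fun w _ => f0 w).
rewrite preimage_setT /comp => <-.
apply: eq_measure_integral => A mA _; exact: eq_pushforward.
Qed.

Lemma integrable_translate z (f : T -> R) :
  mu.-integrable [set: T] (EFin \o f) ->
  mu.-integrable [set: T] (EFin \o (fun w => f ((z + (w : 'G2_m)) : T))).
Proof.
move=> /integrableP[mf fi]; apply/integrableP; split.
  by apply: (measurableT_comp mf); exact: measurable_translate.
rewrite -(ge0_integral_translate z) in fi => //.
exact: measurableT_comp.
Qed.

Lemma Rintegral_translate z (f : T -> R) :
  mu.-integrable [set: T] (EFin \o f) ->
  \int[mu]_w f ((z + (w : 'G2_m)) : T) = \int[mu]_w f w.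
Proof.
move=> fi; have /integrableP[mf _] := fi.
have mt := measurable_translate z.
have := @integral_pushforward _ _ _ _ _ _ mt mu setT _ mf.
rewrite preimage_setT => /(_ (integrable_translate z fi) measurableT).
rewrite /Rintegral => h; congr fine; rewrite -[LHS]h.
apply: eq_measure_integral => A mA _; exact: eq_pushforward.
Qed.

End HaarMeasure.

(** * Jensen's and Minkowski's inequalities for a probability density *)

Section WeightedAverages.
Context d (T : measurableType d) (R : realType) (mu : probability T R).
Implicit Types (f g h : T -> R) (r C : R).

Lemma integral_cst_probability (c : \bar R) : (\int[mu]_x cst c x = c)%E.
Proof.
rewrite integral_cst// -[RHS]mule1; congr (_ * _)%E; exact: probability_setT.
Qed.

Lemma measurable_normc (f : T -> R[i]) :
  measurable_fun [set: T] (fun x => complex.Re (f x)) ->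
  measurable_fun [set: T] (fun x => complex.Im (f x)) ->
  measurable_fun [set: T] (fun x => Normc.normc (f x)).
Proof.
move=> mr mi.
have -> : (fun x => Normc.normc (f x)) =
    (fun x => (complex.Re (f x) ^+ 2 + complex.Im (f x) ^+ 2) `^ 2^-1).
  apply/funext => x; rewrite powR12_sqrt; last by rewrite addr_ge0// sqr_ge0.
  by case: (f x).
apply: (measurableT_comp (measurable_powR _)).
by apply: measurable_funD; apply: measurable_funX.
Qed.

Lemma Lnorm_eq_integral r (h1 h2 : T -> \bar R) :
  (\int[mu]_x (`|h1 x| `^ r) = \int[mu]_x (`|h2 x| `^ r))%E ->
  Lnorm mu r%:E h1 = Lnorm mu r%:E h2.
Proof. by rewrite unlock => ->. Qed.

Lemma Lnorm_leP r C f : 1 <= r -> 0 <= C ->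
  (Lnorm mu r%:E (EFin \o f) <= C%:E)%E <->
  (\int[mu]_x (`|f x| `^ r)%:E <= (C `^ r)%:E)%E.
Proof.
move=> r1 C0; have r0 : 0 < r by exact: lt_le_trans r1.
have rV0 : 0 <= r^-1 by rewrite invr_ge0 ltW.
have E : (\int[mu]_x (`|f x| `^ r)%:E = Lnorm mu r%:E (EFin \o f) `^ r)%E.
  by rewrite poweR_Lnorm ?gt_eqF.
rewrite E -poweR_EFin; split=> h.
  apply: gt0_ler_poweR => //; first exact: ltW.
    by rewrite in_itv/= leey Lnorm_ge0.
  by rewrite in_itv/= leey lee_fin C0.
have := Lnorm_ge0 mu r%:E (EFin \o f).
have K x : (0 <= x)%E -> x = ((x `^ r) `^ r^-1)%E.
  by move=> x0; rewrite -poweRrM divff ?gt_eqF// poweRe1.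
move=> n0; rewrite [leLHS]K// [leRHS]K ?lee_fin//.
by apply: gt0_ler_poweR => //; rewrite in_itv/= leey andbT ?poweR_ge0// lee_fin powR_ge0.
Qed.

(** The graph of x^r lies above its tangent at [t]; this is Young's inequality with exponents r and
    r / (r - 1), the case [r = 1] being apart. *)
Lemma powR_tangent r (a t : R) : 1 <= r -> 0 <= a -> 0 <= t ->
  r * t `^ (r - 1) * a <= a `^ r + (r - 1) * t `^ r.
Proof.
rewrite le_eqVlt => /predU1P[<-|r1] a0 t0.
  by rewrite subrr powRr0 mul0r addr0 !mul1r powRr1.
have r0 : 0 < r by exact: lt_trans r1.
have r10 : 0 < r - 1 by rewrite subr_gt0.
have := @conjugate_powR R a (t `^ (r - 1)) r (r / (r - 1)) a0 (powR_ge0 _ _) r0.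
rewrite divr_gt0// => /(_ erefl).
have -> : r^-1 + (r / (r - 1))^-1 = 1 by field; rewrite !gt_eqF.
move=> /(_ erefl); rewrite -powRrM [(r - 1) * _]mulrC divfK ?gt_eqF//.
move=> h; rewrite -mulrA [t `^ _ * a]mulrC.
apply: (le_trans (ler_wpM2l (ltW r0) h)).
by rewrite le_eqVlt; apply/orP; left; apply/eqP; field; rewrite !gt_eqF.
Qed.

Variable D : T -> R.
Hypotheses (mD : measurable_fun [set: T] D) (D0 : forall x, 0 <= D x).
Hypothesis D1 : (\int[mu]_x (D x)%:E = 1)%E.

(* Jensen's inequality for the probability [D * mu], integrating the tangent
   inequality at [t]. *)
Lemma weighted_jensen r (g : T -> R) t : 1 <= r -> 0 <= t ->
  measurable_fun [set: T] g -> (forall x, 0 <= g x) ->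
  (t%:E <= \int[mu]_x (g x * D x)%:E)%E ->
  ((t `^ r)%:E <= \int[mu]_x (g x `^ r * D x)%:E)%E.
Proof.
move=> r1 t0 mg g0 tg.
have r0 : 0 < r by exact: lt_le_trans r1.
have mgD : measurable_fun [set: T] (fun x => g x * D x) by exact: measurable_funM.
have mgr : measurable_fun [set: T] (fun x => g x `^ r * D x).
  by apply: measurable_funM => //; exact: (measurableT_comp (measurable_powR _)).
have c0 : 0 <= r * t `^ (r - 1) by rewrite mulr_ge0 ?powR_ge0 ?ltW.
have c1 : 0 <= (r - 1) * t `^ r by rewrite mulr_ge0 ?powR_ge0// subr_ge0.
have h : (\int[mu]_x ((r * t `^ (r - 1))%:E * (g x * D x)%:E) <=
    \int[mu]_x ((g x `^ r * D x)%:E + ((r - 1) * t `^ r)%:E * (D x)%:E))%E.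
  apply: ge0_le_integral => //.
  - by move=> x _; rewrite -EFinM lee_fin mulr_ge0// mulr_ge0.
  - apply/measurable_EFinP; exact: measurable_funM.
  - apply/measurable_EFinP; apply: measurable_funD => //; exact: measurable_funM.
  - move=> x _; rewrite -!EFinM -EFinD lee_fin mulrA -mulrDl ler_wpM2r//.
    exact: powR_tangent.
rewrite ge0_integralZl// in h; last first.
  - by move=> x _; rewrite lee_fin mulr_ge0.
  - exact/measurable_EFinP.
rewrite ge0_integralD// in h; last first.
  - by apply/measurable_EFinP; exact: measurable_funM.
  - by move=> x _; rewrite -EFinM lee_fin mulr_ge0.
  - exact/measurable_EFinP.
  - by move=> x _; rewrite lee_fin mulr_ge0// powR_ge0.
rewrite ge0_integralZl// in h; last first.
  - by move=> x _; rewrite lee_fin.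
  - exact/measurable_EFinP.
rewrite D1 mule1 in h.
have h2 := le_trans (lee_wpmul2l _ tg) h.
have {h2} := h2 (_ : 0 <= (r * t `^ (r - 1))%:E)%E; rewrite lee_fin => /(_ c0).
rewrite -EFinM.
have -> : r * t `^ (r - 1) * t = r * t `^ r.
  rewrite -mulrA; congr (_ * _).
  have [->|tn0] := eqVneq t 0; first by rewrite mulr0 powR0// gt_eqF.
  by rewrite powRB ?tn0 ?implybT// powRr1// divfK.
have -> : r * t `^ r = t `^ r + (r - 1) * t `^ r by ring.
by rewrite EFinD leeD2rE.
Qed.

Lemma weighted_minkowski (G : T * T -> R) h r C : 1 <= r -> 0 <= C ->
  measurable_fun [set: T * T] G -> (forall xy, 0 <= G xy) ->
  measurable_fun [set: T] h -> (forall x, 0 <= h x) ->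
  (forall x, (h x)%:E <= \int[mu]_y (G (x, y) * D y)%:E)%E ->
  (forall y, D y != 0 -> (Lnorm mu r%:E (fun x => (G (x, y))%:E) <= C%:E)%E) ->
  (Lnorm mu r%:E (fun x => (h x)%:E) <= C%:E)%E.
Proof.
move=> r1 C0 mG G0 mh h0 hG GC.
have r0 : 0 < r by exact: lt_le_trans r1.
apply/Lnorm_leP => //.
have mGr : measurable_fun [set: T * T] (fun xy => G xy `^ r * D xy.2).
  apply: measurable_funM; first exact: (measurableT_comp (measurable_powR _)).
  exact: (measurableT_comp mD).
have GrD0 xy : 0 <= G xy `^ r * D xy.2 by rewrite mulr_ge0// powR_ge0.
apply: (@le_trans _ _ (\int[mu]_x \int[mu]_y (G (x, y) `^ r * D y)%:E)%E).
  apply: ge0_le_integral => //.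
  - apply/measurable_EFinP; apply: (measurableT_comp (measurable_powR _)).
    exact: measurableT_comp.
  - apply: (measurable_fun_fubini_tonelli_F (fun xy => (G xy `^ r * D xy.2)%:E)) => //.
    exact/measurable_EFinP.
  - move=> x _; rewrite ger0_norm//.
    apply: weighted_jensen => //.
    exact: (measurable_fun_pair2 x mG).
have := @fubini_tonelli _ _ _ _ _ mu mu (fun xy => (G xy `^ r * D xy.2)%:E).
move=> /= -> //; last exact/measurable_EFinP.
apply: (@le_trans _ _ (\int[mu]_y ((C `^ r)%:E * (D y)%:E))%E); last first.
  rewrite ge0_integralZl//.
  - by rewrite D1 mule1.
  - exact/measurable_EFinP.
  - by move=> y _; rewrite lee_fin.
  - by rewrite lee_fin powR_ge0.
apply: ge0_le_integral => //.
- by move=> y _; apply: integral_ge0 => x _; rewrite lee_fin (GrD0 (x, y)).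
- apply: (measurable_fun_fubini_tonelli_G (fun xy => (G xy `^ r * D xy.2)%:E)) => //.
  exact/measurable_EFinP.
- by apply/measurable_EFinP; exact: measurable_funM.
- move=> y _.
  have mGy : measurable_fun [set: T] (fun x => (G (x, y) `^ r)%:E).
    apply/measurable_EFinP; apply: (measurableT_comp (measurable_powR _)).
    exact: (measurable_fun_pair1 y mG).
  under eq_integral => x _ do rewrite mulrC EFinM.
  rewrite ge0_integralZl//; last first.
  - by rewrite lee_fin.
  - by move=> x _; rewrite lee_fin powR_ge0.
  have [->|Dy] := eqVneq (D y) 0; first by rewrite mul0e mule0.
  rewrite muleC lee_wpmul2r ?lee_fin//.
  have /Lnorm_leP := GC y Dy.
  move=> /(_ r1 C0); apply: le_trans.
  by under eq_integral => x _ do rewrite -[G (x, y)]ger0_norm//.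
Qed.

End WeightedAverages.

(** * Integration of complex functions *)

Section ComplexIntegral.
Variables (R : realType) (m : nat -> nat).
Hypothesis m_ge2 : forall k, (2 <= m k)%N.
Local Notation T := (borel 'G2_m).
Local Notation nc := (@Normc.normc R).
Implicit Types (f g : 'G2_m -> R[i]) (z w : 'G2_m).

Lemma cmeasurableD f g : cmeasurable f -> cmeasurable g ->
  cmeasurable (fun z => f z + g z).
Proof.
move=> [f1 f2] [g1 g2]; split.
  rewrite (_ : (fun _ => _) = (fun z : T => complex.Re (f z) + complex.Re (g z))).
    exact: measurable_funD.
  by apply/funext => z; case: (f z) (g z) => ? ? [].
rewrite (_ : (fun _ => _) = (fun z : T => complex.Im (f z) + complex.Im (g z))).
  exact: measurable_funD.
by apply/funext => z; case: (f z) (g z) => ? ? [].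
Qed.

Lemma cmeasurableM f g : cmeasurable f -> cmeasurable g ->
  cmeasurable (fun z => f z * g z).
Proof.
move=> [f1 f2] [g1 g2]; split.
  rewrite (_ : (fun _ => _) = (fun z : T => complex.Re (f z) * complex.Re (g z)
     - complex.Im (f z) * complex.Im (g z))).
    by apply: measurable_funB; exact: measurable_funM.
  by apply/funext => z; case: (f z) (g z) => ? ? [].
rewrite (_ : (fun _ => _) = (fun z : T => complex.Re (f z) * complex.Im (g z)
     + complex.Im (f z) * complex.Re (g z))).
  by apply: measurable_funD; exact: measurable_funM.
by apply/funext => z; case: (f z) (g z) => ? ? [].
Qed.

Lemma cmeasurable_cst (c : R[i]) : @cmeasurable R m (fun=> c).
Proof. by split; exact: measurable_cst. Qed.

Lemma cmeasurableZ (c : R[i]) f : cmeasurable f -> cmeasurable (fun z => c * f z).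
Proof. by move=> mf; apply: cmeasurableM => //; exact: cmeasurable_cst. Qed.



Lemma cmeasurable_translate f w : cmeasurable f -> cmeasurable (fun z => f (w + z)).
Proof.
move=> [f1 f2]; split.
  exact: (measurableT_comp f1 (measurable_translate m_ge2 w)).
exact: (measurableT_comp f2 (measurable_translate m_ge2 w)).
Qed.

Lemma measurable_locally_constant (h : T -> R) N :
  (forall z w, vilI N (w.1 - z.1) -> vilI N (w.2 - z.2) -> h w = h z) ->
  measurable_fun [set: T] h.
Proof.
move=> hc _ B mB; rewrite setTI; apply: measurable_open.
apply/open_G2P => z /= Bz; exists N => w h1 h2; by rewrite /= (hc z w).
Qed.

Lemma cmeasurable_locally_constant f N :
  (forall z w, vilI N (w.1 - z.1) -> vilI N (w.2 - z.2) -> f w = f z) ->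
  cmeasurable f.
Proof.
by move=> fc; split; apply: (@measurable_locally_constant _ N) => z w h1 h2; rewrite (fc z w).
Qed.

Lemma vil_psi_locally_constant n (x y : vilenkin m) :
  vilI n.+1 (y - x) -> vil_psi R n y = vil_psi R n x.
Proof.
move=> Iyx; rewrite -(subrK x y) vil_psiD// (vil_psi_vilI _ _ (ltn_vilM m_ge2 n) Iyx)//.
exact: mul1r.
Qed.

Lemma cmeasurable_vil_psi1 n : cmeasurable (fun z : 'G2_m => vil_psi R n z.1).
Proof.
by apply: (@cmeasurable_locally_constant _ n.+1) => z w h1 _; exact: vil_psi_locally_constant.
Qed.

Lemma cmeasurable_vil_psi2 n : cmeasurable (fun z : 'G2_m => vil_psi R n z.2).
Proof.
by apply: (@cmeasurable_locally_constant _ n.+1) => z w _; exact: vil_psi_locally_constant.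
Qed.

Lemma measurable_cnormc f : cmeasurable f ->
  measurable_fun [set: T] (fun z => nc (f z)).
Proof. by case; exact: measurable_normc. Qed.

Lemma normr_Re_le (x : R[i]) : `|complex.Re x| <= nc x.
Proof.
by case: x => a b /=; rewrite -sqrtr_sqr ler_sqrt ?addr_ge0 ?sqr_ge0// lerDl sqr_ge0.
Qed.

Lemma normr_Im_le (x : R[i]) : `|complex.Im x| <= nc x.
Proof.
by case: x => a b /=; rewrite -sqrtr_sqr ler_sqrt ?addr_ge0 ?sqr_ge0// lerDr sqr_ge0.
Qed.

Variable mu : probability T R.

Definition cintegrable f : Prop :=
  cmeasurable f /\ (\int[mu]_z (nc (f z))%:E < +oo)%E.

Lemma cintegrable_Re f : cintegrable f ->
  mu.-integrable [set: T] (EFin \o (fun z => complex.Re (f z))).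
Proof.
move=> [[f1 f2] fi]; apply/integrableP; split; first exact/measurable_EFinP.
apply: le_lt_trans fi; apply: ge0_le_integral => //=.
- apply/measurable_EFinP; exact: measurableT_comp.
- by apply/measurable_EFinP; exact: measurable_cnormc.
- by move=> z _; rewrite lee_fin normr_Re_le.
Qed.

Lemma cintegrable_Im f : cintegrable f ->
  mu.-integrable [set: T] (EFin \o (fun z => complex.Im (f z))).
Proof.
move=> [[f1 f2] fi]; apply/integrableP; split; first exact/measurable_EFinP.
apply: le_lt_trans fi; apply: ge0_le_integral => //=.
- apply/measurable_EFinP; exact: measurableT_comp.
- by apply/measurable_EFinP; exact: measurable_cnormc.
- by move=> z _; rewrite lee_fin normr_Im_le.
Qed.

Lemma cintegrableD f g : cintegrable f -> cintegrable g ->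
  cintegrable (fun z => f z + g z).
Proof.
move=> [mf fi] [mg gi]; split; first exact: cmeasurableD.
have mnf := measurable_cnormc mf; have mng := measurable_cnormc mg.
apply: (@le_lt_trans _ _ (\int[mu]_z ((nc (f z))%:E + (nc (g z))%:E))%E).
  apply: ge0_le_integral => //=.
  - by move=> z _; rewrite lee_fin normc_ge0.
  - by apply/measurable_EFinP; apply: measurable_cnormc; exact: cmeasurableD.
  - by apply/measurable_EFinP; exact: measurable_funD.
  - by move=> z _; rewrite -EFinD lee_fin; exact: ler_normcD.
rewrite ge0_integralD//; first exact: lte_add_pinfty.
- by move=> z _; rewrite lee_fin normc_ge0.
- exact/measurable_EFinP.
- by move=> z _; rewrite lee_fin normc_ge0.
- exact/measurable_EFinP.
Qed.

Lemma cintegrable_bounded f g (K : R) : cintegrable f -> cmeasurable g ->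
  (forall z, nc (g z) <= K) -> cintegrable (fun z => g z * f z).
Proof.
move=> [mf fi] mg gK; split; first exact: cmeasurableM.
have K0 : 0 <= K by exact: le_trans (normc_ge0 _) (gK 0).
have mnf := measurable_cnormc mf.
apply: (@le_lt_trans _ _ (\int[mu]_z (K%:E * (nc (f z))%:E))%E).
  apply: ge0_le_integral => //=.
  - by move=> z _; rewrite lee_fin normc_ge0.
  - by apply/measurable_EFinP; apply: measurable_cnormc; exact: cmeasurableM.
  - by apply/measurable_EFinP; exact: measurable_funM.
  - by move=> z _; rewrite -EFinM lee_fin Normc.normcM ler_wpM2r// normc_ge0.
rewrite ge0_integralZl//.
- by rewrite lte_mul_pinfty// integral_ge0// => z _; rewrite lee_fin normc_ge0.
- exact/measurable_EFinP.
- by move=> z _; rewrite lee_fin normc_ge0.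
Qed.

Lemma cintegrableZ (c : R[i]) f : cintegrable f -> cintegrable (fun z => c * f z).
Proof.
move=> fi; apply: (@cintegrable_bounded _ (fun=> c) (nc c)) => //.
Qed.

Lemma cintegrable_sum n (F : nat -> 'G2_m -> R[i]) :
  (forall i, cintegrable (F i)) ->
  cintegrable (fun z => \sum_(0 <= i < n) F i z).
Proof.
move=> mF; elim: n => [|n IH].
  rewrite (_ : (fun _ => _) = fun z => 0 * F 0 z); first exact: cintegrableZ.
  by apply/funext => z; rewrite big_geq// mul0r.
rewrite (_ : (fun _ => _) = fun z => \sum_(0 <= i < n) F i z + F n z).
  exact: cintegrableD.
by apply/funext => z; rewrite big_nat_recr.
Qed.

Lemma cintegralD f g : cintegrable f -> cintegrable g ->
  cintegral mu (fun z => f z + g z) = cintegral mu f + cintegral mu g.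
Proof.
move=> fi gi.
have E1 : \int[mu]_z complex.Re (f z + g z) =
    \int[mu]_z complex.Re (f z) + \int[mu]_z complex.Re (g z).
  rewrite -RintegralD//; try exact: cintegrable_Re.
  by apply: eq_Rintegral => z _; case: (f z) (g z) => ? ? [].
have E2 : \int[mu]_z complex.Im (f z + g z) =
    \int[mu]_z complex.Im (f z) + \int[mu]_z complex.Im (g z).
  rewrite -RintegralD//; try exact: cintegrable_Im.
  by apply: eq_Rintegral => z _; case: (f z) (g z) => ? ? [].
by rewrite /cintegral E1 E2.
Qed.

Lemma cintegralZ (c : R[i]) f : cintegrable f ->
  cintegral mu (fun z => c * f z) = c * cintegral mu f.
Proof.
move=> fi; have fr := cintegrable_Re fi; have fI := cintegrable_Im fi.
case: c => a b.
have iZ (u : R) (h : T -> R) : mu.-integrable [set: T] (EFin \o h) ->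
    mu.-integrable [set: T] (EFin \o (fun z => u * h z)).
  move=> hi; rewrite (_ : _ \o _ = (fun z => u%:E * (EFin \o h) z)%E) //.
  exact: integrableZl.
have E1 : \int[mu]_z complex.Re ((a +i* b)%C * f z) =
    a * \int[mu]_z complex.Re (f z) - b * \int[mu]_z complex.Im (f z).
  rewrite -!RintegralZl// -RintegralB//; [|exact: iZ|exact: iZ].
  by apply: eq_Rintegral => z _; case: (f z).
have E2 : \int[mu]_z complex.Im ((a +i* b)%C * f z) =
    a * \int[mu]_z complex.Im (f z) + b * \int[mu]_z complex.Re (f z).
  rewrite -!RintegralZl// -RintegralD//; [|exact: iZ|exact: iZ].
  by apply: eq_Rintegral => z _; case: (f z).
by rewrite /cintegral E1 E2.
Qed.

Lemma cintegral_sum n (F : nat -> 'G2_m -> R[i]) :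
  (forall i, cintegrable (F i)) ->
  cintegral mu (fun z => \sum_(0 <= i < n) F i z) = \sum_(0 <= i < n) cintegral mu (F i).
Proof.
move=> mF; elim: n => [|n IH].
  transitivity (0 * cintegral mu (F 0)); last by rewrite mul0r big_geq.
  rewrite -cintegralZ//; congr cintegral.
  by apply/funext => z; rewrite big_geq// mul0r.
rewrite big_nat_recr//= -IH -cintegralD//; last exact: cintegrable_sum.
by congr cintegral; apply/funext => z; rewrite big_nat_recr.
Qed.

(** With c the integral of f, |c|^2 is the integral of the real part of c^* f, hence at most |c|
    times the integral of |f|. *)
Lemma normc_cintegral_le f : cintegrable f ->
  ((nc (cintegral mu f))%:E <= \int[mu]_z (nc (f z))%:E)%E.
Proof.
move=> fi; have fr := cintegrable_Re fi; have fI := cintegrable_Im fi.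
have [mf flt] := fi; have mnf := measurable_cnormc mf.
set c := cintegral mu f; set K := nc c.
have K0 : 0 <= K by exact: normc_ge0.
have n0 : (0 <= \int[mu]_z (nc (f z))%:E)%E.
  by apply: integral_ge0 => z _; rewrite lee_fin normc_ge0.
have [->//|Kn0] := eqVneq K 0.
have Kp : 0 < K by rewrite lt_def Kn0.
have ci := cintegrableZ c^* fi.
have K2 : (K ^+ 2)%:E = (\int[mu]_z (complex.Re (c^* * f z))%:E)%E.
  have : cintegral mu (fun z => c^* * f z) = (K ^+ 2)%:C%C.
    by rewrite cintegralZ// mulrC /K normc_sqr.
  move=> /(congr1 (@complex.Re R)) /= h.
  rewrite -h /Rintegral fineK//.
  exact: (integrable_fin_num _ (cintegrable_Re ci)).
have h : ((K ^+ 2)%:E <= \int[mu]_z (K%:E * (nc (f z))%:E))%E.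
  rewrite K2; apply: le_integral => //.
  - exact: cintegrable_Re.
  - apply/integrableP; split.
      by apply/measurable_EFinP; exact: measurable_funM.
    under eq_integral => z _ do rewrite gee0_abs ?mule_ge0 ?lee_fin ?normc_ge0//.
    rewrite ge0_integralZl//.
    + by rewrite lte_mul_pinfty.
    + exact/measurable_EFinP.
    + by move=> z _; rewrite lee_fin normc_ge0.
  - move=> z _; rewrite -EFinM lee_fin (le_trans (ler_norm _))//.
    by rewrite (le_trans (normr_Re_le _))// Normc.normcM normc_conj.
rewrite ge0_integralZl// in h; last first.
- by move=> z _; rewrite lee_fin normc_ge0.
- exact/measurable_EFinP.
by rewrite expr2 EFinM lee_pmul2l// lte_fin in h.
Qed.

Hypothesis mu_haar : is_haar mu.

Lemma cintegrable_translate f w : cintegrable f -> cintegrable (fun z => f (w + z)).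
Proof.
move=> [mf fi]; split; first exact: cmeasurable_translate.
rewrite (ge0_integral_translate m_ge2 mu_haar w (f := fun z => (nc (f z))%:E))//.
  by apply/measurable_EFinP; exact: measurable_cnormc.
by move=> z; rewrite lee_fin normc_ge0.
Qed.

Lemma cintegral_translate f w : cintegrable f ->
  cintegral mu (fun z => f (w + z)) = cintegral mu f.
Proof.
move=> fi; rewrite /cintegral.
have h1 := Rintegral_translate m_ge2 mu_haar w (cintegrable_Re fi).
have h2 := Rintegral_translate m_ge2 mu_haar w (cintegrable_Im fi).
by rewrite h1 h2.
Qed.

End ComplexIntegral.

(** * L^p norms, averages and the Dirichlet kernel *)

Section LpNorms.
Variables (R : realType) (m : nat -> nat).
Hypothesis m_ge2 : forall k, (2 <= m k)%N.
Local Notation T := (borel 'G2_m).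
Local Notation nc := (@Normc.normc R).
Local Notation psi := (@vil_psi R m).
Local Notation M k := (vilM m k).
Implicit Types (f g : 'G2_m -> R[i]) (z w : 'G2_m).
Variable mu : probability T R.
Variable p : \bar R.
Hypothesis p1 : (1 <= p)%E.

Lemma Lpnorm_leP r f (C : R) : 1 <= r -> 0 <= C ->
  (Lpnorm mu r%:E f <= C%:E)%E <->
  (\int[mu]_z (nc (f z) `^ r)%:E <= (C `^ r)%:E)%E.
Proof.
move=> r1 C0; have := Lnorm_leP mu (fun z => nc (f z)) r1 C0.
by under eq_integral => z _ do rewrite ger0_norm ?normc_ge0//.
Qed.

Lemma Lpnorm_supP f (C : R) :
  (Lpnorm mu +oo f <= C%:E)%E <-> forall z, nc (f z) <= C.
Proof.
split=> [h z|h].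
  rewrite -lee_fin; apply: le_trans h; apply: ereal_sup_ubound.
  by exists z.
by apply: ge_ereal_sup => _ [z _ <-]; rewrite lee_fin.
Qed.

Lemma Lpnorm_ge0 f : (0 <= Lpnorm mu p f)%E.
Proof.
case: p p1 => [r|_|//]; first by move=> _; exact: Lnorm_ge0.
apply: (@le_trans _ _ (nc (f 0))%:E); first by rewrite lee_fin normc_ge0.
by apply: ereal_sup_ubound; exists 0.
Qed.

(** At [p = +oo] this asks for measurability and boundedness in place of continuity, so that one
    argument serves all exponents. *)
Definition Lp_fun f : Prop := cmeasurable f /\ (Lpnorm mu p f < +oo)%E.

Definition Lp_real f : R := fine (Lpnorm mu p f).

Lemma Lp_realE f : Lp_fun f -> Lpnorm mu p f = (Lp_real f)%:E.
Proof. by case=> _ fi; rewrite fineK// ge0_fin_numE// Lpnorm_ge0. Qed.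

Lemma Lp_real_ge0 f : 0 <= Lp_real f.
Proof. by rewrite fine_ge0// Lpnorm_ge0. Qed.

Lemma LpnormD f g : cmeasurable f -> cmeasurable g ->
  (Lpnorm mu p (fun z => f z + g z)%R <= Lpnorm mu p f + Lpnorm mu p g)%E.
Proof.
move=> mf mg; case: p p1 => [r|_|//].
  rewrite lee_fin => r1.
  have mnf := measurable_cnormc mf; have mng := measurable_cnormc mg.
  apply: le_trans (minkowski_EFin mu mnf mng r1).
  have [->|fin] := eqVneq (Lnorm mu r%:E (EFin \o ((fun z => nc (f z)) \+ (fun z => nc (g z))))) +oo%E.
    by rewrite leey.
  have L0 := Lnorm_ge0 mu r%:E (EFin \o ((fun z => nc (f z)) \+ (fun z => nc (g z)))).
  have finN : Lnorm mu r%:E (EFin \o ((fun z => nc (f z)) \+ (fun z => nc (g z)))) \is a fin_num.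
    by rewrite ge0_fin_numE// ltey.
  rewrite -(fineK finN); apply/Lpnorm_leP => //; first exact: fine_ge0.
  have := Lnorm_leP mu ((fun z => nc (f z)) \+ (fun z => nc (g z))) r1 (fine_ge0 L0).
  rewrite (fineK finN) => -[/(_ (lexx _)) h _]; apply: le_trans h.
  apply: ge0_le_integral => //=.
  - by move=> z _; rewrite lee_fin powR_ge0.
  - apply/measurable_EFinP; apply: (measurableT_comp (measurable_powR _)).
    by apply: measurable_cnormc; exact: cmeasurableD.
  - apply/measurable_EFinP; apply: (measurableT_comp (measurable_powR _)).
    by apply: measurableT_comp => //; exact: measurable_funD.
  - move=> z _; rewrite lee_fin ger0_norm ?addr_ge0 ?normc_ge0//.
    rewrite ge0_ler_powR ?nnegrE ?addr_ge0 ?normc_ge0 ?ler_normcD//.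
    exact: le_trans r1.
apply: ge_ereal_sup => _ [z _ <-].
apply: (@le_trans _ _ ((nc (f z))%:E + (nc (g z))%:E)%E).
  by rewrite -EFinD lee_fin ler_normcD.
by apply: leeD; apply: ereal_sup_ubound; exists z.
Qed.

Lemma Lp_funD f g : Lp_fun f -> Lp_fun g -> Lp_fun (fun z => f z + g z).
Proof.
move=> [mf fi] [mg gi]; split; first exact: cmeasurableD.
exact: le_lt_trans (LpnormD mf mg) (lte_add_pinfty fi gi).
Qed.

Lemma LpnormZ (c : R[i]) f : Lp_fun f ->
  (Lpnorm mu p (fun z => c * f z)%R <= (nc c * Lp_real f)%:E)%E.
Proof.
move=> Lf; have := Lp_realE Lf; have := Lp_real_ge0 f; case: Lf => mf _.
set C := Lp_real f; clearbody C.
have c0 : 0 <= nc c by exact: normc_ge0.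
case: p p1 => [r|_|//].
  rewrite lee_fin => r1 C0 E.
  have /(Lpnorm_leP _ r1 C0) h : (Lpnorm mu r%:E f <= C%:E)%E by rewrite E.
  apply/Lpnorm_leP => //; first exact: mulr_ge0.
  under eq_integral => z _ do rewrite Normc.normcM powRM ?normc_ge0// EFinM.
  have mnf := measurable_cnormc mf.
  rewrite ge0_integralZl//; last first.
  - by rewrite lee_fin powR_ge0.
  - by move=> z _; rewrite lee_fin powR_ge0.
  - by apply/measurable_EFinP; apply: (measurableT_comp (measurable_powR _)).
  by rewrite powRM// EFinM lee_wpmul2l// lee_fin powR_ge0.
move=> C0 E; apply/Lpnorm_supP => z.
have /Lpnorm_supP h : (Lpnorm mu +oo f <= C%:E)%E by rewrite E.
by rewrite Normc.normcM ler_wpM2l.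
Qed.

Lemma Lp_funZ (c : R[i]) f : Lp_fun f -> Lp_fun (fun z => c * f z).
Proof.
move=> Lf; split; first by case: Lf => mf _; exact: cmeasurableZ.
exact: le_lt_trans (LpnormZ c Lf) (ltry _).
Qed.

Lemma Lp_funB f g : Lp_fun f -> Lp_fun g -> Lp_fun (fun z => f z - g z).
Proof.
move=> Lf Lg; rewrite (_ : (fun _ => _) = (fun z => f z + -1 * g z)).
  by apply: Lp_funD => //; exact: Lp_funZ.
by apply/funext => z; rewrite mulN1r.
Qed.

Lemma Lp_fun_bounded f (C : R) : cmeasurable f -> (forall z, nc (f z) <= C) ->
  Lp_fun f.
Proof.
move=> mf fC; split => //; have C0 : 0 <= C by exact: le_trans (normc_ge0 _) (fC 0).
apply: le_lt_trans (ltry C); case: p p1 => [r|_|//]; last exact/Lpnorm_supP.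
rewrite lee_fin => r1; apply/Lpnorm_leP => //.
apply: (@le_trans _ _ (\int[mu]_z (cst (C `^ r)%:E z))%E); last first.
  by rewrite integral_cst_probability.
apply: ge0_le_integral => //=.
- by move=> z _; rewrite lee_fin powR_ge0.
- apply/measurable_EFinP; apply: (measurableT_comp (measurable_powR _)).
  exact: measurable_cnormc.
- move=> z _; rewrite lee_fin ge0_ler_powR ?nnegrE ?normc_ge0//.
  exact: le_trans r1.
Qed.

Lemma Lp_fun_sum n (F : nat -> 'G2_m -> R[i]) : (forall i, Lp_fun (F i)) ->
  Lp_fun (fun z => \sum_(0 <= i < n) F i z).
Proof.
move=> LF; elim: n => [|n IH].
  rewrite (_ : (fun _ => _) = fun z => 0 * F 0 z); first exact: Lp_funZ.
  by apply/funext => z; rewrite big_geq// mul0r.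
rewrite (_ : (fun _ => _) = fun z => \sum_(0 <= i < n) F i z + F n z).
  exact: Lp_funD.
by apply/funext => z; rewrite big_nat_recr.
Qed.

(** On a probability space, |f| <= 1 + |f|^r for r >= 1. *)
Lemma Lp_fun_cintegrable f : Lp_fun f -> cintegrable mu f.
Proof.
move=> Lf; split; first by case: Lf.
have mf : cmeasurable f by case: Lf.
have := Lp_realE Lf; have := Lp_real_ge0 f; set C := Lp_real f; clearbody C.
have mnf := measurable_cnormc mf.
case: p p1 => [r|_|//]; last first.
  move=> C0 E; have /Lpnorm_supP h : (Lpnorm mu +oo f <= C%:E)%E by rewrite E.
  apply: (@le_lt_trans _ _ (\int[mu]_z (cst C%:E z))%E); last first.
    by rewrite integral_cst_probability ltry.
  apply: ge0_le_integral => //=.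
  - by move=> z _; rewrite lee_fin normc_ge0.
  - exact/measurable_EFinP.
  - by move=> z _; rewrite lee_fin.
rewrite lee_fin => r1 C0 E.
have /(Lpnorm_leP _ r1 C0) h : (Lpnorm mu r%:E f <= C%:E)%E by rewrite E.
apply: (@le_lt_trans _ _ (\int[mu]_z ((cst 1%:E) z + (nc (f z) `^ r)%:E))%E).
  apply: ge0_le_integral => //=.
  - by move=> z _; rewrite lee_fin normc_ge0.
  - exact/measurable_EFinP.
  - apply/measurable_EFinP; apply: measurable_funD => //.
    exact: (measurableT_comp (measurable_powR _)).
  - move=> z _; rewrite -EFinD lee_fin.
    have [f1|f1] := leP (nc (f z)) 1.
      by rewrite (le_trans f1)// lerDl powR_ge0.
    have : nc (f z) `^ 1 <= nc (f z) `^ r by rewrite ler_powR// ltW.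
    by rewrite powRr1 ?normc_ge0// => /le_trans; apply; rewrite lerDr.
rewrite ge0_integralD//=.
- apply: lte_add_pinfty; first by rewrite integral_cst_probability ltry.
  exact: le_lt_trans h (ltry _).
- by move=> z _; rewrite lee_fin powR_ge0.
- by apply/measurable_EFinP; exact: (measurableT_comp (measurable_powR _)).
Qed.

(** Only [p = +oo] has content: a continuous function is Borel, and bounded by compactness of the
    group. *)
Lemma in_Lp_fun f : in_Lp mu p f -> Lp_fun f.
Proof.
rewrite /Lp_fun; case: p p1 => [r _ //|_ cf|//].
(* Serves the real part, the imaginary part and the modulus, all 1-Lipschitz. *)
have cnt (h : R[i] -> R) (hL : forall x y, `|h x - h y| <= nc (x - y)) :
    continuous (fun z : 'G2_m => h (f z) : R).
  move=> z; apply/cvgrPdist_lt => e e0.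
  have := cf z; move/cvgrPdist_lt/(_ e%:C%C) => cfz.
  have {}cfz := cfz (_ : 0 < e%:C%C); rewrite ltcR in cfz.
  apply: filterS (cfz e0) => w /=.
  rewrite normcE_real ltcR; exact: le_lt_trans (hL _ _).
have cmeas (h : 'G2_m -> R) : continuous h -> measurable_fun [set: T] (h : T -> R).
  move=> ch; apply: (@measurability _ _ _ _ _ _ _ (RGenOpens.measurableE R)).
  move=> _ [_ [a [b ->]] <-]; rewrite setTI; apply: measurable_open.
  by move/continuousP: ch; apply; exact: itv_open.
split; first split.
- by apply: cmeas; apply: cnt => -[a b] [c d]; exact: (normr_Re_le (_ +i* _)%C).
- by apply: cmeas; apply: cnt => -[a b] [c d]; exact: (normr_Im_le (_ +i* _)%C).
have cN : continuous (fun z : 'G2_m => nc (f z) : R).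
  apply: cnt => x y.
  have h1 : nc x <= nc (x - y) + nc y by rewrite -{1}(subrK y x) ler_normcD.
  have h2 : nc y <= nc (x - y) + nc x.
    by rewrite -(normc_opp (x - y)) opprB -{1}(subrK x y) ler_normcD.
  by rewrite ler_norml; apply/andP; split; lra.
have [c _ cmax] := @compact_EVT_max 'G2_m R (fun z => nc (f z)) setT
  (ex_intro _ 0 I) (@compact_G2 m) (continuous_subspaceT cN).
apply: le_lt_trans (ltry (nc (f c))); apply/Lpnorm_supP => z.
by apply: cmax; rewrite inE.
Qed.

(** Minkowski's integral inequality for every [p] at once; at [p = +oo] it is a pointwise bound,
    since the norm is a true supremum. *)
Lemma Lpnorm_average (D : T -> R) (Phi : 'G2_m -> 'G2_m -> R[i]) f (C : R) :
  measurable_fun [set: T] D -> (forall w, 0 <= D w) ->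
  (\int[mu]_w (D w)%:E = 1)%E ->
  measurable_fun [set: T * T] (fun zw => nc (Phi zw.1 zw.2)) ->
  cmeasurable f -> 0 <= C ->
  (forall z, (nc (f z))%:E <= \int[mu]_w (nc (Phi z w) * D w)%:E)%E ->
  (forall w, D w != 0 -> (Lpnorm mu p (fun z => Phi z w) <= C%:E)%E) ->
  (Lpnorm mu p f <= C%:E)%E.
Proof.
move=> mD D0 D1 mPhi mf C0 fPhi PhiC; have mnf := measurable_cnormc mf.
case: p p1 PhiC => [r|_|//].
  rewrite lee_fin => r1 PhiC.
  apply: (@weighted_minkowski _ _ _ mu D mD D0 D1 (fun zw => nc (Phi zw.1 zw.2))
    (fun z => nc (f z)) r C) => //; by move=> *; exact: normc_ge0.
move=> PhiC; apply/Lpnorm_supP => z; rewrite -lee_fin; apply: le_trans (fPhi z) _.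
have -> : C%:E = (\int[mu]_w (C%:E * (D w)%:E))%E.
  rewrite ge0_integralZl//.
  - by rewrite D1 mule1.
  - exact/measurable_EFinP.
  - by move=> w _; rewrite lee_fin.
apply: ge0_le_integral => //=.
- by move=> w _; rewrite lee_fin mulr_ge0 ?normc_ge0.
- apply/measurable_EFinP; apply: measurable_funM => //.
  exact: (measurable_fun_pair2 (z : T) mPhi).
- by apply/measurable_EFinP; exact: measurable_funM.
- move=> w _; rewrite -EFinM lee_fin.
  have [->|Dw] := eqVneq (D w) 0; first by rewrite !mulr0.
  by rewrite ler_wpM2r//; have /Lpnorm_supP := PhiC w Dw; exact.
Qed.

Hypothesis mu_haar : is_haar mu.

Lemma Lpnorm_translate f w : cmeasurable f ->
  Lpnorm mu p (fun z => f (w + z)) = Lpnorm mu p f.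
Proof.
move=> mf; have mnf := measurable_cnormc mf; case: p p1 => [r|_|//].
  rewrite lee_fin => r1; apply: Lnorm_eq_integral.
  have := ge0_integral_translate m_ge2 mu_haar w
    (f := fun z : T => (`|(nc (f z))%:E| `^ r)%E).
  apply => [|z]; last exact: poweR_ge0.
  rewrite (_ : (fun _ => _) = EFin \o (fun z => `|nc (f z)| `^ r)) //.
  apply/measurable_EFinP.
  by apply: (measurableT_comp (measurable_powR _)); exact: measurableT_comp.
congr ereal_sup; apply/seteqP; split => _ [z _ <-]; first by exists (w + z).
by exists (- w + z) => //; rewrite addrA subrr add0r.
Qed.

Lemma Lp_fun_translate f w : Lp_fun f -> Lp_fun (fun z => f (w + z)).
Proof.
by move=> [mf fi]; split; [exact: cmeasurable_translate|rewrite Lpnorm_translate].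
Qed.

(* The Dirichlet kernel of order [M N]. *)
Definition vil_dirac N (x : vilenkin m) : R :=
  if `[< vilI N x >] then (M N)%:R else 0.

Lemma vil_dirac_ge0 N x : 0 <= vil_dirac N x.
Proof. by rewrite /vil_dirac; case: ifP. Qed.

Lemma vil_diracE N x : (vil_dirac N x)%:C%C = \sum_(0 <= i < M N) psi i x.
Proof.
by rewrite vil_dirichlet// /vil_dirac; case: ifP => // _; exact: real_complex_nat.
Qed.

Lemma vil_diracN N x : vil_dirac N (- x) = vil_dirac N x.
Proof.
rewrite /vil_dirac (_ : `[< vilI N (- x) >] = `[< vilI N x >])//.
apply/idP/idP => /asboolP h; apply/asboolP; last exact: vilIN.
by rewrite -[x]opprK; exact: vilIN.
Qed.

(** Exactly one representative moves [x] into [vilI N]; in terms of characters, summation over the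
    representatives leaves only the frequency 0. *)
Lemma vil_dirac_sum N x :
  \sum_(0 <= u < M N) vil_dirac N (x + vil_of_nat m u) = (M N)%:R.
Proof.
apply: (@complexI R); rewrite rmorph_sum /=.
under eq_bigr do rewrite vil_diracE.
rewrite exchange_big/=.
under eq_big_nat => i /andP[_ iN].
  under eq_bigr => u _.
    rewrite vil_psiD// -[psi i (vil_of_nat m u)]mulr1 -(rmorph1 Num.conj) -(vil_psi_index0 R m_ge2 (vil_of_nat m u)).
    over.
  rewrite -mulr_sumr vil_psi_orthogonal ?vilM_gt0//; over.
rewrite (bigD1_seq 0%N) ?mem_index_iota ?iota_uniq ?vilM_gt0//= big1 => [|j ji].
  by rewrite addr0 vil_psi_index0// mul1r real_complex_nat.
by rewrite (negbTE ji) mulr0.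
Qed.

Definition vil_dirac2 N N' (w : T) : R := vil_dirac N w.1 * vil_dirac N' w.2.

Lemma vil_dirac_shift N (x y : vilenkin m) : vilI N (y - x) -> vil_dirac N y = vil_dirac N x.
Proof.
move=> Iyx; rewrite /vil_dirac (_ : `[< vilI N y >] = `[< vilI N x >])//.
apply/idP/idP => /asboolP h; apply/asboolP.
  by rewrite -[x](subKr y); apply: vilID => //; exact: vilIN.
by rewrite -[y](subrK x); exact: vilID.
Qed.

Lemma measurable_vil_dirac2 N N' : measurable_fun [set: T] (vil_dirac2 N N').
Proof.
apply: (@measurable_locally_constant _ _ _ (maxn N N')) => z w h1 h2.
rewrite /vil_dirac2 (@vil_dirac_shift N z.1 w.1) ?(@vil_dirac_shift N' z.2 w.2)//.
  by apply: vilI_le h2; exact: leq_maxr.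
by apply: vilI_le h1; exact: leq_maxl.
Qed.

(** The measure is known only through invariance and total mass 1. The translates by all pairs of
    representatives have equal integrals and add up to the constant [K], so [K] times the integral
    is [K]. *)
Lemma integral_vil_dirac2 N N' : (\int[mu]_w (vil_dirac2 N N' w)%:E = 1)%E.
Proof.
have D0 w : 0 <= vil_dirac2 N N' w by rewrite mulr_ge0 ?vil_dirac_ge0.
have mD := measurable_vil_dirac2 N N'.
pose a u v : 'G2_m := (vil_of_nat m u, vil_of_nat m v).
set I1 := (\int[mu]_w _)%E.
have trans u v : (\int[mu]_w (vil_dirac2 N N' ((a u v + (w : 'G2_m))%R : T))%:E = I1)%E.
  rewrite (ge0_integral_translate m_ge2 mu_haar (a u v) (f := fun w => (vil_dirac2 N N' w)%:E))//.
  exact/measurable_EFinP.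
have mtr u v : measurable_fun [set: T] (fun w => vil_dirac2 N N' ((a u v + (w : 'G2_m))%R : T)).
  exact: (measurableT_comp mD (measurable_translate m_ge2 (a u v))).
pose K : R := (M N)%:R * (M N')%:R.
have K0 : 0 < K by rewrite mulr_gt0// ltr0n vilM_gt0.
have S w : \sum_(0 <= u < M N) \sum_(0 <= v < M N') vil_dirac2 N N' ((a u v + (w : 'G2_m))%R : T) = K.
  rewrite /vil_dirac2 /=; under eq_bigr do rewrite -mulr_sumr.
  rewrite -mulr_suml /K; congr (_ * _).
    by under eq_bigr do rewrite addrC; exact: vil_dirac_sum.
  by under eq_bigr do rewrite addrC; exact: vil_dirac_sum.
have cst n (x : \bar R) : (0 <= x)%E -> (\sum_(0 <= i < n) x = n%:R%:E * x)%E.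
  move=> x0; elim: n => [|n IH]; first by rewrite big_geq// mul0e.
  by rewrite big_nat_recr//= IH -natr1 EFinD ge0_muleDl ?mul1e.
have I0 : (0 <= I1)%E by apply: integral_ge0 => w _; rewrite lee_fin.
have : (K%:E * I1 = K%:E)%E.
  rewrite -[RHS](integral_cst_probability mu).
  transitivity (\int[mu]_w (\sum_(0 <= u < M N) \sum_(0 <= v < M N')
      (vil_dirac2 N N' ((a u v + (w : 'G2_m))%R : T))%:E))%E.
    rewrite ge0_integral_sum//; last first.
    - by move=> u w _; apply: sume_ge0 => v _; rewrite lee_fin.
    - by move=> u; apply: emeasurable_sum => v; exact/measurable_EFinP.
    under eq_bigr => u _.
      rewrite ge0_integral_sum//; last first.
      - by move=> v w _; rewrite lee_fin.
      - by move=> v; exact/measurable_EFinP.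
      under eq_bigr => v _ do rewrite trans.
      rewrite cst//.
      over.
    by rewrite cst ?mule_ge0 ?lee_fin// muleA -EFinM.
  apply: eq_integral => w _ /=; rewrite -(S w) -sumEFin.
  by apply: eq_bigr => u _; rewrite sumEFin.
(* An infinite integral would contradict that [K] is finite and positive. *)
case: I1 I0 {trans} => [x _|_|//].
  rewrite -EFinM => -[/eqP]; rewrite -{2}[K]mulr1 => /eqP /mulfI ->//.
  by rewrite gt_eqF.
by rewrite gt0_muley// lte_fin.
Qed.

End LpNorms.

(** * Partial Fourier sums as averages of translates *)

Section FourierSums.
Variables (R : realType) (m : nat -> nat).
Hypothesis m_ge2 : forall k, (2 <= m k)%N.
Local Notation T := (borel 'G2_m).
Local Notation nc := (@Normc.normc R).
Local Notation psi := (@vil_psi R m).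
Local Notation M k := (vilM m k).
Implicit Types (f g : 'G2_m -> R[i]) (z w : 'G2_m) (c : nat -> nat -> R[i]).

Definition trig_poly N N' c z : R[i] :=
  \sum_(0 <= i < M N) \sum_(0 <= j < M N') c i j * psi i z.1 * psi j z.2.

Lemma eq_trig_poly N N' c c' z :
  (forall i j, (i < M N)%N -> (j < M N')%N -> c i j = c' i j) ->
  trig_poly N N' c z = trig_poly N N' c' z.
Proof.
move=> cc'; apply: eq_big_nat => i /andP[_ iN].
by apply: eq_big_nat => j /andP[_ jN]; rewrite cc'.
Qed.

Lemma trig_polyD N N' c c' z :
  trig_poly N N' (fun i j => c i j + c' i j) z = trig_poly N N' c z + trig_poly N N' c' z.
Proof.
rewrite /trig_poly -big_split; apply: eq_bigr => i _.
by rewrite -big_split; apply: eq_bigr => j _; rewrite !mulrDl.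
Qed.

Lemma trig_polyZ N N' (a : R[i]) c z :
  trig_poly N N' (fun i j => a * c i j) z = a * trig_poly N N' c z.
Proof.
rewrite /trig_poly mulr_sumr; apply: eq_bigr => i _.
by rewrite mulr_sumr; apply: eq_bigr => j _; rewrite !mulrA.
Qed.

Lemma trig_poly_shift N N' (u v : vilenkin m) c z :
  trig_poly N N' (fun i j => c i j * psi i u * psi j v) z = trig_poly N N' c ((u, v) + z).
Proof.
apply: eq_bigr => i _; apply: eq_bigr => j _.
rewrite /= !vil_psiD//.
by move: (psi i u) (psi j v) (psi i z.1) (psi j z.2) => a b a' b'; ring.
Qed.

Variable mu : probability T R.
Hypothesis mu_haar : is_haar mu.

(** Convolution with the product Dirichlet kernel; as that kernel is even, it can be written with
    [z + w], a mean of translates over a box. *)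
Definition vil_average N N' f z : R[i] :=
  cintegral mu (fun w => (vil_dirac2 R N N' w)%:C%C * f (z + w)).

Lemma vil_dirac2_cmeasurable N N' :
  cmeasurable (fun w : 'G2_m => (vil_dirac2 R N N' w)%:C%C).
Proof.
by split; [exact: measurable_vil_dirac2|exact: measurable_cst].
Qed.

Lemma vil_dirac2_ge0 N N' (w : T) : 0 <= vil_dirac2 R N N' w.
Proof. by rewrite mulr_ge0 ?vil_dirac_ge0. Qed.

Lemma vil_dirac_le N (x : vilenkin m) : vil_dirac R N x <= (M N)%:R.
Proof. by rewrite /vil_dirac; case: ifP. Qed.

Lemma normc_vil_dirac2 N N' (w : T) :
  nc (vil_dirac2 R N N' w)%:C%C = vil_dirac2 R N N' w.
Proof. by rewrite normc_real ger0_norm// vil_dirac2_ge0. Qed.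

Lemma vil_dirac2_le N N' (w : T) :
  nc (vil_dirac2 R N N' w)%:C%C <= (M N)%:R * (M N')%:R.
Proof.
by rewrite normc_vil_dirac2 ler_pM ?vil_dirac_ge0 ?vil_dirac_le.
Qed.

Lemma vil_average_cintegrable N N' f z : cintegrable mu f ->
  cintegrable mu (fun w => (vil_dirac2 R N N' w)%:C%C * f (z + w)).
Proof.
move=> fi; apply: cintegrable_bounded; first exact: cintegrable_translate.
  exact: vil_dirac2_cmeasurable.
exact: vil_dirac2_le.
Qed.


Lemma vil_averageB N N' f g z : cintegrable mu f -> cintegrable mu g ->
  vil_average N N' (fun z => f z - g z) z = vil_average N N' f z - vil_average N N' g z.
Proof.
move=> fi gi; have gi' := vil_average_cintegrable N N' z gi.
have fi' := vil_average_cintegrable N N' z fi.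
rewrite -mulN1r /vil_average -(cintegralZ _ gi') -(cintegralD fi' (cintegrableZ _ gi')).
by congr cintegral; apply/funext => w; rewrite mulrBr mulN1r.
Qed.

Lemma vil_average_translate N N' f a z :
  vil_average N N' (fun z => f (a + z)) z = vil_average N N' f (a + z).
Proof. by congr cintegral; apply/funext => w; rewrite addrA. Qed.

(** Under the integral, the characters of z - w sum to the Dirichlet kernel; substituting z + w for
    w and using evenness gives the average. *)
Lemma fourier_partial_sum N N' f z : cintegrable mu f ->
  trig_poly N N' (fourier_coef mu f) z = vil_average N N' f z.
Proof.
move=> fi.
pose e i j w := psi i (z.1 - w.1) * psi j (z.2 - w.2).
have me i j : cmeasurable (e i j).
  apply: (@cmeasurable_locally_constant _ _ _ (maxn i.+1 j.+1)) => x y h1 h2.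
  have I1 : vilI i.+1 ((z.1 - y.1) - (z.1 - x.1)).
    rewrite (_ : _ - _ = - (y.1 - x.1)); last by rewrite !opprB addrC addrA subrK.
    by apply: vilIN; apply: vilI_le h1; exact: leq_maxl.
  have I2 : vilI j.+1 ((z.2 - y.2) - (z.2 - x.2)).
    rewrite (_ : _ - _ = - (y.2 - x.2)); last by rewrite !opprB addrC addrA subrK.
    by apply: vilIN; apply: vilI_le h2; exact: leq_maxr.
  by rewrite /e (vil_psi_locally_constant R m_ge2 I1) (vil_psi_locally_constant R m_ge2 I2).
have ei i j : cintegrable mu (fun w => e i j w * f w).
  apply: (cintegrable_bounded fi (me i j) (K := 1)) => w.
  by rewrite /e Normc.normcM !normc_vil_psi// mulr1.
have fc i j : fourier_coef mu f i j * psi i z.1 * psi j z.2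
    = cintegral mu (fun w => e i j w * f w).
  (* The integrand of the coefficient differs from that of [ei] by a constant of modulus 1. *)
  have fci : cintegrable mu (fun w => f w * (psi i w.1)^* * (psi j w.2)^*).
    have := cintegrableZ (psi i z.1 * psi j z.2)^* (ei i j).
    rewrite (_ : (fun _ => _) = (fun w => f w * (psi i w.1)^* * (psi j w.2)^*))//.
    apply/funext => w; rewrite /e !vil_psiD// !vil_psiN//.
    have h1 := @vil_psi_conj R m i z.1; have h2 := @vil_psi_conj R m j z.2.
    transitivity ((psi i z.1 * (psi i z.1)^*) * (psi j z.2 * (psi j z.2)^*)
       * (f w * (psi i w.1)^* * (psi j w.2)^*)).
      rewrite rmorphM /=.
      move: (psi i z.1) (psi j z.2) (psi i z.1)^* (psi j z.2)^*
        (psi i w.1)^* (psi j w.2)^* (f w) => a b a1 b1 a' b' x; ring.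
    by rewrite h1 h2 !mul1r.
  rewrite -mulrA mulrC /fourier_coef -(cintegralZ _ fci).
  congr cintegral; apply/funext => w; rewrite /e !vil_psiD// !vil_psiN//.
  by move: (psi i z.1) (psi j z.2) (psi i w.1)^* (psi j w.2)^* (f w) => a b a' b' x; ring.
rewrite /trig_poly; under eq_bigr do under eq_bigr do rewrite fc.
under eq_bigr do rewrite -cintegral_sum//.
rewrite -cintegral_sum//; last by move=> i; exact: cintegrable_sum.
have Dz w : \sum_(0 <= i < M N) \sum_(0 <= j < M N') e i j w * f w
    = (vil_dirac2 R N N' (z - w))%:C%C * f w.
  rewrite /vil_dirac2 rmorphM /= !vil_diracE// mulr_suml mulr_suml.
  by apply: eq_bigr => i _; rewrite mulr_sumr mulr_suml.
have gi : cintegrable mu (fun w => (vil_dirac2 R N N' (z - w))%:C%C * f w).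
  rewrite (_ : (fun _ => _) = (fun w => \sum_(0 <= i < M N) \sum_(0 <= j < M N') e i j w * f w)).
    by apply: cintegrable_sum => i; exact: cintegrable_sum.
  by apply/funext => w; rewrite Dz.
under [X in cintegral mu X]eq_fun => w do rewrite Dz.
rewrite -(cintegral_translate m_ge2 mu_haar z gi); congr cintegral.
apply/funext => w; rewrite opprD addrA subrr add0r /vil_dirac2 /=.
by rewrite !vil_diracN.
Qed.

Lemma cintegral_vil_dirac2 N N' :
  cintegral mu (fun w => (vil_dirac2 R N N' w)%:C%C) = 1.
Proof.
rewrite /cintegral /= /Rintegral integral_vil_dirac2//=.
by rewrite integral0.
Qed.

Variable p : \bar R.
Hypothesis p1 : (1 <= p)%E.
Local Notation Lp_fun := (Lp_fun mu p).
Local Notation Lp_real := (Lp_real mu p).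

Lemma Lp_realD f g : Lp_fun f -> Lp_fun g ->
  Lp_real (fun z => f z + g z) <= Lp_real f + Lp_real g.
Proof.
move=> Lf Lg; rewrite -lee_fin EFinD -!Lp_realE//; last exact: Lp_funD.
by case: Lf Lg => mf _ [mg _]; exact: LpnormD.
Qed.

Lemma Lp_realZ (a : R[i]) f : Lp_fun f ->
  Lp_real (fun z => a * f z) <= nc a * Lp_real f.
Proof.
by move=> Lf; rewrite -lee_fin -Lp_realE//; [exact: LpnormZ|exact: Lp_funZ].
Qed.

Lemma Lp_realB f g : Lp_fun f -> Lp_fun g ->
  Lp_real (fun z => f z - g z) <= Lp_real f + Lp_real g.
Proof.
move=> Lf Lg.
have -> : (fun z => f z - g z) = (fun z => f z + -1 * g z).
  by apply/funext => z; rewrite mulN1r.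
have h : Lp_real (fun z => f z + -1 * g z) <= Lp_real f + Lp_real (fun z => -1 * g z).
  by apply: Lp_realD => //; exact: Lp_funZ.
apply: (le_trans h); rewrite lerD2l; have := Lp_realZ (-1) Lg.
by rewrite normc_opp Normc.normc1 mul1r.
Qed.

Lemma Lp_real_translate f w : Lp_fun f -> Lp_real (fun z => f (w + z)) = Lp_real f.
Proof. by move=> [mf _]; rewrite /Lp_real Lpnorm_translate. Qed.

Lemma Lp_fun_trig_poly N N' c : Lp_fun (trig_poly N N' c).
Proof.
apply: Lp_fun_sum => // i; apply: Lp_fun_sum => // j.
rewrite (_ : (fun _ => _) = (fun z : 'G2_m => c i j * (psi i z.1 * psi j z.2))); last first.
  by apply/funext => z; rewrite mulrA.
apply: Lp_funZ => //; apply: (@Lp_fun_bounded _ _ mu _ p1 _ 1).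
  by apply: cmeasurableM; [exact: cmeasurable_vil_psi1|exact: cmeasurable_vil_psi2].
by move=> z; rewrite Normc.normcM !normc_vil_psi// mulr1.
Qed.

(** Translation by (u, v) multiplies the coefficient (i, j) by psi_i(u) psi_j(v), so the shift axiom
    is invariance of the norm. *)
Lemma coef_seminorm_Lp N N' :
  coef_seminorm m N N' (fun c => Lp_real (trig_poly N N' c)).
Proof.
split=> [c|c c' cc'|c c'|a c|u v c].
- exact: Lp_real_ge0.
- by congr Lp_real; apply/funext => z; exact: eq_trig_poly.
- rewrite (_ : trig_poly N N' _ = (fun z => trig_poly N N' c z + trig_poly N N' c' z)).
    by apply: Lp_realD; exact: Lp_fun_trig_poly.
  by apply/funext => z; rewrite trig_polyD.
- rewrite (_ : trig_poly N N' _ = (fun z => a * trig_poly N N' c z)).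
    by apply: Lp_realZ; exact: Lp_fun_trig_poly.
  by apply/funext => z; rewrite trig_polyZ.
- rewrite (_ : trig_poly N N' _ = (fun z => trig_poly N N' c ((u, v) + z))).
    by apply: Lp_real_translate; exact: Lp_fun_trig_poly.
  by apply/funext => z; rewrite trig_poly_shift.
Qed.

Lemma Lp_real_average N N' (Phi : 'G2_m -> 'G2_m -> R[i]) f (C : R) :
  measurable_fun [set: T * T] (fun zw => nc (Phi zw.1 zw.2)) ->
  (forall z, cintegrable mu (Phi z)) -> Lp_fun f -> 0 <= C ->
  (forall z, f z = cintegral mu (fun w => (vil_dirac2 R N N' w)%:C%C * Phi z w)) ->
  (forall w : 'G2_m, vilI N w.1 -> vilI N' w.2 ->
     (Lpnorm mu p (fun z => Phi z w) <= C%:E)%E) ->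
  Lp_real f <= C.
Proof.
move=> mPhi iPhi Lf C0 fE PhiC; rewrite -lee_fin -Lp_realE//.
apply: (@Lpnorm_average _ _ _ _ p1 (vil_dirac2 R N N') Phi) => //.
- exact: measurable_vil_dirac2.
- exact: vil_dirac2_ge0.
- exact: integral_vil_dirac2.
- by case: Lf.
- move=> z; rewrite fE.
  have ci : cintegrable mu (fun w => (vil_dirac2 R N N' w)%:C%C * Phi z w).
    apply: cintegrable_bounded => //; first exact: vil_dirac2_cmeasurable.
    exact: vil_dirac2_le.
  apply: le_trans (normc_cintegral_le ci) _.
  under eq_integral => w _ do rewrite Normc.normcM normc_vil_dirac2 mulrC.
  exact: lexx.
(* A nonzero weight forces both coordinates into the box. *)
- move=> w Dw; apply: PhiC.
    by move: Dw; rewrite /vil_dirac2 /vil_dirac; case: asboolP => // _; rewrite mul0r eqxx.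
  by move: Dw; rewrite /vil_dirac2 /vil_dirac; case: (asboolP (vilI N' _)) => // _; rewrite mulr0 eqxx.
Qed.

Lemma measurable_normc_sum f : cmeasurable f ->
  measurable_fun [set: T * T] (fun zw => nc (f ((zw.1 : 'G2_m) + (zw.2 : 'G2_m)))).
Proof.
move=> mf; have mnf := measurable_cnormc mf.
exact: (measurableT_comp mnf (measurable_vil_sum m_ge2)).
Qed.

Lemma vil_average_contraction N N' f : Lp_fun f ->
  Lp_real (vil_average N N' f) <= Lp_real f.
Proof.
move=> Lf; have fi := Lp_fun_cintegrable p1 Lf.
apply: (@Lp_real_average N N' (fun z w => f (z + w))) => //.
- by apply: measurable_normc_sum; case: Lf.
- by move=> z; exact: cintegrable_translate.
- rewrite (_ : vil_average N N' f = trig_poly N N' (fourier_coef mu f)).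
    exact: Lp_fun_trig_poly.
  by apply/funext => z; rewrite fourier_partial_sum.
- exact: Lp_real_ge0.
- move=> w _ _.
  have -> : (fun z => f (z + w)) = (fun z => f (w + z)).
    by apply/funext => z; rewrite addrC.
  by rewrite Lpnorm_translate// ?(Lp_realE p1 Lf)//; case: Lf.
Qed.

Lemma vil_average_approx N N' f (C : R) : Lp_fun f -> 0 <= C ->
  (forall w : 'G2_m, vilI N w.1 -> vilI N' w.2 ->
     (Lpnorm mu p (fun z => f (w + z) - f z)%R <= C%:E)%E) ->
  Lp_real (fun z => vil_average N N' f z - f z) <= C.
Proof.
move=> Lf C0 fC; have fi := Lp_fun_cintegrable p1 Lf.
have ici z : cintegrable mu (fun=> f z).
  by apply: (Lp_fun_cintegrable p1); apply: (@Lp_fun_bounded _ _ mu _ p1 _ (nc (f z))) => //; exact: cmeasurable_cst.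
apply: (@Lp_real_average N N' (fun z w => f (z + w) - f z)) => //.
- have mf : cmeasurable f by case: Lf.
  have ReB (x y : R[i]) : complex.Re (x - y) = complex.Re x - complex.Re y.
    by case: x; case: y.
  have ImB (x y : R[i]) : complex.Im (x - y) = complex.Im x - complex.Im y.
    by case: x; case: y.
  have m1 : measurable_fun [set: T * T]
      (fun zw => complex.Re (f ((zw.1 : 'G2_m) + (zw.2 : 'G2_m)) - f zw.1)).
    rewrite (_ : (fun _ => _) = (fun zw : T * T =>
      complex.Re (f ((zw.1 : 'G2_m) + (zw.2 : 'G2_m))) - complex.Re (f zw.1))).
      apply: measurable_funB; first exact: (measurableT_comp mf.1 (measurable_vil_sum m_ge2)).
      exact: (measurableT_comp mf.1 measurable_fst).
    by apply/funext => zw; rewrite ReB.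
  have m2 : measurable_fun [set: T * T]
      (fun zw => complex.Im (f ((zw.1 : 'G2_m) + (zw.2 : 'G2_m)) - f zw.1)).
    rewrite (_ : (fun _ => _) = (fun zw : T * T =>
      complex.Im (f ((zw.1 : 'G2_m) + (zw.2 : 'G2_m))) - complex.Im (f zw.1))).
      apply: measurable_funB; first exact: (measurableT_comp mf.2 (measurable_vil_sum m_ge2)).
      exact: (measurableT_comp mf.2 measurable_fst).
    by apply/funext => zw; rewrite ImB.
  exact: measurable_normc.
- move=> z; rewrite (_ : (fun _ => _) = (fun w => f (z + w) + -1 * f z)).
    apply: cintegrableD; first exact: cintegrable_translate.
    exact: cintegrableZ.
  by apply/funext => w; rewrite mulN1r.
- apply: (Lp_funB p1 _ Lf).
  rewrite (_ : vil_average N N' f = trig_poly N N' (fourier_coef mu f)).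
    exact: Lp_fun_trig_poly.
  by apply/funext => z; rewrite fourier_partial_sum.
(* The kernel has integral 1, so f z is itself an average of the constant f z and can be subtracted
   under the integral. *)
- move=> z; rewrite -{1}[f z]mulr1 -(cintegral_vil_dirac2 N N') -mulNr.
  have i1 : cintegrable mu (fun w => (vil_dirac2 R N N' w)%:C%C).
    apply: (Lp_fun_cintegrable p1); apply: (@Lp_fun_bounded _ _ mu _ p1 _ ((M N)%:R * (M N')%:R)).
      exact: vil_dirac2_cmeasurable.
    exact: vil_dirac2_le.
  rewrite -cintegralZ// -cintegralD//; last exact: cintegrableZ.
    by congr cintegral; apply/funext => w; rewrite mulrBr mulNr [f z * _]mulrC.
  exact: vil_average_cintegrable.
- move=> w h1 h2.
  have -> : (fun z => f (z + w) - f z) = (fun z => f (w + z) - f z).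
    by apply/funext => z; rewrite [z + w]addrC.
  exact: fC.
Qed.

End FourierSums.

(** * Moduli of continuity and differences of partial sums *)

Section Moduli.
Variables (R : realType) (m : nat -> nat).
Hypothesis m_ge2 : forall k, (2 <= m k)%N.
Local Notation T := (borel 'G2_m).
Local Notation nc := (@Normc.normc R).
Local Notation psi := (@vil_psi R m).
Local Notation M k := (vilM m k).
Implicit Types (f g : 'G2_m -> R[i]) (z w : 'G2_m) (u v : vilenkin m).
Variable mu : probability T R.
Hypothesis mu_haar : is_haar mu.
Variable p : \bar R.
Hypothesis p1 : (1 <= p)%E.
Variable f : 'G2_m -> R[i].
Hypothesis Lf : Lp_fun mu p f.
Local Notation Lp_fun := (Lp_fun mu p).
Local Notation Lp_real := (Lp_real mu p).

Let fi : cintegrable mu f. Proof. exact: (Lp_fun_cintegrable p1 Lf). Qed.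

Definition diff1 u z : R[i] := f (z.1 - u, z.2) - f z.
Definition diff2 v z : R[i] := f (z.1, z.2 - v) - f z.
Definition diff12 (uv : 'G2_m) z : R[i] :=
  f (z.1 - uv.1, z.2 - uv.2) - f (z.1 - uv.1, z.2) - f (z.1, z.2 - uv.2) + f z.

Let Lf_shift w : Lp_fun (fun z => f (w + z)).
Proof. exact: Lp_fun_translate. Qed.

Let diff1E u : diff1 u = (fun z => f ((- u, 0) + z) - f z).
Proof.
by apply/funext => z; rewrite /diff1; congr (f _ - _); apply: injective_projections;
  rewrite /= ?add0r// addrC.
Qed.

Let diff2E v : diff2 v = (fun z => f ((0, - v) + z) - f z).
Proof.
by apply/funext => z; rewrite /diff2; congr (f _ - _); apply: injective_projections;
  rewrite /= ?add0r// addrC.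
Qed.

Let diff12E u v : diff12 (u, v) = (fun z => diff1 u ((0, - v) + z) - diff1 u z).
Proof.
apply/funext => z; rewrite /diff12 /diff1 /= add0r.
have -> : (0, - v) + z = (z.1, z.2 - v).
  by apply: injective_projections; rewrite /= ?add0r// addrC.
rewrite [- v + _]addrC opprB addrA [RHS]addrAC.
by rewrite -!addrA; congr (_ + _); rewrite addrCA addrC -!addrA.
Qed.

Lemma Lp_fun_diff1 u : Lp_fun (diff1 u).
Proof. by rewrite diff1E; exact: Lp_funB. Qed.

Lemma Lp_fun_diff2 v : Lp_fun (diff2 v).
Proof. by rewrite diff2E; exact: Lp_funB. Qed.

Lemma Lp_fun_diff12 u v : Lp_fun (diff12 (u, v)).
Proof.
rewrite diff12E; apply: (Lp_funB p1) (Lp_fun_diff1 u).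
by apply: Lp_fun_translate => //; exact: Lp_fun_diff1.
Qed.

(** Only serves to make the moduli finite, so the constant is crude. *)
Lemma Lp_real_diff1 u : Lp_real (diff1 u) <= 4 * Lp_real f.
Proof.
rewrite diff1E; apply: le_trans (Lp_realB p1 (Lf_shift _) Lf) _.
rewrite (Lp_real_translate m_ge2 mu_haar p1 _ Lf).
have := Lp_real_ge0 mu p1 f; lra.
Qed.

Lemma Lp_real_diff2 v : Lp_real (diff2 v) <= 4 * Lp_real f.
Proof.
rewrite diff2E; apply: le_trans (Lp_realB p1 (Lf_shift _) Lf) _.
rewrite (Lp_real_translate m_ge2 mu_haar p1 _ Lf).
have := Lp_real_ge0 mu p1 f; lra.
Qed.

Lemma Lp_real_diff12 u v : Lp_real (diff12 (u, v)) <= 8 * Lp_real f.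
Proof.
have L1 := Lp_fun_diff1 u.
rewrite diff12E; apply: le_trans (Lp_realB p1 (Lp_fun_translate m_ge2 p1 mu_haar _ L1) L1) _.
rewrite (Lp_real_translate m_ge2 mu_haar p1 _ L1).
have := Lp_real_diff1 u; lra.
Qed.

(** The moduli are suprema in the extended reals; a uniform bound lets the estimates be carried out
    with real numbers. *)
Let sup_fin (I : Type) (S : set I) (F : I -> 'G2_m -> R[i]) (C : R) (i0 : I) :
  S i0 -> (forall i, S i -> Lp_fun (F i)) -> (forall i, S i -> Lp_real (F i) <= C) ->
  let s := ereal_sup [set Lpnorm mu p (F i) | i in S] in
  s = (fine s)%:E /\ forall i, S i -> Lp_real (F i) <= fine s.
Proof.
move=> Si0 LF FC s.
have s0 : (0 <= s)%E.
  apply: (le_trans (Lpnorm_ge0 mu p1 (F i0))).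
  by apply: ereal_sup_ubound; exists i0.
have sC : (s <= C%:E)%E.
  by apply: ge_ereal_sup => _ [i Si <-]; rewrite (Lp_realE p1 (LF i Si)) lee_fin FC.
have sE : s = (fine s)%:E.
  by rewrite fineK// ge0_fin_numE// (le_lt_trans sC)// ltry.
split=> // i Si; rewrite -lee_fin -sE -(Lp_realE p1 (LF i Si)).
by apply: ereal_sup_ubound; exists i.
Qed.

Lemma omega1_fin r : omega1 mu p f r = (fine (omega1 mu p f r))%:E /\
  forall u, vilI r u -> Lp_real (diff1 u) <= fine (omega1 mu p f r).
Proof.
apply: (@sup_fin _ _ diff1 (4 * Lp_real f) 0) => // u _.
  exact: Lp_fun_diff1.
exact: Lp_real_diff1.
Qed.

Lemma omega2_fin r : omega2 mu p f r = (fine (omega2 mu p f r))%:E /\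
  forall v, vilI r v -> Lp_real (diff2 v) <= fine (omega2 mu p f r).
Proof.
apply: (@sup_fin _ _ diff2 (4 * Lp_real f) 0) => // v _.
  exact: Lp_fun_diff2.
exact: Lp_real_diff2.
Qed.

Lemma omega12_fin r s : omega12 mu p f r s = (fine (omega12 mu p f r s))%:E /\
  forall u v, vilI r u -> vilI s v ->
    Lp_real (diff12 (u, v)) <= fine (omega12 mu p f r s).
Proof.
have [h1 h2] := @sup_fin _ (vilI r `*` vilI s) diff12 (8 * Lp_real f) (0, 0)
  (conj (@vilI0 m r) (@vilI0 m s)) (fun uv _ => let: (u, v) := uv in Lp_fun_diff12 u v)
  (fun uv _ => let: (u, v) := uv in Lp_real_diff12 u v).
by split=> // u v Iu Iv; exact: (h2 (u, v)).
Qed.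

Lemma omega1_le r s : (r <= s)%N -> fine (omega1 mu p f s) <= fine (omega1 mu p f r).
Proof.
move=> rs; rewrite -lee_fin -(omega1_fin s).1 -(omega1_fin r).1.
apply: ge_ereal_sup => _ [u Iu <-]; apply: ereal_sup_ubound.
by exists u => //; exact: vilI_le Iu.
Qed.

Lemma omega2_le r s : (r <= s)%N -> fine (omega2 mu p f s) <= fine (omega2 mu p f r).
Proof.
move=> rs; rewrite -lee_fin -(omega2_fin s).1 -(omega2_fin r).1.
apply: ge_ereal_sup => _ [u Iu <-]; apply: ereal_sup_ubound.
by exists u => //; exact: vilI_le Iu.
Qed.

Variables N N' : nat.
Local Notation c := (fourier_coef mu f).
Local Notation P := (@trig_poly R m N N').
Local Notation E := (vil_average mu N N').

Let PE z : P c z = E f z. Proof. exact: fourier_partial_sum. Qed.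

(** Translation by -u multiplies coefficients by psi_i(-u), and the average commutes with
    translations. *)
Let average_diff1 u : P (fun i j => (psi i (- u) - 1) * c i j) = E (diff1 u).
Proof.
apply/funext => z; rewrite diff1E vil_averageB//; last by case: (Lp_fun_cintegrable p1 (Lf_shift (- u, 0))).
rewrite vil_average_translate -!PE -trig_poly_shift// -(mulN1r (P c z)) -trig_polyZ -trig_polyD.
by apply: eq_trig_poly => i j _ _; rewrite vil_psi0; ring.
Qed.

Let average_diff2 v : P (fun i j => (psi j (- v) - 1) * c i j) = E (diff2 v).
Proof.
apply/funext => z; rewrite diff2E vil_averageB//; last by case: (Lp_fun_cintegrable p1 (Lf_shift (0, - v))).
rewrite vil_average_translate -!PE -trig_poly_shift// -(mulN1r (P c z)) -trig_polyZ -trig_polyD.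
by apply: eq_trig_poly => i j _ _; rewrite vil_psi0; ring.
Qed.

Let average_diff12 u v :
  P (fun i j => (psi i (- u) - 1) * ((psi j (- v) - 1) * c i j)) = E (diff12 (u, v)).
Proof.
have di := Lp_fun_cintegrable p1 (Lp_fun_diff1 u).
apply/funext => z; rewrite diff12E vil_averageB//; last exact: cintegrable_translate.
rewrite vil_average_translate -!average_diff1 -trig_poly_shift//.
rewrite -(mulN1r (P (fun i j => (psi i (- u) - 1) * c i j) z)) -trig_polyZ -trig_polyD.
by apply: eq_trig_poly => i j _ _; rewrite vil_psi0; ring.
Qed.

Lemma Lp_real_fourier_diff1 r u : vilI r u ->
  Lp_real (P (fun i j => (psi i (- u) - 1) * c i j)) <= fine (omega1 mu p f r).
Proof.
move=> Iu; rewrite average_diff1; apply: le_trans ((omega1_fin r).2 u Iu).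
by apply: vil_average_contraction => //; exact: Lp_fun_diff1.
Qed.

Lemma Lp_real_fourier_diff2 r v : vilI r v ->
  Lp_real (P (fun i j => (psi j (- v) - 1) * c i j)) <= fine (omega2 mu p f r).
Proof.
move=> Iv; rewrite average_diff2; apply: le_trans ((omega2_fin r).2 v Iv).
by apply: vil_average_contraction => //; exact: Lp_fun_diff2.
Qed.

Lemma Lp_real_fourier_diff12 r s u v : vilI r u -> vilI s v ->
  Lp_real (P (fun i j => (psi i (- u) - 1) * ((psi j (- v) - 1) * c i j)))
    <= fine (omega12 mu p f r s).
Proof.
move=> Iu Iv; rewrite average_diff12; apply: le_trans ((omega12_fin r s).2 u v Iu Iv).
by apply: vil_average_contraction => //; exact: Lp_fun_diff12.
Qed.

Lemma Lp_real_fourier_approx :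
  Lp_real (fun z => P c z - f z) <= fine (omega1 mu p f N) + fine (omega2 mu p f N').
Proof.
have -> : (fun z => P c z - f z) = (fun z => E f z - f z).
  by apply/funext => z; rewrite PE.
have [_ W1] := omega1_fin N; have [_ W2] := omega2_fin N'.
apply: vil_average_approx => //.
  apply: addr_ge0.
    by apply: le_trans (W1 0 _) => //; exact: Lp_real_ge0.
  by apply: le_trans (W2 0 _) => //; exact: Lp_real_ge0.
move=> w h1 h2; have I1 := vilIN h1; have I2 := vilIN h2.
have L1 := Lp_fun_diff1 (- w.1); have L2 := Lp_fun_diff2 (- w.2).
(* The first coordinate is moved at the already shifted second coordinate, then the second one; the
   shift does not affect the norm of the first difference. *)
have -> : (fun z => f (w + z) - f z) =
    (fun z => diff1 (- w.1) ((0, w.2) + z) + diff2 (- w.2) z).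
  apply/funext => z; rewrite /diff1 /diff2 !opprK /=.
  have -> : (0, w.2) + z = (z.1, z.2 + w.2).
    by apply: injective_projections; rewrite /= ?add0r// addrC.
  rewrite add0r addrA [w.2 + _]addrC subrK; congr (f _ - _).
  by apply: injective_projections; rewrite /= addrC.
have L1' := Lp_fun_translate m_ge2 p1 mu_haar (0, w.2) L1.
apply: (@le_trans _ _ (Lp_real (fun z => diff1 (- w.1) ((0, w.2) + z)) + Lp_real (diff2 (- w.2)))%:E).
  by rewrite EFinD -!Lp_realE//; case: L1' L2 => m1 _ [m2 _]; exact: LpnormD.
rewrite lee_fin lerD ?W2// (Lp_real_translate m_ge2 mu_haar p1 _ L1).
exact: W1.
Qed.

End Moduli.

(** The multiplier vanishes beyond [n], so the sums may be prolonged from [n] to any full range [0,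
    M_N) containing [n]. *)
Lemma cesaro_mean_trig_poly (R : realType) (m : nat -> nat)
    (mu : probability (borel (vilenkin m * vilenkin m)%type) R) (alpha beta : R)
    (n n' N N' : nat) (f : vilenkin m * vilenkin m -> R[i]) :
  (n < vilM m N)%N -> (n' < vilM m N')%N ->
  cesaro_mean mu (- alpha) (- beta) n n' f =
  trig_poly N N' (fun i j =>
    (cesaro_multiplier alpha n i * cesaro_multiplier beta n' j)%:C%C * fourier_coef mu f i j).
Proof.
move=> nN nN'; apply/funext => z; rewrite /cesaro_mean /trig_poly.
have trunc (k K : nat) (F : nat -> R[i]) : (k < K)%N ->
    (forall i, (k < i)%N -> F i = 0) ->
    \sum_(0 <= i < K) F i = \sum_(0 <= i < k.+1) F i.
  move=> kK F0; rewrite (@big_cat_nat _ _ _ k.+1)//= [X in _ + X]big_nat_cond.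
  by rewrite [X in _ + X]big1 ?addr0// => i; rewrite andbT => /andP[/F0].
rewrite [in RHS](trunc n (vilM m N))//; last first.
  move=> i ni; rewrite big1// => j _.
  by rewrite /cesaro_multiplier leqNgt ni/= !mul0r.
rewrite mulr_sumr; apply: eq_big_nat => i /andP[_ ni].
rewrite [in RHS](trunc n' (vilM m N'))//; last first.
  move=> j nj; rewrite (_ : cesaro_multiplier beta n' j = 0) ?mulr0 ?mul0r//.
  by rewrite /cesaro_multiplier leqNgt nj.
rewrite mulr_sumr; apply: eq_big_nat => j /andP[_ nj].
rewrite /cesaro_multiplier -ltnS ni -ltnS nj.
move: (cesaro_number (- alpha) n) (cesaro_number (- beta) n')
  (cesaro_number (- alpha) (n - i)) (cesaro_number (- beta) (n' - j)) => a b a' b'.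
have -> : a' / a * (b' / b) = (a * b)^-1 * (a' * b') by rewrite invfM; ring.
have RM (x y : R) : (x * y)%:C%C = x%:C%C * y%:C%C by exact: rmorphM.
rewrite (RM _ (a' * b')).
by rewrite !mulrA.
Qed.

Theorem theorem1 (R : realType) (m : nat -> nat)
    (m_ge2 : forall k, (2 <= m k)%N)
    (m_bounded : exists B, forall k, (m k <= B)%N)
    (alpha beta : R) (alpha01 : 0 < alpha < 1) (beta01 : 0 < beta < 1) :
  exists2 c : R, 0 < c &
    forall mu : probability (borel (vilenkin m * vilenkin m)%type) R,
      is_haar mu ->
    forall p : \bar R, (1 <= p)%E ->
    forall f : vilenkin m * vilenkin m -> R[i], in_Lp mu p f ->
    forall k l n n' : nat, (1 <= k)%N -> (1 <= l)%N ->
      (vilM m k <= n < vilM m k.+1)%N ->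
      (vilM m l <= n' < vilM m l.+1)%N ->
    (Lpnorm mu p (fun z => cesaro_mean mu (- alpha) (- beta) n n' f z - f z)%R
     <= c%:E *
        (omega1 mu p f k.-1 * ((vilM m k)%:R `^ alpha)%R%:E
         + omega2 mu p f l.-1 * ((vilM m l)%:R `^ beta)%R%:E
         + omega12 mu p f k.-1 l.-1
             * ((vilM m k)%:R `^ alpha * (vilM m l)%:R `^ beta)%R%:E
         + \sum_(0 <= r < k.-1)
             ((vilM m r)%:R / (vilM m k)%:R)%R%:E * omega1 mu p f r
         + \sum_(0 <= s < l.-1)
             ((vilM m s)%:R / (vilM m l)%:R)%R%:E * omega2 mu p f s))%E.
Proof.
have [B m_leB] := m_bounded.
pose C (a : R) := 1 + cesaro_const B a + cesaro_low_const B a + cesaro_low_const B a * B%:R.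
have C0 a : 0 < a < 1 -> 0 <= C a.
  move=> a01; have := cesaro_const_ge0 B a01; have := cesaro_low_const_ge0 B a01.
  rewrite /C; move: (cesaro_const B a) (cesaro_low_const B a) => x y *.
  by rewrite !addr_ge0// mulr_ge0.
have K0 : 0 <= C alpha * C beta by rewrite mulr_ge0 ?C0.
(* The additional 1 pays for replacing f by its partial sum. *)
exists (C alpha * C beta + 1); first by rewrite ltr_wpDl.
move=> mu mu_haar p p1 f inLp k l n n' k1 l1 kn ln.
have Lf := in_Lp_fun p1 inLp.
have [kn1 kn2] := andP kn; have [ln1 ln2] := andP ln.
(* The smallest levels for which n < M_(k+1) and n' < M_(l+1) are guaranteed, so the partial sum has
   the same means as f. *)
pose N := k.+1; pose N' := l.+1; pose c := fourier_coef mu f.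
pose W1 r := fine (omega1 mu p f r); pose W2 r := fine (omega2 mu p f r).
pose W12 := fine (omega12 mu p f k.-1 l.-1).
pose lam i j := cesaro_multiplier alpha n i * cesaro_multiplier beta n' j.
have o1 r := omega1_fin m_ge2 mu_haar p1 Lf r.
have o2 r := omega2_fin m_ge2 mu_haar p1 Lf r.
have o12 := omega12_fin m_ge2 mu_haar p1 Lf k.-1 l.-1.
have kN : (0 < k < N)%N by rewrite k1 /N ltnSn.
have lN : (0 < l < N')%N by rewrite l1 /N' ltnSn.
have := coef_seminorm_cesaro m_ge2 m_leB (c := c) (W1 := W1) (W2 := W2) (W12 := W12)
  alpha01 beta01 kN lN kn ln
  (coef_seminorm_Lp m_ge2 mu_haar p1 N N')
  (fun r u Iu => Lp_real_fourier_diff1 m_ge2 mu_haar p1 Lf N N' Iu)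
  (fun r v Iv => Lp_real_fourier_diff2 m_ge2 mu_haar p1 Lf N N' Iv)
  (fun u v Iu Iv => Lp_real_fourier_diff12 m_ge2 mu_haar p1 Lf N N' Iu Iv).
rewrite -/(C alpha) -/(C beta).
set X := (vilM m k)%:R `^ alpha; set Y := (vilM m l)%:R `^ beta.
set S1 := \sum_(0 <= r < k.-1) _; set S2 := \sum_(0 <= s < l.-1) _.
move=> main.
have W1ge0 r : 0 <= W1 r by apply: le_trans ((o1 r).2 0 _) => //; exact: Lp_real_ge0.
have W2ge0 r : 0 <= W2 r by apply: le_trans ((o2 r).2 0 _) => //; exact: Lp_real_ge0.
have W12ge0 : 0 <= W12 by apply: le_trans (o12.2 0 0 _ _) => //; exact: Lp_real_ge0.
have powR_ge1 (a : R) q : 0 < a < 1 -> 1 <= (vilM m q)%:R `^ a.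
  move=> /andP[a0 _]; have : (vilM m q)%:R `^ 0 <= (vilM m q)%:R `^ a.
    by rewrite ler_powR ?ler1n ?vilM_gt0// ltW.
  by rewrite powRr0.
have X1 : 1 <= X by exact: powR_ge1.
have Y1 : 1 <= Y by exact: powR_ge1.
have S1ge0 : 0 <= S1 by apply: sumr_ge0 => r _; rewrite mulr_ge0// divr_ge0.
have S2ge0 : 0 <= S2 by apply: sumr_ge0 => r _; rewrite mulr_ge0// divr_ge0.
set Q := W1 k.-1 * X + W2 l.-1 * Y + W12 * (X * Y) + S1 + S2 in main.
(* All moduli are finite, so the right-hand side is a real number. *)
have -> : (omega1 mu p f k.-1 * X%:E + omega2 mu p f l.-1 * Y%:E
      + omega12 mu p f k.-1 l.-1 * (X * Y)%R%:E
      + \sum_(0 <= r < k.-1) ((vilM m r)%:R / (vilM m k)%:R)%R%:E * omega1 mu p f r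
      + \sum_(0 <= s < l.-1) ((vilM m s)%:R / (vilM m l)%:R)%R%:E * omega2 mu p f s)%E
    = Q%:E.
  rewrite (o1 k.-1).1 (o2 l.-1).1 o12.1.
  under eq_bigr => r _ do rewrite (o1 r).1 -EFinM.
  under [X in (_ + X)%E]eq_bigr => r _ do rewrite (o2 r).1 -EFinM.
  by rewrite !sumEFin -!EFinM -!EFinD.
have approx := Lp_real_fourier_approx m_ge2 mu_haar p1 Lf N N'.
have cE := cesaro_mean_trig_poly mu alpha beta f kn2 ln2.
have LP c' := Lp_fun_trig_poly m_ge2 mu p1 N N' c'.
have -> : (fun z => cesaro_mean mu (- alpha) (- beta) n n' f z - f z) =
    (fun z => trig_poly N N' (fun i j => (lam i j - 1)%:C%C * c i j) z
       + (trig_poly N N' c z - f z)).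
  apply/funext => z; rewrite cE addrA; congr (_ - _).
  rewrite -trig_polyD; apply: eq_trig_poly => i j _ _.
  by rewrite rmorphB /= mulrBl mul1r subrK.
have LB := Lp_funB p1 (LP c) Lf.
rewrite (Lp_realE p1 (Lp_funD p1 (LP _) LB)) -EFinM lee_fin.
apply: le_trans (Lp_realD p1 (LP _) LB) _.
rewrite mulrDl mul1r lerD//; apply: (le_trans approx).
(* The approximation error involves the modulus at level [k.+1], which monotonicity and [1 <= X]
   absorb into the first term. *)
have w1 : W1 N <= W1 k.-1 * X.
  apply: (@le_trans _ _ (W1 k.-1)); last by rewrite ler_peMr.
  by apply: omega1_le => //; rewrite (leq_trans (leq_pred _)).
have w2 : W2 N' <= W2 l.-1 * Y.
  apply: (@le_trans _ _ (W2 l.-1)); last by rewrite ler_peMr.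
  by apply: omega2_le => //; rewrite (leq_trans (leq_pred _)).
apply: (le_trans (lerD w1 w2)); rewrite /Q -!addrA lerD2l lerDl.
have X0 : 0 <= X by exact: le_trans X1.
have Y0 : 0 <= Y by exact: le_trans Y1.
by rewrite !addr_ge0// !mulr_ge0.
Qed.
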